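(* Let $0<q_1,q_2\le1$ and $q_1\le\lambda_1\le1$ satisfy $\frac{q_2}{\lambda_2}=\frac{q_1}{\lambda_1}$, and let $\beta\neq n\left(\frac1{\lambda_1}-\frac1{\lambda_2}\right)$. Then there exists $\sigma(D)\in Op\Sigma^{-\beta}(\mathbb{R}^n)$ which is not continuous from $\mathcal{HM}_{q_1}^{\lambda_1}(\mathbb{R}^n)$ to $\mathcal{HM}_{q_2}^{\lambda_2}(\mathbb{R}^n)$.
   Context: For $0<q\le\lambda<\infty$ and measurable $g$ on $\mathbb{R}^n$, set $\|g\|_{\mathcal{M}_q^\lambda}:=\sup_Q |Q|^{1/\lambda-1/q}\big(\int_Q|g(y)|^q\,dy\big)^{1/q}$, the supremum being over all cubes $Q\subset\mathbb{R}^n$. Fix $\varphi\in\mathcal{S}(\mathbb{R}^n)$ with $\int\varphi\neq0$ and put $\varphi_t(x)=t^{-n}\varphi(x/t)$. For $f\in\mathcal{S}'(\mathbb{R}^n)$ let $M_\varphi f(x)=\sup_{0<t<\infty}|\varphi_t*f(x)|$. The Hardy-Morrey space $\mathcal{HM}_q^\lambda(\mathbb{R}^n)$ is the set of $f\in\mathcal{S}'(\mathbb{R}^n)$ with $\|f\|_{\mathcal{HM}_q^\lambda}:=\|M_\varphi f\|_{\mathcal{M}_q^\lambda}<\infty$ (independent of the choice of $\varphi$ up to equivalence of quasi-norms). For $m\in\mathbb{R}$, $\Sigma^m(\mathbb{R}^n)$ is the set of $\sigma\in C^\infty(\mathbb{R}^n\setminus\{0\})$ such that for every multi-index $\alpha\in\mathbb{N}_0^n$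 there is $C_\alpha$ with $|\partial^\alpha\sigma(\xi)|\le C_\alpha|\xi|^{m-|\alpha|}$ for $\xi\ne0$. $Op\Sigma^m(\mathbb{R}^n)$ is the set of Fourier multiplier operators $\sigma(D)$ with $\sigma\in\Sigma^m(\mathbb{R}^n)$, given by $\sigma(D)u(x)=\int_{\mathbb{R}^n}e^{2\pi i x\cdot\xi}\sigma(\xi)\widehat u(\xi)\,d\xi$ with $\widehat u(\xi)=\int e^{-2\pi i x\cdot\xi}u(x)\,dx$, i.e. $\widehat{\sigma(D)u}=\sigma\,\widehat u$. Continuity from $\mathcal{HM}_{q_1}^{\lambda_1}$ to $\mathcal{HM}_{q_2}^{\lambda_2}$ means boundedness: there is $C>0$ with $\|\sigma(D)u\|_{\mathcal{HM}_{q_2}^{\lambda_2}}\le C\|u\|_{\mathcal{HM}_{q_1}^{\lambda_1}}$ for all $u\in\mathcal{HM}_{q_1}^{\lambda_1}(\mathbb{R}^n)$. *)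

(* Defs.v *)
From HB Require Import structures.
From mathcomp Require Import all_boot all_order all_algebra.
From mathcomp Require Import complex.
From mathcomp Require Import all_classical all_reals all_analysis.

Set Implicit Arguments.
Unset Strict Implicit.
Unset Printing Implicit Defensive.

Import Order.TTheory GRing.Theory Num.Theory.
Import numFieldNormedType.Exports.

Local Open Scope classical_set_scope.
Local Open Scope complex_scope.
Local Open Scope ring_scope.

Definition measure_rV_display : measure_display.
Proof. exact: default_measure_display. Qed.

(* The Borel sigma-algebra: the smallest one making the coordinates
   measurable. *)
Section measurable_rV.
Context {R : realType} {n : nat}.

Let coord (i : 'I_n) (x : 'rV[R]_n) : measurableTypeR R := x 0 i.

Let rV_set0 : g_sigma_preimage coord set0.
Proof. exact: sigma_algebra0. Qed.

Let rV_setC A : g_sigma_preimage coord A -> g_sigma_preimage coord (~` A).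
Proof. exact: sigma_algebraC. Qed.

Let rV_bigcup (F : _^nat) : (forall i, g_sigma_preimage coord (F i)) ->
  g_sigma_preimage coord (\bigcup_i (F i)).
Proof. exact: sigma_algebra_bigcup. Qed.

HB.instance Definition _ := @isMeasurable.Build measure_rV_display
  'rV[R]_n (g_sigma_preimage coord) rV_set0 rV_setC rV_bigcup.

Lemma measurable_rV_coord (i : 'I_n) :
  measurable_fun [set: 'rV[R]_n] (coord i).
Proof.
move=> _ Y mY; rewrite setTI; apply: sub_sigma_algebra => /=.
rewrite -bigcup_seq/=; exists i => /=; first by rewrite mem_index_enum.
by exists Y => //; rewrite setTI.
Qed.

Lemma measurable_fun_rV d (T : measurableType d) (f : T -> 'rV[R]_n) :
  (forall i, measurable_fun [set: T] (coord i \o f)) ->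
  measurable_fun [set: T] f.
Proof.
move=> mf; apply: (@measurability _ _ _ _ [set: T] f
  (\big[setU/set0]_(i < n)
     preimage_set_system setT (coord i) (@measurable _ (measurableTypeR R)))).
  by [].
move=> _ [A + <-].
rewrite -bigcup_seq => -[i _ [B mB <-]].
by rewrite !setTI -comp_preimage -[X in measurable X]setTI; exact: mf.
Qed.

End measurable_rV.

Section lebesgue_rV_step.
Context {R : realType} {n : nat}.

Definition rV_cons (p : measurableTypeR R * 'rV[R]_n) : 'rV[R]_n.+1 :=
  \row_i oapp (fun j => p.2 0 j) p.1 (unlift ord0 i).

Definition rV_uncons (x : 'rV[R]_n.+1) : measurableTypeR R * 'rV[R]_n :=
  (x 0 ord0, \row_j x 0 (lift ord0 j)).

Lemma rV_consK : cancel rV_cons rV_uncons.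
Proof.
move=> [a x]; rewrite /rV_uncons /rV_cons mxE unlift_none/=; congr pair.
by apply/rowP => j; rewrite !mxE liftK.
Qed.

Lemma measurable_rV_cons : measurable_fun setT rV_cons.
Proof.
apply: measurable_fun_rV => i.
case: (unliftP ord0 i) => [j ij|i0].
  rewrite (_ : _ \o _ = (fun x : 'rV[R]_n => x 0 j : measurableTypeR R) \o snd).
    by apply: measurableT_comp; [exact: measurable_rV_coord|].
  by apply/funext => -[a x]; rewrite /= mxE ij liftK.
rewrite (_ : _ \o _ = fst); first exact: measurable_fst.
by apply/funext => -[a x]; rewrite /= mxE i0 unlift_none.
Qed.

Lemma measurable_rV_uncons : measurable_fun setT rV_uncons.
Proof.
apply/measurable_fun_pairP; split; first exact: measurable_rV_coord.
apply: measurable_fun_rV => j.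
rewrite (_ : _ \o _ = fun x : 'rV[R]_n.+1 => x 0 (lift ord0 j)).
  exact: measurable_rV_coord.
by apply/funext => x /=; rewrite mxE.
Qed.

Variable m : {sigma_finite_measure set 'rV[R]_n -> \bar R}.

Definition lebesgue_rV_step : set 'rV[R]_n.+1 -> \bar R :=
  pushforward (lebesgue_measure \x m)%E rV_cons.

Let step0 : lebesgue_rV_step set0 = 0%E.
Proof. by rewrite /lebesgue_rV_step /pushforward preimage_set0 measure0. Qed.

Let step_ge0 A : (0 <= lebesgue_rV_step A)%E.
Proof.
apply: (@measure_ge0 _ _ _ (pushforward (lebesgue_measure \x m)%E rV_cons)).
exact: measurable_rV_cons.
Qed.

Let step_sigma_additive : semi_sigma_additive lebesgue_rV_step.
Proof.
apply: (@measure_semi_sigma_additive _ _ _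
  (pushforward (lebesgue_measure \x m)%E rV_cons)).
exact: measurable_rV_cons.
Qed.

HB.instance Definition _ := isMeasure.Build _ _ _ lebesgue_rV_step
  step0 step_ge0 step_sigma_additive.

Let step_sigma_finite : sigma_finite setT lebesgue_rV_step.
Proof.
have /sigma_finiteP[F [TF ndF Foo]] := sigma_finiteT (@lebesgue_measure R).
have /sigma_finiteP[G [TG ndG Goo]] := sigma_finiteT m.
exists (fun k => rV_uncons @^-1` (F k `*` G k)).
  rewrite -preimage_bigcup (_ : \bigcup_k _ = setT) ?preimage_setT//.
  rewrite -setXTT TF TG predeqE => -[x y]; split.
    by move=> [k _ []/= ? ?]; split; exists k.
  move=> [/= [k _ Fkx] [l _ Gly]]; exists (maxn k l) => //; split.
  - by move: x Fkx; exact/subsetPset/ndF/leq_maxl.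
  - by move: y Gly; exact/subsetPset/ndG/leq_maxr.
move=> k; have [mF Fk] := Foo k; have [mG Gk] := Goo k; split.
  rewrite -[X in measurable X]setTI; apply: measurable_rV_uncons => //.
  exact: measurableX.
rewrite /lebesgue_rV_step /pushforward -comp_preimage.
rewrite (_ : _ \o _ = id) ?preimage_id; last first.
  by apply/funext => p; exact: rV_consK.
by rewrite product_measure1E// lte_mul_pinfty// ge0_fin_numE.
Qed.

HB.instance Definition _ := @Measure_isSigmaFinite.Build _ _ _
  lebesgue_rV_step step_sigma_finite.

End lebesgue_rV_step.

(* The n-fold product of the one-dimensional Lebesgue measure. *)
Fixpoint lebesgue_rV (R : realType) (n : nat) :
    {sigma_finite_measure set 'rV[R]_n -> \bar R} :=
  match n with
  | 0 => @dirac _ 'rV[R]_0 0 R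
  | n'.+1 => lebesgue_rV_step (lebesgue_rV R n')
  end.

Section complex_functions.
Context {R : realType} {n : nat}.
Implicit Types (f g : 'rV[R]_n -> R[i]) (x xi : 'rV[R]_n) (a : 'I_n -> nat).

Definition enorm x : R := Num.sqrt (\sum_(i < n) x 0 i ^+ 2).

Definition dotp x xi : R := \sum_(i < n) x 0 i * xi 0 i.

(* [Normc.normc] is the modulus with values in [R]. *)
Definition cnorm (z : R[i]) : R := Normc.normc z.

Definition cintegral f : R[i] :=
  (\int[lebesgue_rV R n]_x complex.Re (f x)) +i*
  (\int[lebesgue_rV R n]_x complex.Im (f x)).

Definition partial (i : 'I_n) f : 'rV[R]_n -> R[i] := fun x =>
  ('D_(delta_mx 0 i) (fun y => complex.Re (f y)) x) +i*
  ('D_(delta_mx 0 i) (fun y => complex.Im (f y)) x).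

(* [f] is C^oo on the open set [U]: every iterated partial derivative
   d_(i_1) ... d_(i_k) f is (Frechet) differentiable at every point of [U]. *)
Definition smooth_on (U : set 'rV[R]_n) f : Prop :=
  forall (w : seq 'I_n) x, U x ->
    differentiable (fun y => complex.Re (foldr partial f w y)) x /\
    differentiable (fun y => complex.Im (foldr partial f w y)) x.

Definition morder a : nat := (\sum_(i < n) a i)%N.

Definition mpartial a f : 'rV[R]_n -> R[i] :=
  foldr (fun i => iter (a i) (partial i)) f (enum 'I_n).

Definition mmonom a x : R := \prod_(i < n) x 0 i ^+ a i.

Definition schwartz_seminorm (N : nat) f : \bar R :=
  ereal_sup [set y | exists (a b : 'I_n -> nat) (x : 'rV[R]_n),
    [/\ (morder a <= N)%N, (morder b <= N)%N &
    y = (`|mmonom a x| * cnorm (mpartial b f x))%:E]].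

Definition schwartz f : Prop :=
  smooth_on setT f /\ forall N, (schwartz_seminorm N f < +oo)%E.

(* A distribution is a functional on all functions, of which only the values
   on Schwartz functions are meaningful. *)
Definition tempered (u : ('rV[R]_n -> R[i]) -> R[i]) : Prop :=
  (forall (c : R[i]) f g, schwartz f -> schwartz g ->
     u (fun x => c * f x + g x) = c * u f + u g) /\
  exists (N : nat) (C : R), forall f, schwartz f ->
    ((cnorm (u f))%:E <= C%:E * schwartz_seminorm N f)%E.

Definition cis (theta : R) : R[i] := cos theta +i* sin theta.

Definition fourier f : 'rV[R]_n -> R[i] := fun xi =>
  cintegral (fun x => cis (- (2 * pi * dotp x xi)) * f x).

Definition dist_fourier (u : ('rV[R]_n -> R[i]) -> R[i]) :
    ('rV[R]_n -> R[i]) -> R[i] :=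
  fun psi => u (fourier psi).

Definition dist_conv f (u : ('rV[R]_n -> R[i]) -> R[i]) : 'rV[R]_n -> R[i] :=
  fun x => u (fun y => f (x - y)).

Definition dilate (t : R) f : 'rV[R]_n -> R[i] :=
  fun x => (t ^- n)%:C * f (t^-1 *: x).

Definition cube (c : 'rV[R]_n) (r : R) : set 'rV[R]_n :=
  [set x | forall i, c 0 i <= x 0 i <= c 0 i + r].

Definition morrey_norm (q lam : R) (g : 'rV[R]_n -> \bar R) : \bar R :=
  ereal_sup [set y | exists (c : 'rV[R]_n) (r : R), 0 < r /\
    y = (poweR (lebesgue_rV R n (cube c r)) (lam^-1 - q^-1)%R *
         poweR (\int[lebesgue_rV R n]_(x in cube c r) poweR `|g x| q) q^-1%R)%E].

Definition maximal (phi : 'rV[R]_n -> R[i])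
    (u : ('rV[R]_n -> R[i]) -> R[i]) : 'rV[R]_n -> \bar R :=
  fun x => ereal_sup
    [set (cnorm (dist_conv (dilate t phi) u x))%:E | t in [set t : R | 0 < t]].

Definition hm_norm (phi : 'rV[R]_n -> R[i]) (q lam : R)
    (u : ('rV[R]_n -> R[i]) -> R[i]) : \bar R :=
  morrey_norm q lam (maximal phi u).

Definition hardy_morrey (phi : 'rV[R]_n -> R[i]) (q lam : R) :
    set (('rV[R]_n -> R[i]) -> R[i]) :=
  [set u | tempered u /\ (hm_norm phi q lam u < +oo)%E].

(* The symbol class Sigma^m; the value of [sigma] at 0 is irrelevant. *)
Definition symbol_class (m : R) : set ('rV[R]_n -> R[i]) :=
  [set sigma | smooth_on [set xi | xi != 0] sigma /\
    forall a, exists C : R, forall xi, xi != 0 ->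
      cnorm (mpartial a sigma xi) <= C * enorm xi `^ (m - (morder a)%:R)].

(* [v] is sigma(D)u: the Fourier transform of [v] is sigma times that of [u].
   As sigma may be singular at 0, the product makes sense as a distribution on
   R^n \ {0}, i.e. against Schwartz functions vanishing near 0. This determines
   [v] up to a polynomial, and since a nonzero polynomial has infinite
   Hardy-Morrey quasi-norm, at most one such [v] lies in a given Hardy-Morrey
   space. *)
Definition is_multiplier (sigma : 'rV[R]_n -> R[i])
    (u v : ('rV[R]_n -> R[i]) -> R[i]) : Prop :=
  forall psi, schwartz psi ->
    (exists2 e : R, 0 < e & forall xi, enorm xi < e -> psi xi = 0) ->
    dist_fourier v psi = dist_fourier u (fun xi => sigma xi * psi xi).

Definition hm_continuous (phi : 'rV[R]_n -> R[i]) (q1 lam1 q2 lam2 : R)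
    (sigma : 'rV[R]_n -> R[i]) : Prop :=
  exists2 C : R, 0 < C & forall u, hardy_morrey phi q1 lam1 u ->
    exists2 v, hardy_morrey phi q2 lam2 v & is_multiplier sigma u v /\
      (hm_norm phi q2 lam2 v <= C%:E * hm_norm phi q1 lam1 u)%E.

End complex_functions.

(* Main.v *)
From HB Require Import structures.
Require Import Defs.
From mathcomp Require Import all_boot all_order all_algebra.
From mathcomp Require Import complex.
From mathcomp Require Import all_classical all_reals all_analysis.
From mathcomp Require Import measurable_realfun ring lra.

Set Implicit Arguments.
Unset Strict Implicit.
Unset Printing Implicit Defensive.

Import Order.TTheory GRing.Theory Num.Theory.
Import numFieldNormedType.Exports.

Local Open Scope classical_set_scope.
Local Open Scope complex_scope.
Local Open Scope ring_scope.

(** The Riesz symbol sigma(xi) = |xi| ^ (- beta) is homogeneous, and an operator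
    that is homogeneous cannot be bounded between two scale invariant spaces
    unless the exponents match. Let u be a Schwartz function whose Fourier
    transform is supported in an annulus, and let v be the function whose
    transform is sigma times that of u. For u_t(x) = u(t x), the quasi-norm of
    u_t is of order t ^ (- n / lam1), while sigma(D) u_t = t ^ (- beta) v_t has
    quasi-norm of order t ^ (- beta - n / lam2). Boundedness would make
    t ^ (n / lam1 - n / lam2 - beta) bounded over all t > 0, although its
    exponent is not 0.

    Three points carry this argument. First, sigma is a symbol: its derivatives
    are homogeneous of the right degree, because a class of explicit homogeneous
    functions is stable under differentiation ([homogeneous_diff]). Secondly,
    the quasi-norms of u and v are finite even for small exponents q. This
    requires maximal functions of arbitrarily fast polynomial decay, and so
    vanishing moments: u and v are taken to be derivatives of high order
    ([maximal_decay], [morrey_decay]).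

    Thirdly, a bounded operator would only provide some w in the target space
    whose Fourier transform is that of t ^ (- beta) v_t off the origin, and the
    lower bound is needed for w ([maximal_unique]). The difference D of the two
    distributions has its spectrum at the origin, so that differences of high
    order annihilate it ([spectrum_at_origin_diffh]); D behaves like a
    polynomial without having been identified with one. A mollification G of D
    then satisfies |G(x)| ^ q <= K sum_j |G(x + j h)| ^ q for all steps h, and
    averaging over h in a cube of side r bounds |G(x)| ^ q by the mean of
    |G| ^ q over cubes of side comparable to r, which tends to 0 in a Morrey
    space as r grows ([annihilated_by_differences]). Hence G = 0, and w has the
    maximal function of t ^ (- beta) v_t.

    The earlier parts build the calculus that this uses: integration over R^n
    with affine changes of variable, the Schwartz class as a class stable under
    derivatives, products and the Fourier transform, and Fourier inversion. The
    inversion formula is only established up to a nonzero constant, which is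
    all that supports and homogeneity can see. *)

(** * Lebesgue measure on row vectors *)

Lemma integral_image d1 d2 (X : measurableType d1) (Y : measurableType d2)
    (R : realType) (phi : X -> Y) (mphi : measurable_fun setT phi)
    (mu : {measure set X -> \bar R}) (f : Y -> \bar R) :
  measurable_fun setT f -> (forall y, 0 <= f y)%E ->
  (\int[pushforward mu phi]_y f y = \int[mu]_x f (phi x))%E.
Proof.
by move=> mf f0; rewrite (ge0_integral_pushforward mphi)// preimage_setT.
Qed.

Section measure_on_rV.
Context {R : realType}.
Local Notation leb := (@lebesgue_measure R).

Lemma integral_rV0 (f : 'rV[R]_0 -> \bar R) :
  (\int[lebesgue_rV R 0]_x f x = f 0%R)%E.
Proof.
rewrite /= integral_dirac//; first by rewrite diracT mul1e.
rewrite (_ : f = cst (f 0%R)); first exact: measurable_cst.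
by apply/funext => x; rewrite (thinmx0 x).
Qed.

Lemma tonelli_rV n (f : 'rV[R]_n.+1 -> \bar R) :
  measurable_fun setT f -> (forall x, 0 <= f x)%E ->
  (\int[lebesgue_rV R n.+1]_x f x =
   \int[leb]_a \int[lebesgue_rV R n]_x f (rV_cons (a, x)))%E.
Proof.
move=> mf f0.
have E := integral_image (@measurable_rV_cons R n) (leb \x lebesgue_rV R n)%E mf f0.
transitivity (\int[leb \x lebesgue_rV R n]_p (f \o rV_cons) p)%E; first exact: E.
apply: fubini_tonelli1; last by move=> p; exact: f0.
by apply: measurableT_comp => //; exact: measurable_rV_cons.
Qed.

Lemma lebesgue_affine (c r : R) (A : set (measurableTypeR R)) : 0 < r ->
  measurable A ->
  leb ((fun x : measurableTypeR R => (c + r * x) : measurableTypeR R) @^-1` A) =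
  ((r^-1)%:E * leb A)%E.
Proof.
move=> r0 mA.
pose g (x : measurableTypeR R) : measurableTypeR R := c + r * x.
have mg : measurable_fun setT g.
  apply: continuous_measurable_fun => x.
  by apply: cvgD; [exact: cvg_cst|apply: cvgM; [exact: cvg_cst|exact: cvg_id]].
pose m1 : {measure set (measurableTypeR R) -> \bar R} :=
  mscale (NngNum (ltW r0)) (pushforward leb g : {measure set _ -> \bar R}).
have := @lebesgue_measure_unique R (m1 mg).
have r0' : r != 0 by rewrite gt_eqF.
move=> /(_ _ A mA) ->; last first.
  move=> _ [[a b]] _ <-.
  rewrite /m1/= /mscale/= /pushforward.
  have -> : g @^-1` `]a, b]%classic = `](a - c) / r, (b - c) / r]%classic.
    apply/seteqP; split => x /=; rewrite /g !in_itv/= ltr_pdivrMr// ler_pdivlMr//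
      ltrBlDr lerBrDr ![_ + c]addrC ![x * r]mulrC//.
  rewrite !lebesgue_measure_itv/= !lte_fin ltr_pdivrMr// divrK ?unitfE// ltrD2r.
  case: ifP => // _; last by rewrite mule0.
  by rewrite -!EFinB -EFinM; congr EFin; field.
by rewrite /m1/= /mscale/= muleA -EFinM mulVf// mul1e.
Qed.

Lemma integral_affine1 (c r : R) (f : measurableTypeR R -> \bar R) : r != 0 ->
  measurable_fun setT f -> (forall x, 0 <= f x)%E ->
  (\int[leb]_x f (c + r * x)%R = (`|r|^-1)%:E * \int[leb]_x f x)%E.
Proof.
move=> r0 mf f0.
have pos (c' r' : R) (g : measurableTypeR R -> \bar R) : 0 < r' ->
    measurable_fun setT g -> (forall x, 0 <= g x)%E ->
    (\int[leb]_x g (c' + r' * x)%R = (r'^-1)%:E * \int[leb]_x g x)%E.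
  move=> r'0 mg g0.
  pose h (x : measurableTypeR R) : measurableTypeR R := c' + r' * x.
  have mh : measurable_fun setT h.
    apply: continuous_measurable_fun => x.
    by apply: cvgD; [exact: cvg_cst|apply: cvgM; [exact: cvg_cst|exact: cvg_id]].
  have -> : (\int[leb]_x g (c' + r' * x)%R = \int[pushforward leb h]_x g x)%E.
    by rewrite (integral_image mh).
  have ri0 : 0 <= r'^-1 by rewrite invr_ge0 ltW.
  have := @ge0_integral_mscale _ _ _ leb setT measurableT (NngNum ri0) g.
  move=> /(_ mg (fun x _ => g0 x)) /= <-.
  apply: eq_measure_integral => A mA _.
  by rewrite /= /pushforward lebesgue_affine.
have [rp|rn] := ltP 0 r; first by rewrite pos// gtr0_norm.
have rn' : 0 < - r by rewrite oppr_gt0 lt_neqAle r0.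
rewrite ler0_norm// -(pos c)//.
have mN : measurable_fun setT (-%R : measurableTypeR R -> measurableTypeR R).
  by apply: continuous_measurable_fun => x; exact: cvgN.
have mg : measurable_fun setT (fun x : measurableTypeR R => f (c + - r * x)).
  apply: measurableT_comp => //.
  apply: (@continuous_measurable_fun R (fun x => c + - r * x)) => x.
  by apply: cvgD; [exact: cvg_cst|apply: cvgM; [exact: cvg_cst|exact: cvg_id]].
transitivity (\int[leb]_x f (c + - r * (- x))%R)%E.
  by apply: eq_integral => x _; rewrite mulrNN.
rewrite (_ : (\int[leb]_x f (c + - r * - x)%R = \int[pushforward leb (-%R : _ -> measurableTypeR R)]_x f (c + - r * x)%R)%E).
  by apply: eq_measure_integral => A mA _; exact: lebesgue_measureN.
by rewrite (integral_image mN).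
Qed.

Lemma measurable_affine n (c : 'rV[R]_n) (r : R) :
  measurable_fun setT (fun x : 'rV[R]_n => c + r *: x).
Proof.
apply: measurable_fun_rV => i.
rewrite (_ : _ \o _ = (fun x : 'rV[R]_n => (c 0 i + r * x 0 i) : measurableTypeR R)); last first.
  by apply/funext => x /=; rewrite !mxE.
apply: measurable_funD => //; apply: measurable_funM => //.
exact: measurable_rV_coord.
Qed.

Lemma integral_affine n (c : 'rV[R]_n) (r : R) (f : 'rV[R]_n -> \bar R) :
  r != 0 -> measurable_fun setT f -> (forall x, 0 <= f x)%E ->
  (\int[lebesgue_rV R n]_x f (c + r *: x)%R =
   (`|r| ^- n)%:E * \int[lebesgue_rV R n]_x f x)%E.
Proof.
move=> r0; elim: n c f => [|n IH] c f mf f0.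
  by rewrite !integral_rV0 expr0 invr1 mul1e (thinmx0 (c + r *: 0)).
rewrite tonelli_rV//; last exact: measurableT_comp mf (measurable_affine c r).
pose c' : 'rV[R]_n := \row_j c 0 (lift ord0 j).
have mfc a : measurable_fun setT (fun x => f (rV_cons (a, x))).
  apply: measurableT_comp => //.
  apply: (measurableT_comp (@measurable_rV_cons R n)).
  exact: measurable_pair1.
transitivity (\int[leb]_a ((`|r| ^- n)%:E *
    \int[lebesgue_rV R n]_x f (rV_cons ((c 0 ord0 + r * a)%R, x))))%E.
  apply: eq_integral => a _; rewrite -(IH c' _ (mfc _))//.
  apply: eq_integral => x _; congr f; apply/rowP => i; rewrite !mxE.
  by case: (unliftP ord0 i) => [j ->|->]; rewrite ?liftK ?unlift_none //= !mxE.
have mF : measurable_fun setT (fun a : measurableTypeR R =>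
    \int[lebesgue_rV R n]_x f (rV_cons (a, x)))%E.
  apply: (@measurable_fun_fubini_tonelli_F _ _ _ _ _ _ (f \o rV_cons)).
  - by apply: measurableT_comp => //; exact: measurable_rV_cons.
  - by move=> p; exact: f0.
have F0 a : (0 <= \int[lebesgue_rV R n]_x f (rV_cons (a, x)))%E.
  by apply: integral_ge0 => x _; exact: f0.
rewrite ge0_integralZl//; last first.
  apply: (measurableT_comp mF).
  apply: (@continuous_measurable_fun R (fun x => c 0 ord0 + r * x)) => x.
  by apply: cvgD; [exact: cvg_cst|apply: cvgM; [exact: cvg_cst|exact: cvg_id]].
rewrite (@integral_affine1 (c 0 ord0) r (fun a => \int[lebesgue_rV R n]_x f (rV_cons (a, x)))%E)//.
by rewrite -tonelli_rV// muleA -EFinM exprSr invfM.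
Qed.

Definition rV_round n (k : nat) (z : 'I_n -> int) : 'rV[R]_n :=
  \row_i ((z i)%:~R / k.+1%:R).

(** The sigma-algebra is generated by the coordinates, hence continuity does not
    give measurability at once. But f is the limit of its values at the corners
    of the grid of mesh 1 / (k + 1), and a function of countably many corners is
    measurable. *)
Lemma continuous_measurable_rV n (f : 'rV[R]_n -> R) :
  continuous f -> measurable_fun setT (f : 'rV[R]_n -> measurableTypeR R).
Proof.
move=> cf.
pose g (k : nat) (x : 'rV[R]_n) : {ffun 'I_n -> int} :=
  [ffun i => Num.floor (k.+1%:R * x 0 i)].
have cvx (x : 'rV[R]_n) : rV_round k (g k x) @[k --> \oo] --> x.
  apply/cvgrPdist_le => e e0.
  have [N HN] : exists N : nat, e^-1 <= N%:R.
    exists (Num.bound e^-1); apply: ltW; apply: archi_boundP.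
    by rewrite invr_ge0 ltW.
  exists N => // k /= Nk.
  rewrite /Num.norm/=.
  have : mx_norm (x - rV_round k (g k x)) <= e.
    rewrite mx_normrE; apply/bigmax_leP; split => [|[i j] _ /=]; first exact: ltW.
    rewrite ord1 !mxE ffunE.
    have k0 : (0 : R) < k.+1%:R by rewrite ltr0n.
    have /andP[h1 h2] := Num.Theory.floor_itv (k.+1%:R * x 0 j).
    have -> : x 0 j - (Num.floor (k.+1%:R * x 0 j))%:~R / k.+1%:R =
      (k.+1%:R * x 0 j - (Num.floor (k.+1%:R * x 0 j))%:~R) / k.+1%:R.
      by field; rewrite gt_eqF.
    rewrite ger0_norm; last by rewrite divr_ge0 ?subr_ge0 ?ler0n.
    rewrite ler_pdivrMr//.
    apply: (@le_trans _ _ 1).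
      by apply: ltW; rewrite ltrBlDl; rewrite intrD in h2.
    rewrite -ler_pdivrMl// mulr1 (le_trans HN)// ler_nat; exact: leqW.
  by [].
apply: (@measurable_fun_cvg _ _ _ _
  (fun k x => f (rV_round k (g k x)))); last first.
  move=> x _; apply: (cvg_comp _ _ (cvx x)); exact: cf.
move=> k _ Y mY; rewrite setTI.
have -> : (fun x => f (rV_round k (g k x))) @^-1` Y =
  \bigcup_(z : {ffun 'I_n -> int}) ([set _ | Y (f (rV_round k z))] `&` (g k @^-1` [set z])).
  apply/seteqP; split => x /=; first by move=> Yx; exists (g k x).
  by move=> [z _ [/= Yz gz]]; rewrite gz.
apply: countable_bigcupT_measurable => [|z]; first exact: countableP.
apply: measurableI.
  have [Yz|nYz] := pselect (Y (f (rV_round k z))).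
    by rewrite (_ : [set _ | _] = setT)//; apply/seteqP; split.
  by rewrite (_ : [set _ | _] = set0)//; apply/seteqP; split.
have -> : g k @^-1` [set z] = \bigcap_(i in [set: 'I_n])
    ((fun x : 'rV[R]_n => x 0 i : measurableTypeR R) @^-1`
      [set y | Num.floor (k.+1%:R * y) = z i]).
  apply/seteqP; split => x /=.
    by move=> <- i _ /=; rewrite ffunE.
  by move=> H; apply/ffunP => i; rewrite ffunE; exact: (H i).
apply: fin_bigcap_measurable => // i _.
rewrite -[X in measurable X]setTI; apply: measurable_rV_coord => //.
have -> : [set y | Num.floor (k.+1%:R * y) = z i] =
   `[(z i)%:~R / k.+1%:R, (z i + 1)%:~R / k.+1%:R[%classic :> set R.
  apply/seteqP; split => y /=; rewrite in_itv/= ler_pdivrMr ?ltr0n//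
    ltr_pdivlMr ?ltr0n// ![y * _]mulrC.
    by move=> <-; exact: Num.Theory.floor_itv.
  by move=> H; apply: Num.Theory.floor_def.
exact: measurable_itv.
Qed.

Lemma measurable_cube n (c : 'rV[R]_n) r : measurable (cube c r).
Proof.
have -> : cube c r = \bigcap_(i in [set: 'I_n])
    ((fun x : 'rV[R]_n => x 0 i : measurableTypeR R) @^-1` `[c 0 i, c 0 i + r]%classic).
  apply/seteqP; split => x /=; first by move=> H i _ /=; rewrite in_itv/=; exact: H.
  by move=> H i; have := H i Logic.I; rewrite /= in_itv/=.
apply: fin_bigcap_measurable => // i _.
by rewrite -[X in measurable X]setTI; apply: measurable_rV_coord.
Qed.

Lemma lebesgue_cube n (c : 'rV[R]_n) (r : R) : 0 < r ->
  lebesgue_rV R n (cube c r) = (r ^+ n)%:E.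
Proof.
move=> r0; elim: n c => [|n IH] c.
  by rewrite /= diracE mem_set// => -[].
pose c' : 'rV[R]_n := \row_j c 0 (lift ord0 j).
rewrite -(setIT (cube c r)) -integral_indic//; last exact: measurable_cube.
rewrite tonelli_rV//; last first.
  by apply/measurable_EFinP; apply: measurable_indic; exact: measurable_cube.
transitivity (\int[leb]_a ((\1_(`[c 0 ord0, c 0 ord0 + r]%classic) a)%:E * (r ^+ n)%:E))%E.
  apply: eq_integral => a _; rewrite -(IH c') -(setIT (cube c' r)).
  rewrite -integral_indic//; last exact: measurable_cube.
  rewrite -ge0_integralZl//=; last first.
    by apply/measurable_EFinP; apply: measurable_indic; exact: measurable_cube.
  apply: eq_integral => x _; rewrite -EFinM !indicE -natrM mulnb.
  congr ((nat_of_bool _)%:R%:E); apply/idP/andP.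
    rewrite inE /cube/= => H; split; rewrite inE/=.
      by have := H ord0; rewrite mxE unlift_none/= in_itv/=.
    by move=> i; have := H (lift ord0 i); rewrite mxE liftK/= mxE.
  rewrite !inE/= in_itv/= => -[H1 H2] i.
  case: (unliftP ord0 i) => [j ->|->]; rewrite mxE ?liftK ?unlift_none//=.
  by have := H2 j; rewrite mxE.
rewrite ge0_integralZr//; last 2 first.
- by apply/measurable_EFinP; apply: measurable_indic; exact: measurable_itv.
- by rewrite lee_fin exprn_ge0// ltW.
rewrite integral_indic// setIT /= lebesgue_measure_itv/= lte_fin ltrDl r0.
by rewrite -EFinB -EFinM exprS; congr (_ * _)%:E; rewrite addrAC subrr add0r.
Qed.

Lemma integral_oneDsqrV_lty : (\int[leb]_x ((1 + x ^+ 2)^-1)%:E < +oo)%E.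
Proof.
have mf : measurable_fun [set: R] (fun x : R => ((1 + x ^+ 2)^-1)%:E).
  by apply/measurable_EFinP; apply: continuous_measurable_fun; exact: continuous_oneDsqrV.
have f0 (x : R) : (0 <= ((1 + x ^+ 2)^-1)%:E)%E.
  by rewrite lee_fin invr_ge0 addr_ge0// sqr_ge0.
have h := @integral0y_oneDsqr R.
have -> : [set: R] = `]-oo, 0%R[%classic `|` `[0%R, +oo[%classic.
  by apply/seteqP; split => x //= _; rewrite !in_itv/= andbT; case: (ltP x 0); [left|right].
rewrite ge0_integral_setU//; last 2 first.
- by rewrite (_ : _ `|` _ = setT)//; apply/seteqP; split => x //= _;
    rewrite !in_itv/= andbT; case: (ltP x 0); [left|right].
- apply/disj_setPS => x [] /=; rewrite !in_itv/= andbT => x0 x1.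
  by move: (lt_le_trans x0 x1); rewrite ltxx.
apply: lte_add_pinfty; last by rewrite h ltry.
apply: (@le_lt_trans _ _ (\int[leb]_(x in `]-oo, 0%R]%classic) ((1 + x ^+ 2)^-1)%:E)%E).
  apply: ge0_subset_integral => //; first exact: measurable_funS mf.
  by move=> x /=; rewrite !in_itv/=; exact: ltW.
rewrite (_ : (\int[leb]_(x in `]-oo, 0%R]%classic) _ =
  \int[leb]_(x in `]-oo, 0%R]%classic) ((1 + (- x) ^+ 2)^-1)%:E)%E).
  by rewrite -(ge0_integration_by_substitution0 mf f0) h ltry.
by apply: eq_integral => x _; rewrite sqrrN.
Qed.

Lemma coord_le_norm n (x : 'rV[R]_n) i : `|x 0 i| <= `|x|.
Proof.
rewrite /Num.norm/= mx_normrE.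
exact: (@le_bigmax _ _ _ 0 (fun ij : 'I_1 * 'I_n => `|x ij.1 ij.2|) (0, i)).
Qed.

Lemma continuous_decay n (k : nat) :
  continuous (fun x : 'rV[R]_n => (1 + `|x|) ^- k).
Proof.
move=> x; apply: (@continuous_comp _ _ _ (fun x : 'rV[R]_n => `|x|)
  (fun y : R => (1 + y) ^- k)); first exact: norm_continuous.
apply: cvgV; first by rewrite gt_eqF// exprn_gt0// ltr_pwDl.
apply: (@continuous_comp _ _ _ (fun y : R => 1 + y) (fun y => y ^+ k)).
  by apply: cvgD; [exact: cvg_cst|exact: cvg_id].
exact: exprn_continuous.
Qed.

Lemma measurable_decay n (k : nat) :
  measurable_fun setT (fun x : 'rV[R]_n => ((1 + `|x|) ^- k)%:E).
Proof.
apply/measurable_EFinP; apply: continuous_measurable_rV; exact: continuous_decay.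
Qed.

(** With the sup norm, (1 + |x|) ^ 2 >= 1 + x_i ^ 2 for each i, so the weight is
    below a product of one-dimensional integrable functions. *)
Lemma integrable_poly_decay n :
  (\int[lebesgue_rV R n]_x ((1 + `|x|) ^- (2 * n))%:E < +oo)%E.
Proof.
have mw k : measurable_fun setT (fun x : 'rV[R]_k =>
    (\prod_(i < k) (1 + x 0 i ^+ 2)^-1)%:E).
  apply/measurable_EFinP; apply: measurable_prod => i _.
  apply: (measurableT_comp (f := fun y : R => (1 + y ^+ 2)^-1)).
    by apply: continuous_measurable_fun; exact: continuous_oneDsqrV.
  exact: measurable_rV_coord.
have w0 k (x : 'rV[R]_k) : 0 <= \prod_(i < k) (1 + x 0 i ^+ 2)^-1.
  by apply: prodr_ge0 => i _; rewrite invr_ge0 addr_ge0// sqr_ge0.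
have W : (\int[lebesgue_rV R n]_x (\prod_(i < n) (1 + x 0 i ^+ 2)^-1)%:E < +oo)%E.
  elim: n => [|n IH]; first by rewrite integral_rV0 ltry.
  rewrite tonelli_rV//; last by move=> x; rewrite lee_fin; exact: w0.
  rewrite (_ : (\int[leb]_a _ = \int[leb]_a (((1 + a ^+ 2)^-1)%:E *
    \int[lebesgue_rV R n]_x (\prod_(i < n) (1 + x 0 i ^+ 2)^-1)%:E))%E); last first.
    apply: eq_integral => a _.
    rewrite -ge0_integralZl; last 4 first.
    - exact: measurableT.
    - exact: mw.
    - by move=> x _; rewrite lee_fin; exact: w0.
    - by rewrite lee_fin invr_ge0 addr_ge0// sqr_ge0.
    apply: eq_integral => x _.
    rewrite big_ord_recl mxE unlift_none/= EFinM; congr (_ * _%:E)%E.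
    by apply: eq_bigr => i _; rewrite mxE liftK.
  rewrite ge0_integralZr//=; last 3 first.
  - by apply/measurable_EFinP; apply: continuous_measurable_fun; exact: continuous_oneDsqrV.
  - by move=> x _; rewrite lee_fin invr_ge0 addr_ge0// sqr_ge0.
  - by apply: integral_ge0 => x _; rewrite lee_fin; exact: w0.
  apply: lte_mul_pinfty; last exact: IH.
    by apply: integral_ge0 => x _; rewrite lee_fin invr_ge0 addr_ge0// sqr_ge0.
  rewrite ge0_fin_numE; first exact: integral_oneDsqrV_lty.
  by apply: integral_ge0 => x _; rewrite lee_fin invr_ge0 addr_ge0// sqr_ge0.
apply: le_lt_trans W; apply: ge0_le_integral => //.
- exact: measurable_decay.
- exact: mw.
- move=> x _; rewrite lee_fin prodfV lef_pV2 ?posrE; last 2 first.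
  + by rewrite exprn_gt0// ltr_pwDl.
  + by apply: prodr_gt0 => i _; rewrite ltr_pwDl// sqr_ge0.
  have := coord_le_norm x; move: `|x| => b xb.
  rewrite exprM -[in leRHS](card_ord n) -prodr_const.
  apply: ler_prod => i _; rewrite addr_ge0 ?sqr_ge0//=.
  have := xb i; have := normr_ge0 (x 0 i).
  rewrite -(real_normK (num_real (x 0 i))).
  set a := `|x 0 i| => a0 ab; nra.
Qed.

End measure_on_rV.

(** * Integration of complex functions *)

Section complex_modulus.
Context {R : realType}.
Implicit Types z w : R[i].

Lemma cnormE z : cnorm z = Num.sqrt (complex.Re z ^+ 2 + complex.Im z ^+ 2).
Proof. by case: z. Qed.

Lemma cnorm_ge0 z : 0 <= cnorm z.
Proof. by rewrite cnormE sqrtr_ge0. Qed.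

Lemma cnorm0 : cnorm (0 : R[i]) = 0.
Proof. exact: Normc.normc0. Qed.

Lemma cnormM z w : cnorm (z * w) = cnorm z * cnorm w.
Proof. exact: Normc.normcM. Qed.

Lemma cnormD z w : cnorm (z + w) <= cnorm z + cnorm w.
Proof. exact: le_normcD. Qed.

Lemma cnormN z : cnorm (- z) = cnorm z.
Proof. exact: normcN. Qed.

Lemma cnormB z w : cnorm (z - w) <= cnorm z + cnorm w.
Proof. by rewrite -(cnormN w); exact: cnormD. Qed.

Lemma cnorm_real (a : R) : cnorm a%:C = `|a|.
Proof. by rewrite cnormE /= expr0n/= addr0 sqrtr_sqr. Qed.

Lemma cnorm_eq0 z : cnorm z = 0 -> z = 0.
Proof. exact: Normc.eq0_normc. Qed.

Lemma cnorm_gt0 z : z != 0 -> 0 < cnorm z.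
Proof.
move=> z0; rewrite lt_neqAle cnorm_ge0 andbT eq_sym.
by apply: contra z0 => /eqP/cnorm_eq0 ->.
Qed.

Lemma normr_Re_le z : `|complex.Re z| <= cnorm z.
Proof. by rewrite cnormE -sqrtr_sqr ler_wsqrtr// lerDl sqr_ge0. Qed.

Lemma normr_Im_le z : `|complex.Im z| <= cnorm z.
Proof. by rewrite cnormE -sqrtr_sqr ler_wsqrtr// lerDr sqr_ge0. Qed.

Lemma cnorm_le_ReIm z : cnorm z <= `|complex.Re z| + `|complex.Im z|.
Proof.
rewrite cnormE -[leRHS]ger0_norm ?addr_ge0// -sqrtr_sqr ler_wsqrtr//.
by rewrite sqrrD !real_normK ?num_real// -addrA lerD2l lerDr mulrn_wge0// mulr_ge0.
Qed.

Lemma cnorm_cis (t : R) : cnorm (cis t) = 1.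
Proof. by rewrite cnormE /= cos2Dsin2 sqrtr1. Qed.

Lemma cReM z w : complex.Re (z * w) =
  complex.Re z * complex.Re w - complex.Im z * complex.Im w.
Proof. by case: z; case: w. Qed.

Lemma cImM z w : complex.Im (z * w) =
  complex.Re z * complex.Im w + complex.Im z * complex.Re w.
Proof. by case: z; case: w. Qed.

Lemma cReD z w : complex.Re (z + w) = complex.Re z + complex.Re w.
Proof. by case: z; case: w. Qed.

Lemma cImD z w : complex.Im (z + w) = complex.Im z + complex.Im w.
Proof. by case: z; case: w. Qed.

Lemma cReN z : complex.Re (- z) = - complex.Re z.
Proof. by case: z. Qed.

Lemma cImN z : complex.Im (- z) = - complex.Im z.
Proof. by case: z. Qed.

Lemma complex_ext z w : complex.Re z = complex.Re w ->
  complex.Im z = complex.Im w -> z = w.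
Proof. by case: z => a b; case: w => c d /= -> ->. Qed.

End complex_modulus.

Section complex_integral.
Context {R : realType} {n : nat}.
Local Notation V := 'rV[R]_n.
Local Notation mu := (lebesgue_rV R n).
Implicit Types (f g : V -> R[i]) (b : V -> R).

Definition cmeas d (T : measurableType d) (f : T -> R[i]) :=
  measurable_fun setT (fun x => complex.Re (f x) : measurableTypeR R) /\
  measurable_fun setT (fun x => complex.Im (f x) : measurableTypeR R).

Definition rint b := mu.-integrable setT (EFin \o b).

Definition cint f := rint (@complex.Re R \o f) /\ rint (@complex.Im R \o f).

Lemma cint_dom f b : cmeas f -> rint b -> (forall x, cnorm (f x) <= b x) -> cint f.
Proof.
move=> [m1 m2] ib fb; split; apply: (le_integrable _ _ _ ib) => //.
- exact/measurable_EFinP.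
- move=> x _; rewrite lee_fin/=; apply: (le_trans (normr_Re_le _)).
  by apply: (le_trans (fb x)); exact: ler_norm.
- exact/measurable_EFinP.
- move=> x _; rewrite lee_fin/=; apply: (le_trans (normr_Im_le _)).
  by apply: (le_trans (fb x)); exact: ler_norm.
Qed.

Lemma cint_meas f : cint f -> cmeas f.
Proof. by move=> [i1 i2]; split; apply/measurable_EFinP;
  [exact: measurable_int i1|exact: measurable_int i2]. Qed.

Lemma rintZ b (c : R) : rint b -> rint (fun x => c * b x).
Proof.
move=> ib; rewrite /rint (_ : _ \o _ = (fun x => c%:E * (b x)%:E)%E)//.
exact: (@integrableZl _ _ _ mu setT measurableT c (EFin \o b)).
Qed.

Lemma rintD b b' : rint b -> rint b' -> rint (fun x => b x + b' x).
Proof.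
move=> ib ib'; rewrite /rint (_ : _ \o _ = (fun x => (b x)%:E + (b' x)%:E)%E)//.
exact: (@integrableD _ _ _ mu setT measurableT (EFin \o b) (EFin \o b')).
Qed.

Lemma rintB b b' : rint b -> rint b' -> rint (fun x => b x - b' x).
Proof.
move=> ib ib'; rewrite /rint (_ : _ \o _ = (fun x => (b x)%:E - (b' x)%:E)%E)//.
exact: (@integrableB _ _ _ mu setT measurableT (EFin \o b) (EFin \o b')).
Qed.

Lemma cint_cnorm f : cint f -> rint (fun x => cnorm (f x)).
Proof.
move=> if_; have [m1 m2] := cint_meas if_; have [i1 i2] := if_.
apply: (le_integrable _ _ _ (rintD (integrable_norm i1) (integrable_norm i2))) => //.
  apply/measurable_EFinP.
  rewrite (_ : (fun x => cnorm (f x)) = (fun x => Num.sqrt (complex.Re (f x) ^+ 2 + complex.Im (f x) ^+ 2))).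
    apply: (measurableT_comp (f := @Num.sqrt R)).
      by apply: continuous_measurable_fun; exact: sqrt_continuous.
    by apply: measurable_funD; apply: measurable_funX.
  by apply/funext => x; rewrite cnormE.
move=> x _; rewrite /= lee_fin ger0_norm ?cnorm_ge0//.
by rewrite ger0_norm ?addr_ge0//; exact: cnorm_le_ReIm.
Qed.

Lemma cintD f g : cint f -> cint g -> cint (fun x => f x + g x).
Proof.
move=> [f1 f2] [g1 g2]; split.
  rewrite (_ : _ \o _ = (fun x => complex.Re (f x) + complex.Re (g x))).
    exact: rintD.
  by apply/funext => x /=; rewrite cReD.
rewrite (_ : _ \o _ = (fun x => complex.Im (f x) + complex.Im (g x))).
  exact: rintD.
by apply/funext => x /=; rewrite cImD.
Qed.

Lemma cintZ (c : R[i]) f : cint f -> cint (fun x => c * f x).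
Proof.
move=> [f1 f2]; split.
  rewrite (_ : _ \o _ = (fun x => complex.Re c * complex.Re (f x) - complex.Im c * complex.Im (f x))).
    by apply: rintB; exact: rintZ.
  by apply/funext => x /=; rewrite cReM.
rewrite (_ : _ \o _ = (fun x => complex.Re c * complex.Im (f x) + complex.Im c * complex.Re (f x))).
  by apply: rintD; exact: rintZ.
by apply/funext => x /=; rewrite cImM.
Qed.

Lemma cintegralD f g : cint f -> cint g ->
  cintegral (fun x => f x + g x) = cintegral f + cintegral g.
Proof.
move=> [f1 f2] [g1 g2]; rewrite /cintegral/=.
apply: complex_ext; rewrite ?cReD ?cImD/=.
  rewrite -(RintegralD measurableT f1 g1).
  by apply: eq_Rintegral => x _ /=; rewrite cReD.
rewrite -(RintegralD measurableT f2 g2).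
by apply: eq_Rintegral => x _ /=; rewrite cImD.
Qed.

Lemma cintegralZ (c : R[i]) f : cint f ->
  cintegral (fun x => c * f x) = c * cintegral f.
Proof.
move=> [f1 f2]; apply: complex_ext; rewrite ?cReM ?cImM/=.
  rewrite -(RintegralZl _ measurableT f1) -(RintegralZl _ measurableT f2).
  rewrite -RintegralB//; [|exact: rintZ|exact: rintZ].
  by apply: eq_Rintegral => x _ /=; rewrite cReM.
rewrite -(RintegralZl _ measurableT f1) -(RintegralZl _ measurableT f2).
rewrite -RintegralD//; [|exact: rintZ|exact: rintZ].
by apply: eq_Rintegral => x _ /=; rewrite cImM.
Qed.

Lemma cintegralB f g : cint f -> cint g ->
  cintegral (fun x => f x - g x) = cintegral f - cintegral g.
Proof.
move=> hf hg; rewrite -mulN1r -cintegralZ// -cintegralD//; last exact: cintZ.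
by congr cintegral; apply/funext => x; rewrite mulN1r.
Qed.

Lemma cintegral0 : cintegral (fun _ : V => 0) = 0.
Proof. by apply: complex_ext; rewrite /= /Rintegral integral0. Qed.

(** The factor 2 comes from bounding real and imaginary parts separately. *)
Lemma cintegral_le f b : cmeas f -> rint b -> (forall x, cnorm (f x) <= b x) ->
  cnorm (cintegral f) <= 2 * \int[mu]_x b x.
Proof.
move=> mf ib fb; have [i1 i2] := cint_dom mf ib fb.
apply: (le_trans (cnorm_le_ReIm _)); rewrite mulr_natl mulr2n /cintegral/=.
apply: lerD.
  apply: (le_trans (le_normr_Rintegral measurableT i1)).
  apply: le_Rintegral => //; first exact: integrable_norm.
  by move=> x _ /=; apply: (le_trans (normr_Re_le _)).
apply: (le_trans (le_normr_Rintegral measurableT i2)).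
apply: le_Rintegral => //; first exact: integrable_norm.
by move=> x _ /=; apply: (le_trans (normr_Im_le _)).
Qed.

Lemma cmeasM d (T : measurableType d) (f g : T -> R[i]) :
  cmeas f -> cmeas g -> cmeas (fun x => f x * g x).
Proof.
move=> [f1 f2] [g1 g2]; split.
  rewrite (_ : (fun x => _) = (fun x => complex.Re (f x) * complex.Re (g x) - complex.Im (f x) * complex.Im (g x))).
    by apply: measurable_funB; apply: measurable_funM.
  by apply/funext => x /=; rewrite cReM.
rewrite (_ : (fun x => _) = (fun x => complex.Re (f x) * complex.Im (g x) + complex.Im (f x) * complex.Re (g x))).
  by apply: measurable_funD; apply: measurable_funM.
by apply/funext => x /=; rewrite cImM.
Qed.

Lemma cmeas_comp d (T : measurableType d) d' (T' : measurableType d')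
    (f : T' -> R[i]) (g : T -> T') :
  measurable_fun setT g -> cmeas f -> cmeas (f \o g).
Proof.
move=> mg [f1 f2]; split; first exact: (measurableT_comp f1 mg).
exact: (measurableT_comp f2 mg).
Qed.

Lemma rint_affine (c : V) (r : R) b : r != 0 -> rint b ->
  rint (fun x => b (c + r *: x)).
Proof.
move=> r0 ib; apply/integrableP; split.
  exact: (measurableT_comp (measurable_int _ ib) (measurable_affine c r)).
have /integrableP[mb iboo] := ib.
rewrite (@integral_affine R n c r (fun x => `|(b x)%:E|%E))//; last exact: measurableT_comp.
exact: lte_mul_pinfty.
Qed.

Lemma Rintegral_affine (c : V) (r : R) b : r != 0 -> rint b ->
  \int[mu]_x b (c + r *: x) = (`|r| ^- n) * \int[mu]_x b x.
Proof.
move=> r0 ib; have mb := measurable_int _ ib.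
rewrite /Rintegral integralE [in RHS]integralE.
have := @integral_affine R n c r (fun x => (EFin \o b)^\+ x)%E r0 (measurable_funepos mb) (fun x => funepos_ge0 _ x).
have := @integral_affine R n c r (fun x => (EFin \o b)^\- x)%E r0 (measurable_funeneg mb) (fun x => funeneg_ge0 _ x).
move=> En Ep.
rewrite (_ : (fun x => (b (c + r *: x))%:E) = (EFin \o b) \o (fun x => c + r *: x))//.
rewrite funepos_comp funeneg_comp /comp Ep En.
have := integrable_fin_num measurableT (integrable_funepos measurableT ib).
have := integrable_fin_num measurableT (integrable_funeneg measurableT ib).
rewrite /comp; move: (integral _ _ _) => A; move: (integral _ _ _) => B fA fB.
rewrite -muleBr// ?fineM// ?fin_numB ?fA ?fB//.
by rewrite fin_num_adde_defl// fin_numN.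
Qed.

Lemma cint_affine (c : V) (r : R) f : r != 0 -> cint f ->
  cint (fun x => f (c + r *: x)).
Proof. by move=> r0 [f1 f2]; split; [exact: (rint_affine c r0 f1)|exact: (rint_affine c r0 f2)]. Qed.

Lemma cintegral_affine (c : V) (r : R) f : r != 0 -> cint f ->
  cintegral (fun x => f (c + r *: x)) = (`|r| ^- n)%:C * cintegral f.
Proof.
move=> r0 [f1 f2]; apply: complex_ext; rewrite ?cReM ?cImM/= mul0r ?subr0 ?addr0.
  exact: (Rintegral_affine c r0 f1).
exact: (Rintegral_affine c r0 f2).
Qed.

(** The product bound reduces integrability on the product space to two
    integrals over V. *)
Lemma fubini_real (H : V -> V -> R) (a b : V -> R) :
  measurable_fun setT (fun p : V * V => H p.1 p.2 : measurableTypeR R) ->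
  rint a -> rint b ->
  (forall x y, `|H x y| <= a x * b y) ->
  \int[mu]_x \int[mu]_y H x y = \int[mu]_y \int[mu]_x H x y.
Proof.
move=> mH ia ib Hab.
have iH : (mu \x mu)%E.-integrable setT (fun p : V * V => (H p.1 p.2)%:E).
  apply/integrable12ltyP; first exact/measurable_EFinP.
  apply: (@le_lt_trans _ _ (\int[mu]_x (`|(a x)%:E| * \int[mu]_y `|(b y)%:E|))%E).
    have mab (c : V -> R) : rint c -> measurable_fun setT (fun x : V => `|(c x)%:E|%E).
      by move=> ic; apply: measurableT_comp => //; exact: measurable_int ic.
    apply: ge0_le_integral => //.
    - by move=> x _; apply: integral_ge0.
    - apply: (@measurable_fun_fubini_tonelli_F _ _ _ _ _ mu (fun p : V * V => `|(H p.1 p.2)%:E|%E)) => //.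
      by apply: measurableT_comp => //; exact/measurable_EFinP.
    - apply: emeasurable_funM => //; exact: mab.
    - move=> x _; rewrite -ge0_integralZl//; last exact: mab.
      apply: ge0_le_integral => //.
      + apply: measurableT_comp => //; apply/measurable_EFinP.
        exact: (measurableT_comp mH (measurable_pair1 _)).
      + by apply: emeasurable_funM => //; exact: mab.
      + move=> y _; rewrite /= lee_fin -normrM.
        by apply: (le_trans (Hab x y)); exact: ler_norm.
  have /integrableP[ma aoo] := ia.
  have /integrableP[mb boo] := ib.
  rewrite ge0_integralZr//; last 2 first.
  - exact: measurableT_comp.
  - by apply: integral_ge0.
  apply: lte_mul_pinfty => //; first exact: integral_ge0.
  by rewrite ge0_fin_numE// integral_ge0.
have sec x : mu.-integrable setT (fun y => (H x y)%:E).
  apply: (le_integrable _ _ _ (rintZ (a x) ib)) => //.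
    apply/measurable_EFinP; exact: (measurableT_comp mH (measurable_pair1 _)).
  by move=> y _; rewrite /= lee_fin; apply: (le_trans (Hab x y)); exact: ler_norm.
have sec' y : mu.-integrable setT (fun x => (H x y)%:E).
  apply: (le_integrable _ _ _ (rintZ (b y) ia)) => //.
    apply/measurable_EFinP; exact: (measurableT_comp mH (measurable_pair2 _)).
  by move=> x _; rewrite /= lee_fin mulrC; apply: (le_trans (Hab x y)); exact: ler_norm.
have := Fubini iH; rewrite /Rintegral => F.
congr fine; transitivity (\int[mu]_x \int[mu]_y (H x y)%:E)%E.
  by apply: eq_integral => x _; rewrite fineK//; exact: (integrable_fin_num measurableT (sec x)).
rewrite F.
by apply: eq_integral => y _; rewrite fineK//; exact: (integrable_fin_num measurableT (sec' y)).
Qed.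

Lemma cfubini (H : V -> V -> R[i]) (a b : V -> R) :
  cmeas (fun p : V * V => H p.1 p.2) -> rint a -> rint b ->
  (forall x y, cnorm (H x y) <= a x * b y) ->
  cintegral (fun x => cintegral (H x)) = cintegral (fun y => cintegral (H^~ y)).
Proof.
move=> [m1 m2] ia ib Hab; apply: complex_ext => /=.
  apply: (fubini_real m1 ia ib) => x y.
  by apply: le_trans (Hab x y); exact: normr_Re_le.
apply: (fubini_real m2 ia ib) => x y.
by apply: le_trans (Hab x y); exact: normr_Im_le.
Qed.

Definition decay (k : nat) (x : V) : R := (1 + `|x|) ^- k.

Lemma decay_pos k x : 0 < decay k x.
Proof. by rewrite invr_gt0 exprn_gt0// ltr_pwDl. Qed.

Lemma decay_ge0 k x : 0 <= decay k x.
Proof. exact/ltW/decay_pos. Qed.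

Lemma decay_anti k l x : (k <= l)%N -> decay l x <= decay k x.
Proof.
move=> kl; rewrite /decay lef_pV2 ?posrE ?exprn_gt0 ?ltr_pwDl//.
by rewrite ler_weXn2l// lerDl.
Qed.

Lemma decay_le1 k x : decay k x <= 1.
Proof. by have := decay_anti x (leq0n k); rewrite {2}/decay expr0 invr1. Qed.

Lemma decayD k l x : decay (k + l) x = decay k x * decay l x.
Proof. by rewrite /decay exprD invfM. Qed.

Lemma rint_decay k : (2 * n <= k)%N -> rint (decay k).
Proof.
move=> nk; apply: (@le_integrable _ _ _ mu setT measurableT _ (EFin \o decay (2 * n))).
- exact: measurable_decay.
- move=> x _; rewrite /= lee_fin !ger0_norm ?decay_ge0//; exact: decay_anti.
apply/integrableP; split; first exact: measurable_decay.
apply: le_lt_trans (@integrable_poly_decay R n).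
by apply: ge0_le_integral => //;
  [apply: measurableT_comp => //; exact: measurable_decay|exact: measurable_decay
  |move=> x _; rewrite /= lee_fin ger0_norm// decay_ge0].
Qed.

Definition decay_mass : R := \int[mu]_x decay (2 * n) x.

Lemma decay_mass_ge0 : 0 <= decay_mass.
Proof. by apply: Rintegral_ge0 => x _; exact: decay_ge0. Qed.

Lemma cint_decay f C : cmeas f -> (forall x, cnorm (f x) <= C * decay (2 * n) x) ->
  cint f.
Proof. by move=> mf fC; apply: (cint_dom mf _ fC); apply: rintZ; exact: rint_decay. Qed.

Lemma cintegral_decay_le f C : cmeas f ->
  (forall x, cnorm (f x) <= C * decay (2 * n) x) ->
  cnorm (cintegral f) <= 2 * (C * decay_mass).
Proof.
move=> mf fC; apply: (le_trans (cintegral_le mf (rintZ C (rint_decay (leqnn _))) fC)).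
by rewrite RintegralZl//; exact: rint_decay.
Qed.

End complex_integral.

(** * Differentiability *)

Section first_order.
Context {R : realType} {n : nat}.
Local Notation V := 'rV[R]_n.
Implicit Types (f : V -> R) (x h : V).

Definition basis (i : 'I_n) : V := delta_mx 0 i.

Definition linform (d : 'I_n -> R) (h : V) : R := \sum_(j < n) h 0 j * d j.

Lemma linform_is_linear d : linear (linform d : V -> R^o).
Proof.
move=> a u v; rewrite /linform scaler_sumr -big_split/=; apply: eq_bigr => j _.
by rewrite !mxE mulrDl -mulrA.
Qed.

HB.instance Definition _ d :=
  GRing.isLinear.Build R V R^o _ (linform d) (linform_is_linear d).

Lemma linform_le d h : `|linform d h| <= `|h| * \sum_(j < n) `|d j|.
Proof.
rewrite /linform mulr_sumr; apply: (le_trans (ler_norm_sum _ _ _)).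
by apply: ler_sum => j _; rewrite normrM ler_wpM2r// coord_le_norm.
Qed.

Lemma linform_basis d i : linform d (basis i) = d i.
Proof.
rewrite /linform (bigD1 i)//= mxE !eqxx mul1r big1 ?addr0// => j ji.
by rewrite mxE (negbTE ji) andbF mul0r.
Qed.

Lemma norm_basis (i : 'I_n) : `|basis i| = 1.
Proof.
apply/eqP; rewrite eq_le; apply/andP; split; last first.
  by apply: le_trans (coord_le_norm (basis i) i); rewrite mxE !eqxx normr1.
rewrite /Num.norm/= mx_normrE; apply/bigmax_leP; split => //= -[a j] _ /=.
by rewrite !mxE; case: (_ && _); rewrite ?normr1 ?normr0.
Qed.

(** A quadratic remainder proves differentiability and computes the derivative at
    once. Characters, coordinates, squared norms and Fourier transforms are all
    differentiated in this way. *)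
Lemma expansion_diff f x (d : 'I_n -> R) (C : R) :
  (forall h, `|h| <= 1 -> `|f (x + h) - f x - linform d h| <= C * `|h| ^+ 2) ->
  differentiable f x /\ forall i, 'D_(basis i) f x = d i.
Proof.
move=> H.
have cL : continuous (linform d : V -> R^o).
  apply: bounded_linear_continuous.
  exists (\sum_(j < n) `|d j|); split; first exact: num_real.
  move=> M /ltW dM; apply/nbhs_ballP; exists 1 => //= y.
  rewrite -ball_normE/= sub0r normrN => /ltW y1.
  apply: (le_trans (linform_le d y)); apply: le_trans dM.
  by apply: ler_piMl => //; apply: sumr_ge0.
have E : (f : V -> R^o) \o shift x = cst (f x) + linform d +o_ (0 : V) id.
  apply/eqaddoP => e e0 /=.
  near=> h => /=.
  change (`|f (h + x) - (f x + linform d h)| <= e * `|h|).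
  rewrite [h + x]addrC opprD addrA; apply: (@le_trans _ _ (C * `|h| ^+ 2)).
    apply: H; near: h; apply/nbhs_ballP; exists 1 => //= y.
    by rewrite -ball_normE/= sub0r normrN => /ltW.
  apply: (@le_trans _ _ (`|C| * `|h| * `|h|)).
    by rewrite expr2 mulrA ler_wpM2r// ler_wpM2r// ler_norm.
  rewrite ler_wpM2r//.
  apply: (@le_trans _ _ ((`|C| + 1) * `|h|)); first by rewrite ler_wpM2r// lerDl.
  rewrite -ler_pdivlMl ?ltr_pwDr//.
  near: h; apply/nbhs_ballP; exists ((`|C| + 1)^-1 * e) => /=.
    by rewrite mulr_gt0// invr_gt0 ltr_pwDr.
  by move=> y; rewrite -ball_normE/= sub0r normrN => /ltW.
have dE := diff_unique cL E.
have df : differentiable f x by apply/diff_locallyP; rewrite dE; split.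
split=> // i; rewrite deriveE// dE.
exact: linform_basis.
Unshelve. all: by end_near. Qed.

Lemma coord_diff (j : 'I_n) x : differentiable (fun y : V => y 0 j) x /\
  forall i, 'D_(basis i) (fun y : V => y 0 j) x = (i == j)%:R.
Proof.
apply: (@expansion_diff _ _ _ 0) => h _.
rewrite mul0r mxE /linform (bigD1 j)//= eqxx mulr1 big1 ?addr0; last first.
  by move=> l /negbTE ->; rewrite mulr0.
by rewrite (_ : _ - _ - _ = 0) ?normr0//; ring.
Qed.

Lemma diff_linform f x h : differentiable f x ->
  'd f x h = linform (fun i => 'D_(basis i) f x) h.
Proof.
move=> df; rewrite {1}(row_sum_delta h) linear_sum/=; apply: eq_bigr => j _.
by rewrite linearZ/= deriveE.
Qed.

Lemma mean_value f x h : (forall y, differentiable f y) ->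
  exists2 t, 0 <= t <= 1 &
    f (x + h) - f x = linform (fun i => 'D_(basis i) f (x + t *: h)) h.
Proof.
move=> df; pose g (t : R) : R := f (x + t *: h).
have dg (t : R) : is_derive t (1 : R) g ('d f (x + t *: h) h).
  have dfh : derivable f (x + t *: h) h by apply: diff_derivable.
  have E : (fun s : R => s^-1 *: ((g \o shift t) (s *: (1 : R)) - g t)) =
      (fun s : R => s^-1 *: ((f \o shift (x + t *: h)) (s *: h) - f (x + t *: h))).
    apply/funext => s /=; congr (_ *: (f _ - _)).
    by rewrite /shift /= [s%:A]mulr1 scalerDl addrCA.
  apply: DeriveDef; first by rewrite /derivable E; exact: dfh.
  by rewrite -deriveE// /derive E.
have [|t t01 E] := @MVT_segment R g _ 0 1 ler01 (fun t _ => dg t).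
  apply: continuous_subspaceT => t; apply: differentiable_continuous.
  by apply/derivable1_diffP; have [] := dg t.
exists t; first by move: t01; rewrite in_itv.
by rewrite -diff_linform//; move: E; rewrite /g scale0r addr0 scale1r subr0 mulr1.
Qed.

Lemma differentiable_local_eq f g x (e : R) : 0 < e ->
  (forall h, `|h| < e -> f (x + h) = g (x + h)) -> differentiable g x ->
  differentiable f x /\ forall v, 'D_v f x = 'D_v g x.
Proof.
move=> e0 fg dg.
have [cL E] := (diff_locallyP x g).1 dg.
have E' : (f : V -> R^o) \o shift x = cst (f x) + 'd g x +o_ (0 : V) id.
  apply/eqaddoP => d d0.
  have /eqaddoP/(_ d d0) := E.
  rewrite !near_simpl => H; near=> h.
  change (`|f (h + x) - (f x + 'd g x h)| <= d * `|h|).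
  rewrite [h + x]addrC fg.
    rewrite -{2}[x]addr0 fg ?normr0// addr0 [x + h]addrC.
    by near: h.
  near: h; apply/nbhs_ballP; exists e => //= y.
  by rewrite -ball_normE/= sub0r normrN.
have dE := diff_unique cL E'.
have df : differentiable f x by apply/diff_locallyP; rewrite dE; split.
by split=> [|v]; [exact: df|rewrite (deriveE _ df) (deriveE _ dg) dE].
Unshelve. all: by end_near. Qed.

End first_order.

Section complex_derivatives.
Context {R : realType} {n : nat}.
Local Notation V := 'rV[R]_n.
Implicit Types (f g : V -> R[i]) (x h : V).
Local Notation Re := (@complex.Re R).
Local Notation Im := (@complex.Im R).

Definition cdiff f x :=
  differentiable (fun y => Re (f y)) x /\ differentiable (fun y => Im (f y)) x.

Definition clinform (d : 'I_n -> R[i]) h : R[i] :=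
  \sum_(j < n) (h 0 j)%:C * d j.

Lemma Re_sum I (r : seq I) (P : pred I) (F : I -> R[i]) :
  Re (\sum_(i <- r | P i) F i) = \sum_(i <- r | P i) Re (F i).
Proof. by apply: (big_morph Re) => // z w; rewrite cReD. Qed.

Lemma Im_sum I (r : seq I) (P : pred I) (F : I -> R[i]) :
  Im (\sum_(i <- r | P i) F i) = \sum_(i <- r | P i) Im (F i).
Proof. by apply: (big_morph Im) => // z w; rewrite cImD. Qed.

Lemma Re_clinform d h : Re (clinform d h) = linform (Re \o d) h.
Proof. by rewrite Re_sum; apply: eq_bigr => j _; rewrite cReM/= mul0r subr0. Qed.

Lemma Im_clinform d h : Im (clinform d h) = linform (Im \o d) h.
Proof. by rewrite Im_sum; apply: eq_bigr => j _; rewrite cImM/= mul0r addr0. Qed.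

Lemma expansion_cdiff f x d (C : R) :
  (forall h, `|h| <= 1 ->
    cnorm (f (x + h) - f x - clinform d h) <= C * `|h| ^+ 2) ->
  cdiff f x /\ forall i, partial i f x = d i.
Proof.
move=> H.
have [d1 e1] : differentiable (fun y => Re (f y)) x /\
    forall i, 'D_(basis i) (fun y => Re (f y)) x = (Re \o d) i.
  apply: (@expansion_diff _ _ _ _ _ C) => h h1; apply: le_trans (H h h1).
  rewrite -Re_clinform -!(cReN, cReD); exact: normr_Re_le.
have [d2 e2] : differentiable (fun y => Im (f y)) x /\
    forall i, 'D_(basis i) (fun y => Im (f y)) x = (Im \o d) i.
  apply: (@expansion_diff _ _ _ _ _ C) => h h1; apply: le_trans (H h h1).
  rewrite -Im_clinform -!(cImN, cImD); exact: normr_Im_le.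
by split=> // i; apply: complex_ext; [exact: e1|exact: e2].
Qed.

Lemma cdiff_cst (c : R[i]) x : cdiff (fun=> c) x.
Proof. by split; exact: differentiable_cst. Qed.

Lemma partial_cst (c : R[i]) i : partial i (fun=> c : R[i]) = (fun=> 0) :> (V -> R[i]).
Proof. by apply/funext => x; rewrite /partial !derive_cst. Qed.

Lemma cdiffD f g x : cdiff f x -> cdiff g x -> cdiff (fun y => f y + g y) x.
Proof.
move=> [f1 f2] [g1 g2]; split.
  rewrite (_ : (fun y => _) = (fun y => Re (f y)) + (fun y => Re (g y))).
    exact: differentiableD.
  by apply/funext => y; rewrite cReD.
rewrite (_ : (fun y => _) = (fun y => Im (f y)) + (fun y => Im (g y))).
  exact: differentiableD.
by apply/funext => y; rewrite cImD.
Qed.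

Lemma partialD f g x i : cdiff f x -> cdiff g x ->
  partial i (fun y => f y + g y) x = partial i f x + partial i g x.
Proof.
move=> [f1 f2] [g1 g2]; apply: complex_ext; rewrite ?cReD ?cImD/=.
  rewrite (_ : (fun y => Re (f y + g y)) = (fun y => Re (f y)) + (fun y => Re (g y))).
    by rewrite deriveD//; exact: diff_derivable.
  by apply/funext => y; rewrite cReD.
rewrite (_ : (fun y => Im (f y + g y)) = (fun y => Im (f y)) + (fun y => Im (g y))).
  by rewrite deriveD//; exact: diff_derivable.
by apply/funext => y; rewrite cImD.
Qed.

Lemma cdiffM f g x : cdiff f x -> cdiff g x -> cdiff (fun y => f y * g y) x.
Proof.
move=> [f1 f2] [g1 g2]; split.
  rewrite (_ : (fun y => _) = (fun y => Re (f y)) * (fun y => Re (g y)) - (fun y => Im (f y)) * (fun y => Im (g y))).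
    by apply: differentiableB; exact: differentiableM.
  by apply/funext => y; rewrite cReM.
rewrite (_ : (fun y => _) = (fun y => Re (f y)) * (fun y => Im (g y)) + (fun y => Im (f y)) * (fun y => Re (g y))).
  by apply: differentiableD; exact: differentiableM.
by apply/funext => y; rewrite cImM.
Qed.

Lemma partialM f g x i : cdiff f x -> cdiff g x ->
  partial i (fun y => f y * g y) x = partial i f x * g x + f x * partial i g x.
Proof.
move=> [f1 f2] [g1 g2].
have DM (a b : V -> R) : differentiable a x -> differentiable b x ->
    'D_(basis i) (a * b) x = a x * 'D_(basis i) b x + b x * 'D_(basis i) a x.
  by move=> da db; rewrite deriveM//; exact: diff_derivable.
apply: complex_ext; rewrite ?cReD ?cImD ?cReM ?cImM/=.
  rewrite (_ : (fun y => _) = (fun y => Re (f y)) * (fun y => Re (g y)) - (fun y => Im (f y)) * (fun y => Im (g y))).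
    rewrite deriveB; try by apply: diff_derivable; exact: differentiableM.
    by rewrite !DM//; ring.
  by apply/funext => y; rewrite cReM.
rewrite (_ : (fun y => _) = (fun y => Re (f y)) * (fun y => Im (g y)) + (fun y => Im (f y)) * (fun y => Re (g y))).
  rewrite deriveD; try by apply: diff_derivable; exact: differentiableM.
  by rewrite !DM//; ring.
by apply/funext => y; rewrite cImM.
Qed.

Lemma partialZ (c : R[i]) f x i : cdiff f x ->
  partial i (fun y => c * f y) x = c * partial i f x.
Proof.
move=> df; rewrite partialM//.
by rewrite partial_cst mul0r add0r.
Qed.

Lemma partial_affine f (c : V) (r : R) x i : (forall y, cdiff f y) ->
  cdiff (fun y => f (c + r *: y)) x /\
  partial i (fun y => f (c + r *: y)) x = r%:C * partial i f (c + r *: x).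
Proof.
move=> df.
have H (a : V -> R) : (forall y, differentiable a y) ->
    differentiable (fun y => a (c + r *: y)) x /\
    'D_(basis i) (fun y => a (c + r *: y)) x = r * 'D_(basis i) a (c + r *: x).
  move=> da.
  have dl : differentiable (fun y : V => c + r *: y) x.
    by apply: differentiableD => //; exact: differentiableZ.
  have dal : differentiable (fun y => a (c + r *: y)) x.
    exact: (differentiable_comp dl).
  split=> [|]; first exact: dal.
  have -> : 'D_(basis i) (fun y : V => a (c + r *: y)) x =
      'D_(r *: basis i) a (c + r *: x).
    have E : (fun s : R => s^-1 *: (((fun y : V => a (c + r *: y)) \o shift x)
          (s *: basis i) - a (c + r *: x))) =
        (fun s : R => s^-1 *: ((a \o shift (c + r *: x)) (s *: (r *: basis i)) -
          a (c + r *: x))).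
      apply/funext => s /=; congr (_ *: (a _ - _)).
      by rewrite /shift/= scalerDr !scalerA [s * r]mulrC addrCA.
    by rewrite /derive E.
  by rewrite (deriveE _ (da _)) linearZ -(deriveE _ (da _)).
have [d1 e1] := H (fun y => Re (f y)) (fun y => (df y).1).
have [d2 e2] := H (fun y => Im (f y)) (fun y => (df y).2).
by split=> //; apply: complex_ext; rewrite ?cReM ?cImM/= mul0r ?subr0 ?addr0.
Qed.

Lemma cmean_value f x h (B : R) : (forall y, cdiff f y) ->
  (forall (t : R) j, 0 <= t <= 1 -> cnorm (partial j f (x + t *: h)) <= B) ->
  cnorm (f (x + h) - f x) <= (2 * n)%:R * B * `|h|.
Proof.
move=> df HB.
have K (a : V -> R) (b : 'I_n -> V -> R) : (forall y, differentiable a y) ->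
    (forall j y, 'D_(basis j) a y = b j y) ->
    (forall (t : R) j, 0 <= t <= 1 -> `|b j (x + t *: h)| <= B) ->
    `|a (x + h) - a x| <= n%:R * B * `|h|.
  move=> da ab bB; have [t t01 ->] := @mean_value _ _ a x h da.
  apply: (le_trans (linform_le _ _)); rewrite mulrC ler_wpM2r//.
  apply: (@le_trans _ _ (\sum_(j < n) B)).
    by apply: ler_sum => j _; rewrite ab; exact: bB.
  by rewrite sumr_const card_ord mulr_natl.
apply: (le_trans (cnorm_le_ReIm _)); rewrite natrM -!mulrA mulr_natl mulr2n !mulrA.
rewrite cReD cImD cReN cImN; apply: lerD.
  apply: (K (fun y => Re (f y)) (fun j y => Re (partial j f y))) => //.
    by move=> y; have [] := df y.
  by move=> t j t01; apply: (le_trans (normr_Re_le _)); exact: HB.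
apply: (K (fun y => Im (f y)) (fun j y => Im (partial j f y))) => //.
  by move=> y; have [] := df y.
by move=> t j t01; apply: (le_trans (normr_Im_le _)); exact: HB.
Qed.

Lemma cdiff_local f g x (e : R) : 0 < e ->
  (forall h, `|h| < e -> f (x + h) = g (x + h)) -> cdiff g x ->
  cdiff f x /\ forall i, partial i f x = partial i g x.
Proof.
move=> e0 fg [g1 g2].
have [|d1 e1] := @differentiable_local_eq _ _ (fun y => Re (f y)) _ x e e0 _ g1.
  by move=> h he; rewrite fg.
have [|d2 e2] := @differentiable_local_eq _ _ (fun y => Im (f y)) _ x e e0 _ g2.
  by move=> h he; rewrite fg.
by split=> // i; apply: complex_ext; [exact: e1|exact: e2].
Qed.

End complex_derivatives.

(** * Symmetry of second derivatives *)

Section symmetry_of_partials.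
Context {R : realType} {n : nat}.
Local Notation V := 'rV[R]_n.
Local Notation Re := (@complex.Re R).
Local Notation Im := (@complex.Im R).

(** The mean value theorem along e_i for the increment z |-> f (z + s e_j) - f z,
    then along e_j for the i-th derivative of f. *)
Lemma second_difference (f : V -> R) i j (x : V) (s : R) : 0 < s ->
  (forall y, differentiable f y) ->
  (forall k y, differentiable (fun z => 'D_(basis k) f z) y) ->
  exists2 y, `|y - x| <= 2 * s &
    f (x + s *: basis i + s *: basis j) - f (x + s *: basis i)
      - (f (x + s *: basis j) - f x) =
    s * (s * 'D_(basis j) (fun z => 'D_(basis i) f z) y).
Proof.
move=> s0 df ddf.
pose k (z : V) : R := f (z + s *: basis j) - f z.
have dsh (a : V -> R) (y : V) : (forall z, differentiable a z) ->
    differentiable (fun z => a (z + s *: basis j)) y /\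
    forall v, 'D_v (fun z => a (z + s *: basis j)) y = 'D_v a (y + s *: basis j).
  move=> da; split.
    have dl : differentiable (fun z : V => z + s *: basis j) y.
      by apply: differentiableD.
    exact: (differentiable_comp dl).
  move=> v; have E : (fun t : R => t^-1 *: (((fun z : V => a (z + s *: basis j)) \o shift y)
          (t *: v) - a (y + s *: basis j))) =
        (fun t : R => t^-1 *: ((a \o shift (y + s *: basis j)) (t *: v) -
          a (y + s *: basis j))).
    by apply/funext => t /=; congr (_ *: (a _ - _)); rewrite /shift/= addrA.
  by rewrite /derive E.
have dk y : differentiable k y.
  by apply: differentiableB; [have [] := dsh f y df|].
have [t t01] := @mean_value _ _ k x (s *: basis i) dk.
have lb (d : 'I_n -> R) l : linform d (s *: basis l) = s * d l.
  by rewrite linearZ/= linform_basis.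
rewrite lb.
have -> : 'D_(basis i) k (x + t *: (s *: basis i)) =
    'D_(basis i) f (x + t *: (s *: basis i) + s *: basis j) -
    'D_(basis i) f (x + t *: (s *: basis i)).
  rewrite /k (_ : (fun z => _) = (fun z => f (z + s *: basis j)) - f)//.
  have [d1 e1] := dsh f (x + t *: (s *: basis i)) df.
  by rewrite deriveB ?e1//; exact: diff_derivable.
have [t' t'01 ->] := @mean_value _ _ (fun z => 'D_(basis i) f z)
  (x + t *: (s *: basis i)) (s *: basis j) (ddf i).
rewrite lb => E.
exists (x + t *: (s *: basis i) + t' *: (s *: basis j)); last exact: E.
have -> : x + t *: (s *: basis i) + t' *: (s *: basis j) - x =
    t *: (s *: basis i) + t' *: (s *: basis j) by apply/rowP => l; rewrite !mxE; ring.
rewrite mulr_natl mulr2n; apply: (le_trans (ler_normD _ _)).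
move: t01 t'01 => /andP[t0 t1] /andP[t'0 t'1].
rewrite !normrZ !norm_basis !mulr1 (ger0_norm t0) (ger0_norm t'0) (gtr0_norm s0).
by rewrite lerD// ler_piMl// ltW.
Qed.

Lemma eq_of_common_values (A B : V -> R) (x : V) :
  {for x, continuous A} -> {for x, continuous B} ->
  (forall s, 0 < s -> exists y1 y2,
    [/\ `|y1 - x| <= 2 * s, `|y2 - x| <= 2 * s & A y1 = B y2]) ->
  A x = B x.
Proof.
move=> cA cB H; apply/eqP; rewrite -subr_eq0 -normr_le0.
apply/ler_addgt0Pr => e e0; rewrite add0r.
have e2 : 0 < e / 2 by rewrite divr_gt0.
have near0 (C : V -> R) : {for x, continuous C} -> exists2 d, 0 < d &
    forall y, `|y - x| < d -> `|C x - C y| < e / 2.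
  move=> /cvgrPdist_lt/(_ _ e2) /nbhs_ballP[d /= d0 Hd]; exists d => // y yx; apply: Hd.
  by rewrite -ball_normE/= distrC.
have [d1 d10 H1] := near0 A cA.
have [d2 d20 H2] := near0 B cB.
pose s := Num.min d1 d2 / 4.
have m0 : 0 < Num.min d1 d2 by rewrite lt_min d10.
have s0 : 0 < s by rewrite divr_gt0.
have : 2 * s < Num.min d1 d2 by rewrite /s; lra.
rewrite lt_min => /andP[sd1 sd2].
have [y1 [y2 [y1x y2x E]]] := H s s0.
have := H1 _ (le_lt_trans y1x sd1); have := H2 _ (le_lt_trans y2x sd2); rewrite E => h2 h1.
rewrite (_ : A x - B x = (A x - B y2) + - (B x - B y2)); last by ring.
by apply: (le_trans (ler_normD _ _)); rewrite normrN; lra.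
Qed.

Lemma sqr_cancel (s a b : R) : 0 < s -> s * (s * a) = s * (s * b) -> a = b.
Proof. by move=> s0 E; apply: (mulfI (lt0r_neq0 s0)); apply: (mulfI (lt0r_neq0 s0)). Qed.

Lemma second_difference_sym (a b c d : R) : a - b - (c - d) = a - c - (b - d).
Proof. ring. Qed.

(** The second difference of step s is symmetric in i and j. It is s ^ 2 times
    each of the two mixed derivatives, at two points within 2 s of x; continuity
    identifies the values at x. *)
Lemma clairaut (f : V -> R) i j x :
  (forall y, differentiable f y) ->
  (forall k y, differentiable (fun z => 'D_(basis k) f z) y) ->
  (forall k l, {for x, continuous (fun z => 'D_(basis l) (fun y => 'D_(basis k) f y) z)}) ->
  'D_(basis j) (fun z => 'D_(basis i) f z) x =
  'D_(basis i) (fun z => 'D_(basis j) f z) x.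
Proof.
move=> df ddf cf; apply: eq_of_common_values (cf i j) (cf j i) _ => s s0.
have [y1 y1x E1] := @second_difference f i j x s s0 df ddf.
have [y2 y2x E2] := @second_difference f j i x s s0 df ddf.
have S : f (x + s *: basis i + s *: basis j) - f (x + s *: basis i)
      - (f (x + s *: basis j) - f x) =
    f (x + s *: basis j + s *: basis i) - f (x + s *: basis j)
      - (f (x + s *: basis i) - f x).
  by rewrite [x + s *: basis j + _]addrAC; exact: second_difference_sym.
exists y1, y2; split; [exact: y1x|exact: y2x|].
exact: (sqr_cancel s0 (etrans (esym E1) (etrans S E2))).
Qed.

Lemma partialC (f : V -> R[i]) i j : smooth_on setT f ->
  partial i (partial j f) = partial j (partial i f).
Proof.
move=> sf; apply/funext => x.
have s0 := sf [::]; have s1 k := sf [:: k]; have s2 k l := sf [:: k; l].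
apply: complex_ext => /=; apply: clairaut.
- by move=> y; have [] := s0 y Logic.I.
- by move=> k y; have [] := s1 k y Logic.I.
- by move=> k l; have [h h'] := s2 l k x Logic.I; exact: differentiable_continuous h.
- by move=> y; have [] := s0 y Logic.I.
- by move=> k y; have [] := s1 k y Logic.I.
- by move=> k l; have [h h'] := s2 l k x Logic.I; exact: differentiable_continuous h'.
Qed.

End symmetry_of_partials.

(** * Schwartz functions *)

Section schwartz_class.
Context {R : realType} {n : nat}.
Local Notation V := 'rV[R]_n.
Implicit Types (f g : V -> R[i]) (w : seq 'I_n).

(** Schwartz functions described by words of partial derivatives and powers of
    1 + |x|, a form suited to induction; [sch_schwartz] and [schwartz_sch] relate
    it to multi-indices and monomials. *)
Definition sch f := smooth_on setT f /\
  forall w k, exists C : R, forall x, cnorm (foldr partial f w x) <= C * decay k x.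

Lemma smooth_partial f i : smooth_on setT f -> smooth_on setT (partial i f).
Proof. by move=> sf w x _; rewrite -foldr_rcons; exact: sf. Qed.

Lemma sch_partial f i : sch f -> sch (partial i f).
Proof.
move=> [sf bf]; split; first exact: smooth_partial.
by move=> w k; rewrite -foldr_rcons; exact: bf.
Qed.

Lemma sch_cdiff f x : sch f -> cdiff f x.
Proof. by move=> [sf _]; exact: (sf [::] x Logic.I). Qed.

Lemma sch_bounded f k : sch f -> exists C : R, forall x, cnorm (f x) <= C * decay k x.
Proof. by move=> [_ bf]; exact: (bf [::] k). Qed.

(** How closure properties of the Schwartz class are proved: exhibit a class of
    decaying functions that is stable under partial derivatives. *)
Lemma sch_ind (P : (V -> R[i]) -> Prop) :
  (forall f x, P f -> cdiff f x) -> (forall f i, P f -> P (partial i f)) ->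
  (forall f k, P f -> exists C : R, forall x, cnorm (f x) <= C * decay k x) ->
  forall f, P f -> sch f.
Proof.
move=> Pd Pp Pb f Pf.
have Pw w : P (foldr partial f w) by elim: w => [|i w IH] //=; exact: Pp.
by split=> [w x _|w k]; [exact: Pd|exact: Pb].
Qed.

Lemma smooth_iter f i k : smooth_on setT f -> smooth_on setT (iter k (partial i) f).
Proof. by move=> sf; elim: k => [|k IH] //=; exact: smooth_partial. Qed.

Lemma smooth_foldr_iter f (b : 'I_n -> nat) s : smooth_on setT f ->
  smooth_on setT (foldr (fun i => iter (b i) (partial i)) f s).
Proof. by move=> sf; elim: s => [|i s IH] //=; exact: smooth_iter. Qed.

Lemma partial_iterC f i j k : smooth_on setT f ->
  partial i (iter k (partial j) f) = iter k (partial j) (partial i f).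
Proof.
move=> sf; elim: k => [|k IH] //=; rewrite partialC ?IH//; exact: smooth_iter.
Qed.

Lemma partial_mpartial f i (b : 'I_n -> nat) : smooth_on setT f ->
  partial i (mpartial b f) = mpartial (fun j => b j + (j == i))%N f.
Proof.
move=> sf; rewrite /mpartial.
have : i \in enum 'I_n by rewrite mem_enum.
have := enum_uniq 'I_n.
elim: (enum 'I_n) => [//|j s IH] /= /andP[js us]; rewrite inE => /orP[/eqP ij|is_].
  subst j; rewrite eqxx addn1 /=; congr (partial i (iter _ _ _)).
  elim: s js {IH us} => //= j s IH; rewrite inE negb_or => /andP[ij js].
  by rewrite eq_sym (negbTE ij) addn0 IH.
rewrite partial_iterC; last exact: smooth_foldr_iter.
rewrite IH// (_ : (j == i) = false) ?addn0//.
by apply: contraNF js => /eqP ->.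
Qed.

(** Partial derivatives commute, so a word only counts through the multiplicities
    of its letters. *)
Lemma word_mpartial f w : smooth_on setT f ->
  exists2 b, (morder b <= size w)%N & foldr partial f w = mpartial b f.
Proof.
move=> sf; elim: w => [|i w [b bw E]] /=.
  exists (fun=> 0%N); first by rewrite /morder big1.
  by rewrite /mpartial; elim: (enum 'I_n) => //= j s <-.
exists (fun j => b j + (j == i))%N; last by rewrite E partial_mpartial.
rewrite /morder big_split/= -addn1 leq_add//.
by rewrite (bigD1 i)//= eqxx big1 // => j /negbTE ->.
Qed.

Lemma mpartial_word f b :
  exists2 w, size w = morder b & mpartial b f = foldr partial f w.
Proof.
rewrite /mpartial /morder -big_enum/=.
elim: (enum 'I_n) => [|i s [w ws E]] /=; first by exists [::]; rewrite ?big_nil.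
exists (nseq (b i) i ++ w); first by rewrite size_cat size_nseq big_cons ws.
by rewrite foldr_cat E; elim: (b i) => //= k ->.
Qed.

Lemma mmonom_le (a : 'I_n -> nat) (x : V) N : (morder a <= N)%N ->
  `|mmonom a x| <= (1 + `|x|) ^+ N.
Proof.
move=> aN; apply: (@le_trans _ _ ((1 + `|x|) ^+ morder a)); last first.
  by rewrite ler_weXn2l// lerDl.
rewrite /mmonom /morder expr_sum normr_prod; apply: ler_prod => i _.
rewrite normr_ge0/= normrX lerXn2r ?nnegrE ?addr_ge0//.
by apply: (le_trans (coord_le_norm x i)); rewrite lerDr.
Qed.

Lemma sch_unif f N k : sch f -> exists2 C : R, 0 <= C &
  forall w, (size w <= N)%N -> forall x, cnorm (foldr partial f w x) <= C * decay k x.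
Proof.
elim: N f => [|N IH] f sf.
  have [C HC] := sch_bounded k sf; exists `|C| => // w; rewrite leqn0 size_eq0 => /eqP -> x /=.
  by apply: (le_trans (HC x)); rewrite ler_wpM2r ?decay_ge0// ler_norm.
have [C C0 HC] := IH f sf.
have /choice[c Hc] : forall i, exists c : R, 0 <= c /\ forall w, (size w <= N)%N -> forall x,
    cnorm (foldr partial (partial i f) w x) <= c * decay k x.
  by move=> i; have [c c0 hc] := IH _ (sch_partial i sf); exists c.
exists (C + \sum_i c i); first by rewrite addr_ge0// sumr_ge0// => i _; have [] := Hc i.
move=> w; case: (lastP w) => [_ x|w' i].
  apply: (le_trans (HC [::] isT x)); rewrite ler_wpM2r ?decay_ge0// lerDl.
  by apply: sumr_ge0 => j _; have [] := Hc j.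
rewrite size_rcons ltnS => wN x; rewrite foldr_rcons.
have [c0 hc] := Hc i; apply: (le_trans (hc w' wN x)); rewrite ler_wpM2r ?decay_ge0//.
rewrite (bigD1 i)//= addrCA lerDl addr_ge0//.
by apply: sumr_ge0 => j _; have [] := Hc j.
Qed.

Lemma seminorm_le f N (C : R) :
  (forall w, (size w <= N)%N -> forall x, cnorm (foldr partial f w x) <= C * decay N x) ->
  (schwartz_seminorm N f <= C%:E)%E.
Proof.
move=> H; apply: ge_ereal_sup => _ [a [b [x [aN bN ->]]]].
rewrite lee_fin; have [w ws ->] := mpartial_word f b.
have := H w; rewrite ws => /(_ bN x) h.
apply: (@le_trans _ _ ((1 + `|x|) ^+ N * (C * decay N x))).
  by apply: ler_pM => //; [exact: cnorm_ge0|exact: mmonom_le].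
by rewrite mulrCA /decay divff ?mulr1// gt_eqF// exprn_gt0// ltr_pwDl.
Qed.

Lemma sch_schwartz f : sch f -> schwartz f.
Proof.
move=> sf; split; first by case: sf.
move=> N; have [C _ HC] := sch_unif N N sf.
by apply: (le_lt_trans (seminorm_le HC)); exact: ltry.
Qed.

Lemma cnorm_seminorm f (x : V) a b N : (morder a <= N)%N -> (morder b <= N)%N ->
  ((`|mmonom a x| * cnorm (mpartial b f x))%:E <= schwartz_seminorm N f)%E.
Proof. by move=> aN bN; apply: ereal_sup_ubound; exists a, b, x. Qed.

Lemma mmonom0 (x : V) : mmonom (fun=> 0%N) x = 1.
Proof. by rewrite /mmonom big1. Qed.

Lemma mmonom_pow (x : V) i k : mmonom (fun j => if j == i then k else 0%N) x = x 0 i ^+ k.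
Proof.
by rewrite /mmonom (bigD1 i)//= eqxx big1 ?mulr1// => j /negbTE ->; rewrite expr0.
Qed.

Lemma morder_pow (i : 'I_n) k : morder (fun j => if j == i then k else 0%N) = k.
Proof. by rewrite /morder (bigD1 i)//= eqxx big1 ?addn0// => j /negbTE ->. Qed.

Lemma seminorm_ge0 f N : (0 <= schwartz_seminorm N f)%E.
Proof.
apply: le_trans (@cnorm_seminorm f 0 (fun=> 0%N) (fun=> 0%N) N _ _);
  rewrite ?lee_fin ?mulr_ge0 ?cnorm_ge0// /morder big1//.
Qed.

(** The norm is attained at some coordinate, whose bound gives the decay for
    |x| >= 1; on the unit ball the bound s suffices. *)
Lemma decay_from_coords (c s : R) k (x : V) : 0 <= c -> c <= s ->
  (forall i, `|x 0 i| ^+ k * c <= s) -> c <= 2 ^+ k * (s + s) * decay k x.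
Proof.
move=> c0 cs H.
have Hk : `|x| ^+ k * c <= s + s.
  have [x0|x0] := eqVneq `|x| 0.
    rewrite x0; case: (k) => [|k'].
      by rewrite expr0 mul1r (le_trans cs)// lerDl (le_trans c0).
    by rewrite expr0n mul0r addr_ge0// (le_trans c0).
  have [[z i] /= xi] := mx_norm_neq0 x0.
  rewrite -[`|x|]/(mx_norm x) xi (ord1 z); apply: (le_trans (H i)).
  by rewrite lerDl (le_trans c0).
rewrite -ler_pdivrMr ?decay_pos// /decay invrK.
have [x1|x1] := leP `|x| 1.
  rewrite mulrC ler_pM ?exprn_ge0 ?addr_ge0//.
    by rewrite lerXn2r ?nnegrE ?addr_ge0//; lra.
  by rewrite (le_trans cs)// lerDl (le_trans c0).
apply: (@le_trans _ _ (2 ^+ k * (`|x| ^+ k * c))).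
  rewrite mulrA -exprMn mulrC ler_wpM2r// lerXn2r ?nnegrE ?addr_ge0 ?mulr_ge0//.
  by lra.
by rewrite ler_wpM2l// exprn_ge0.
Qed.

Lemma schwartz_sch f : schwartz f -> sch f.
Proof.
move=> [sf bf]; split=> // w k.
have [b bw ->] := word_mpartial w sf.
set N := maxn (size w) k.
have bN : (morder b <= N)%N by rewrite (leq_trans bw)// leq_maxl.
have z0 : (morder (fun _ : 'I_n => 0%N) <= N)%N by rewrite /morder big1.
have := bf N; have := seminorm_ge0 f N; have := fun x a aN => @cnorm_seminorm f x a b N aN bN.
case: (schwartz_seminorm N f) => [s||]// H s0 _.
exists (2 ^+ k * (s + s)) => x.
have H0 := H x _ z0; rewrite mmonom0 normr1 mul1r lee_fin in H0.
apply: decay_from_coords => //; first exact: cnorm_ge0.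
move=> i; have := H x (fun j => if j == i then k else 0%N).
by rewrite morder_pow mmonom_pow leq_maxr => /(_ isT); rewrite lee_fin normrX.
Qed.

End schwartz_class.

(** * Products and affine changes of variable *)

Section schwartz_closure.
Context {R : realType} {n : nat}.
Local Notation V := 'rV[R]_n.
Implicit Types (f g : V -> R[i]) (w : seq 'I_n).

(** The multipliers of the Schwartz class: polynomial growth, with an exponent that
    may depend on the derivative. *)
Definition tame g := smooth_on setT g /\
  forall w, exists k (C : R), forall x, cnorm (foldr partial g w x) <= C * (1 + `|x|) ^+ k.

Lemma tame_partial f i : tame f -> tame (partial i f).
Proof.
move=> [sf bf]; split; first exact: smooth_partial.
by move=> w; have := bf (rcons w i); rewrite foldr_rcons.
Qed.

Lemma tame_cdiff f x : tame f -> cdiff f x.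
Proof. by move=> [sf _]; exact: (sf [::] x Logic.I). Qed.

Lemma tame_ind (P : (V -> R[i]) -> Prop) :
  (forall f x, P f -> cdiff f x) -> (forall f i, P f -> P (partial i f)) ->
  (forall f, P f -> exists k (C : R), forall x, cnorm (f x) <= C * (1 + `|x|) ^+ k) ->
  forall f, P f -> tame f.
Proof.
move=> Pd Pp Pb f Pf.
have Pw w : P (foldr partial f w) by elim: w => [|i w IH] //=; exact: Pp.
by split=> [w x _|w]; [exact: Pd|exact: Pb].
Qed.

Lemma sch_tame f : sch f -> tame f.
Proof.
move=> [sf bf]; split=> // w; have [C HC] := bf w 0%N.
by exists 0%N, C => x; apply: (le_trans (HC x)); rewrite /decay expr0 invr1.
Qed.

Lemma tame_cst (c : R[i]) : tame (fun=> c).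
Proof.
apply: (tame_ind (P := fun f => exists c, f = fun=> c)); last by exists c.
- by move=> f x [d ->]; exact: cdiff_cst.
- by move=> f i [d ->]; exists 0; rewrite partial_cst.
- by move=> f [d ->]; exists 0%N, (cnorm d) => x; rewrite mulr1.
Qed.

Lemma clinform_local d (x : V) : cdiff (clinform d) x /\
  forall i, partial i (clinform d) x = d i.
Proof.
apply: (@expansion_cdiff _ _ _ _ _ 0) => h _; rewrite mul0r.
rewrite (_ : _ - _ - _ = 0) ?cnorm0// /clinform.
rewrite -!sumrB big1// => j _; rewrite mxE rmorphD/=; ring.
Qed.

Lemma tame_clinform d : tame (clinform d).
Proof.
apply: (tame_ind (P := fun f => (exists d, f = clinform d) \/ (exists c, f = fun=> c)));
  last by left; exists d.
- move=> f x [[e ->]|[c ->]]; last exact: cdiff_cst.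
  by have [] := clinform_local e x.
- move=> f i [[e ->]|[c ->]]; right; last by exists 0; rewrite partial_cst.
  by exists (e i); apply/funext => x; have [_ ->] := clinform_local e x.
- move=> f [[e ->]|[c ->]]; last by exists 0%N, (cnorm c) => x; rewrite mulr1.
  exists 1%N, (\sum_j cnorm (e j)) => x; rewrite expr1 mulr_suml.
  rewrite /clinform; elim/big_ind2 : _ => [|a b c d' ha hb|j _]; first by rewrite cnorm0.
    by apply: (le_trans (cnormD _ _)); exact: lerD.
  rewrite cnormM cnorm_real mulrC ler_wpM2l ?cnorm_ge0//.
  by apply: (le_trans (coord_le_norm x j)); rewrite lerDr.
Qed.

(** Sums make the class of products stable under the Leibniz rule. *)
Inductive product_span : (V -> R[i]) -> Prop :=
| span_mul f g of sch f & tame g : product_span (fun x => f x * g x)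
| span_add f g of product_span f & product_span g : product_span (fun x => f x + g x).

Lemma product_span_sch f : product_span f -> sch f.
Proof.
apply: sch_ind f.
- move=> f x; elim=> [{}f g sf tg|{}f g _ df _ dg]; last exact: cdiffD.
  by apply: cdiffM; [exact: sch_cdiff|exact: tame_cdiff].
- have dP f x : product_span f -> cdiff f x.
    elim=> [{}f g sf tg|{}f g _ df _ dg]; last exact: cdiffD.
    by apply: cdiffM; [exact: sch_cdiff|exact: tame_cdiff].
  move=> f i; elim=> [{}f g sf tg|{}f g pf df pg dg].
    rewrite (_ : partial i _ = fun x => partial i f x * g x + f x * partial i g x).
      apply: span_add; apply: span_mul => //; first exact: sch_partial.
      exact: tame_partial.
    by apply/funext => x; rewrite partialM//; [exact: sch_cdiff|exact: tame_cdiff].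
  rewrite (_ : partial i _ = fun x => partial i f x + partial i g x); first exact: span_add.
  by apply/funext => x; rewrite partialD//; exact: dP.
- move=> f k; elim=> [{}f g sf [_ tg]|{}f g _ [C hC] _ [D hD]].
    have [m [D hD]] := tg [::]; have [C hC] := sch_bounded (k + m) sf.
    exists (C * D) => x; rewrite cnormM.
    apply: (le_trans (ler_pM (cnorm_ge0 _) (cnorm_ge0 _) (hC x) (hD x))).
    rewrite decayD mulrACA [decay m x](_ : _ = (1 + `|x|) ^- m)//.
    by rewrite divfK// gt_eqF// exprn_gt0// ltr_pwDl.
  exists (C + D) => x; apply: (le_trans (cnormD _ _)); rewrite mulrDl; exact: lerD.
Qed.

Lemma schM f g : sch f -> tame g -> sch (fun x => f x * g x).
Proof. by move=> sf tg; apply: product_span_sch; exact: span_mul. Qed.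

Lemma schD f g : sch f -> sch g -> sch (fun x => f x + g x).
Proof.
move=> sf sg; rewrite (_ : (fun x => _) = fun x => f x * 1 + g x * 1).
  by apply: product_span_sch; apply: span_add; apply: span_mul => //; exact: tame_cst.
by apply/funext => x; rewrite !mulr1.
Qed.

Lemma schZ (c : R[i]) f : sch f -> sch (fun x => c * f x).
Proof.
move=> sf; rewrite (_ : (fun x => _) = fun x => f x * c).
  by apply: schM => //; exact: tame_cst.
by apply/funext => x; rewrite mulrC.
Qed.

Lemma schB f g : sch f -> sch g -> sch (fun x => f x - g x).
Proof.
move=> sf sg; rewrite (_ : (fun x => _) = fun x => f x + (-1) * g x).
  by apply: schD => //; exact: schZ.
by apply/funext => x; rewrite mulN1r.
Qed.

(** Peetre's inequality, by which translates and convolutions keep polynomial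
    decay. *)
Lemma decay_peetre k (x y : V) : decay k (x + y) <= (1 + `|y|) ^+ k * decay k x.
Proof.
rewrite /decay ler_pdivlMr ?exprn_gt0 ?ltr_pwDl// mulrC.
rewrite ler_pdivrMr ?exprn_gt0 ?ltr_pwDl// -exprMn.
rewrite lerXn2r ?nnegrE ?mulr_ge0 ?addr_ge0//.
have : `|x| <= `|x + y| + `|y|.
  by rewrite -{1}(addrK y x); apply: (le_trans (ler_normB _ _)).
have := normr_ge0 (x + y); have := normr_ge0 y.
set a := `|y|; set b := `|x + y|; set c := `|x| => a0 b0; nra.
Qed.

Lemma decay_scale k (r : R) (x : V) : r != 0 ->
  decay k (r *: x) <= (1 + `|r|^-1) ^+ k * decay k x.
Proof.
move=> r0; rewrite /decay ler_pdivlMr ?exprn_gt0 ?ltr_pwDl// mulrC.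
rewrite ler_pdivrMr ?exprn_gt0 ?ltr_pwDl// -exprMn.
rewrite lerXn2r ?nnegrE ?mulr_ge0 ?addr_ge0// ?invr_ge0//.
rewrite normrZ mulrDl mulrDr !mul1r mulrDr mulr1 mulrA mulVf ?normr_eq0// mul1r.
have : 0 <= `|r|^-1 by rewrite invr_ge0.
have : 0 <= `|r| * `|x| by exact: mulr_ge0.
by have := normr_ge0 x; lra.
Qed.

Lemma sch_affine f (c : V) (r : R) : r != 0 -> sch f -> sch (fun x => f (c + r *: x)).
Proof.
move=> r0 sf.
apply: (sch_ind (P := fun h => exists a g, sch g /\ h = fun x => a * g (c + r *: x))); last first.
- by exists 1, f; split=> //; apply/funext => x; rewrite mul1r.
- move=> _ k [a [g [sg ->]]]; have [C hC] := sch_bounded k sg.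
  exists (cnorm a * (`|C| * ((1 + `|r|^-1) ^+ k * (1 + `|r^-1 *: c|) ^+ k))) => x.
  rewrite cnormM -mulrA ler_wpM2l ?cnorm_ge0//.
  apply: (le_trans (hC _)); apply: (@le_trans _ _ (`|C| * decay k (c + r *: x))).
    by rewrite ler_wpM2r ?decay_ge0// ler_norm.
  rewrite -mulrA ler_wpM2l//.
  have -> : c + r *: x = r *: (x + r^-1 *: c).
    by rewrite scalerDr scalerA divff// scale1r addrC.
  apply: (le_trans (decay_scale _ _ r0)); rewrite -mulrA ler_wpM2l ?exprn_ge0//.
  exact: decay_peetre.
- move=> _ i [a [g [sg ->]]]; exists (a * r%:C), (partial i g); split; first exact: sch_partial.
  apply/funext => x; have dg y : cdiff g y by exact: sch_cdiff.
  have [d1 e1] := @partial_affine _ _ g c r x i dg.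
  by rewrite partialZ// e1 mulrA.
- move=> _ x [a [g [sg ->]]]; apply: cdiffM; first exact: cdiff_cst.
  have dg y : cdiff g y by exact: sch_cdiff.
  (* partial_affine takes a coordinate; without any, functions are constant *)
  case: (posnP n) => [n0|n0]; last by have [] := @partial_affine _ _ g c r x (Ordinal n0) dg.
  have E h : h = 0 :> V by apply/rowP => j; have /lt0n_neq0/eqP := leq_ltn_trans (leq0n _) (ltn_ord j).
  apply: (@cdiff_local _ _ _ (fun=> g (c + r *: x)) x 1 _ _ (cdiff_cst _ _)).1 => //.
  by move=> h _; rewrite (E h) addr0.
Qed.

Lemma sch_shift f (h : V) : sch f -> sch (fun x => f (x + h)).
Proof.
move=> sf; have := sch_affine h (oner_neq0 _) sf; congr sch.
by apply/funext => x; rewrite scale1r addrC.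
Qed.

Lemma sch_scale f (r : R) : r != 0 -> sch f -> sch (fun x => f (r *: x)).
Proof.
move=> r0 sf; have := sch_affine 0 r0 sf; congr sch.
by apply/funext => x; rewrite add0r.
Qed.

Lemma continuous_cmeas f : (forall x, cdiff f x) -> cmeas f.
Proof.
move=> df; split; apply: continuous_measurable_rV => x; have [d1 d2] := df x.
  exact: differentiable_continuous d1.
exact: differentiable_continuous d2.
Qed.

Lemma sch_cmeas f : sch f -> cmeas f.
Proof. by move=> sf; apply: continuous_cmeas => x; exact: sch_cdiff. Qed.

Lemma tame_cmeas f : tame f -> cmeas f.
Proof. by move=> sf; apply: continuous_cmeas => x; exact: tame_cdiff. Qed.

Lemma sch_cint f : sch f -> cint f.
Proof.
move=> sf; have [C hC] := sch_bounded (2 * n) sf.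
by apply: cint_decay hC; exact: sch_cmeas.
Qed.

End schwartz_closure.

(** * Smooth functions of compact support *)

Section compactly_supported.
Context {R : realType} {n : nat}.
Local Notation V := 'rV[R]_n.

(** The factor s ^ p makes the family stable under differentiation, and for every
    real p the function is flat at 0. The real exponent is what allows a power of
    the squared norm to be absorbed in [riesz_annulus]. *)
Definition flat (p s : R) : R := if 0 < s then s `^ p * expR (- s^-1) else 0.

Lemma flat_le0 p s : s <= 0 -> flat p s = 0.
Proof. by rewrite /flat ltNge => ->. Qed.

Lemma flat_gt0 p s : 0 < s -> 0 < flat p s.
Proof. by move=> s0; rewrite /flat s0 mulr_gt0 ?expR_gt0 ?powR_gt0. Qed.

Lemma flat_ge0 p s : 0 <= flat p s.
Proof. by rewrite /flat; case: ifP => // s0; rewrite mulr_ge0 ?expR_ge0 ?powR_ge0. Qed.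

(** From exp (1 / s) >= (1 / (m s)) ^ m, with m >= 2 - p. This is what makes the
    function differentiable at 0. *)
Lemma flat_small p : exists C : R, forall s, `|s| <= 1 -> `|flat p s| <= C * s ^+ 2.
Proof.
pose m := (Num.bound `|p|).+2.
have pm : 2 - p <= m%:R.
  have := archi_boundP (normr_ge0 p); have := ler_norm (- p); rewrite normrN /m -natr1 -natr1; lra.
exists (m%:R ^+ m) => s; rewrite ler_norml => /andP[_ s1].
have [s0|s0] := ltP 0 s; last first.
  by rewrite flat_le0// normr0; apply: mulr_ge0; [rewrite exprn_ge0// ler0n|exact: sqr_ge0].
rewrite ger0_norm ?flat_ge0// /flat s0.
have m0 : (0 : R) < m%:R by rewrite ltr0n.
have E : expR (- s^-1) <= (m%:R * s) ^+ m.
  rewrite expRN -[leRHS]invrK lef_pV2 ?posrE ?expR_gt0 ?invr_gt0 ?exprn_gt0 ?mulr_gt0//.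
  have -> : s^-1 = (m%:R * s)^-1 * m%:R.
    by rewrite invfM mulrAC mulVf ?mul1r// gt_eqF.
  have nn : 0 <= (m%:R * s)^-1 by rewrite invr_ge0 mulr_ge0// ltW.
  rewrite expRM_natr -exprVn lerXn2r ?nnegrE ?expR_ge0//.
  by apply: le_trans (expR_ge1Dx _); rewrite lerDr.
apply: (@le_trans _ _ (s `^ p * (m%:R * s) ^+ m)); first by rewrite ler_wpM2l ?powR_ge0.
rewrite exprMn mulrCA ler_wpM2l ?exprn_ge0 ?ler0n//.
have sD (a b : R) : s `^ a * s `^ b = s `^ (a + b).
  by rewrite powRD// (gt_eqF s0) implybT.
rewrite -(powR_mulrn m (ltW s0)) -(powR_mulrn 2 (ltW s0)) sD.
have -> : p + m%:R = 2%:R + (p + m%:R - 2) by ring.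
rewrite -sD ler_piMr ?powR_ge0//.
apply: (@le_trans _ _ (1 `^ (p + m%:R - 2))); last by rewrite powR1.
by rewrite ge0_ler_powR// ?nnegrE ?(ltW s0)//; lra.
Qed.

Lemma is_derive_flat p s :
  is_derive s (1 : R) (flat p) (p * flat (p - 1) s + flat (p - 2) s).
Proof.
have [s0|s0|->] := ltrgt0P s.
- have d1 := is_derive1_powR p s0.
  have s0' : s != 0 by rewrite gt_eqF.
  have d2 : is_derive s (1 : R) (fun t : R => - t^-1) (s ^- 2).
    apply: is_derive_eq.
      apply: is_deriveN.
      exact: (@is_deriveV R id s 1 1 s0' (is_derive_id _ _)).
    by rewrite /= scaleNr opprK [_%:A]mulr1.
  have d3 := @is_derive1_comp R expR (fun t : R => - t^-1) s _ _ (is_derive_expR (- s^-1)) d2.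
  have d4 := is_deriveM d1 d3.
  apply: (@near_eq_is_derive _ _ _ ((fun t : R => t `^ p) * (expR \o (fun t : R => - t^-1)))).
    apply/nbhs_ballP; exists s => //= t; rewrite -ball_normE/= => st.
    by rewrite /flat (_ : 0 < t)//; move: st; rewrite ltr_norml; lra.
  apply: (is_derive_eq d4).
  rewrite /flat s0 /comp /= -![_ *: _]/(_ * _).
  have -> : s `^ (p - 2) = s `^ p * s ^- 2.
    rewrite -(powR_mulrn 2 (ltW s0)) -powRN -powRD//.
    by rewrite s0' implybT.
  ring.
- rewrite !flat_le0 ?ltW// mulr0 addr0.
  apply: (near_eq_is_derive _ (is_derive_cst (0 : R) s 1)).
  apply/nbhs_ballP; exists (- s); first by rewrite /= oppr_gt0.
  move=> t; rewrite -ball_normE/= => st.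
  by rewrite flat_le0//; move: st; rewrite ltr_norml; lra.
- rewrite !flat_le0// mulr0 addr0.
  have [C HC] := flat_small p.
  have L : (fun h : R => h^-1 *: ((flat p \o shift (0 : R)) (h *: (1 : R)) - flat p 0)) @ 0^' --> (0 : R).
    apply/cvgrPdist_lt => e e0.
    apply/nbhs_ballP; exists (Num.min 1 (e / (`|C| + 1))) => /=.
      by rewrite lt_min ltr01 divr_gt0// ltr_pwDr.
    move=> h; rewrite -ball_normE/= sub0r normrN lt_min => /andP[h1 h2] h0.
    rewrite /shift /= addr0 [flat p 0]flat_le0// subr0 sub0r normrN [h%:A]mulr1 normrZ normfV.
    rewrite mulrC ltr_pdivrMr ?normr_gt0//.
    apply: (le_lt_trans (HC h (ltW h1))).
    apply: (@le_lt_trans _ _ (`|C| * `|h| * `|h|)).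
      by rewrite -[h ^+ 2]real_normK ?num_real// expr2 mulrA ler_wpM2r// ler_wpM2r// ler_norm.
    rewrite ltr_pM2r ?normr_gt0//.
    apply: (@le_lt_trans _ _ ((`|C| + 1) * `|h|)); first by rewrite ler_wpM2r// lerDl.
    by rewrite mulrC -ltr_pdivlMr// ltr_pwDr.
  by apply: DeriveDef; [exact: (cvgP _ L)|exact: (cvg_lim _ L)].
Qed.

Lemma chain_rule (f : V -> R) (h : R -> R) (a : R) x :
  differentiable f x -> is_derive (f x) (1 : R) h a ->
  differentiable (h \o f) x /\ forall v, 'D_v (h \o f) x = a * 'D_v f x.
Proof.
move=> df [dh ah].
have dh' : differentiable h (f x) by apply/derivable1_diffP.
have dhf : differentiable (h \o f) x := differentiable_comp df dh'.
split=> [|v]; first exact: dhf.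
rewrite (deriveE _ dhf) (deriveE _ df) (diff_comp df dh') /=.
rewrite -[X in 'd h (f x) X]mulr1 [X in 'd h (f x) X](_ : _ = 'd f x v *: (1 : R))//.
by rewrite linearZ/= -(deriveE _ dh') ah mulrC.
Qed.

(** Contains the bump functions in use and is stable under differentiation, so that
    their smoothness is an induction on formulas. *)
Inductive elementary : (V -> R) -> Prop :=
| elem_cst c : elementary (fun=> c)
| elem_coord j : elementary (fun x => x 0 j)
| elem_add f g of elementary f & elementary g : elementary (fun x => f x + g x)
| elem_mul f g of elementary f & elementary g : elementary (fun x => f x * g x)
| elem_flat p f of elementary f : elementary (fun x => flat p (f x)).

Lemma elementary_diff f : elementary f -> (forall x, differentiable f x) /\
  forall i, exists2 g, elementary g & forall x, 'D_(basis i) f x = g x.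
Proof.
elim=> {f} [c|j|f g _ [df Df] _ [dg Dg]|f g ef [df Df] eg [dg Dg]|p f ef [df Df]].
- split=> [x|i]; first exact: differentiable_cst.
  by exists (fun=> 0); [exact: elem_cst|move=> x; rewrite derive_cst].
- split=> [x|i]; first by have [] := coord_diff j x.
  by exists (fun=> (i == j)%:R); [exact: elem_cst|move=> x; have [_ ->] := coord_diff j x].
- split=> [x|i].
    by have := @differentiableD _ _ _ f g x (df x) (dg x).
  have [f' ef' Ef] := Df i; have [g' eg' Eg] := Dg i.
  exists (fun x => f' x + g' x); first exact: elem_add.
  move=> x; rewrite -Ef -Eg; apply: (@deriveD _ _ _ f g x (basis i)); exact: diff_derivable.
- split=> [x|i].
    by have := @differentiableM _ _ f g x (df x) (dg x).
  have [f' ef' Ef] := Df i; have [g' eg' Eg] := Dg i.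
  exists (fun x => f x * g' x + g x * f' x); first by apply: elem_add; exact: elem_mul.
  move=> x; rewrite -Ef -Eg; apply: (@deriveM _ _ f g x (basis i)); exact: diff_derivable.
- have H x := chain_rule (df x) (is_derive_flat p (f x)).
  split=> [x|i]; first by have [] := H x.
  have [f' ef' Ef] := Df i.
  exists (fun x => (p * flat (p - 1) (f x) + flat (p - 2) (f x)) * f' x).
    apply: elem_mul => //; apply: elem_add; last exact: elem_flat.
    by apply: elem_mul; [exact: elem_cst|exact: elem_flat].
  by move=> x; rewrite -Ef; have [_ ->] := H x.
Qed.

Lemma elementary_derive f i : elementary f -> elementary (fun x => 'D_(basis i) f x).
Proof.
move=> /elementary_diff[_ /(_ i)[g eg E]].
by rewrite (_ : (fun x => _) = g)//; apply/funext.
Qed.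

Lemma partial_real (f : V -> R) i :
  partial i (fun x => (f x)%:C) = fun x => ('D_(basis i) f x)%:C.
Proof. by apply/funext => x; apply: complex_ext => //=; exact: derive_cst. Qed.

Lemma cdiff_real (f : V -> R) x : differentiable f x -> cdiff (fun x => (f x)%:C) x.
Proof. by move=> df; split; [exact: df|exact: differentiable_cst]. Qed.

(** Compactness of the ball of radius M bounds each derivative. *)
Lemma elementary_sch f M : elementary f -> (forall x, M <= `|x| -> f x = 0) ->
  sch (fun x => (f x)%:C).
Proof.
move=> ef f0.
apply: (sch_ind (P := fun h => exists f, [/\ elementary f,
   (forall x, M < `|x| -> f x = 0) & h = fun x => (f x)%:C])); last first.
- by exists f; split=> // x /ltW; exact: f0.
- move=> _ k [g [eg g0 ->]].
  pose A : set V := [set x | `|x| <= `|M|].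
  have cA : compact A.
    apply: bounded_closed_compact.
      exists `|M|; split; first exact: num_real.
      by move=> B MB x /= Ax; rewrite (le_trans Ax)// ltW.
    rewrite (_ : A = (fun x : V => `|x|) @^-1` [set y | y <= `|M|])//.
    by apply: (closed_comp _ (@closed_le _ _)) => x _; exact: norm_continuous.
  have A0 : A !=set0 by exists 0; rewrite /A/= normr0.
  have cg : {within A, continuous (fun x => `|g x|)}.
    apply: continuous_subspaceT => x.
    apply: (@continuous_comp _ _ _ g (fun y : R => `|y|)); last exact: norm_continuous.
    by apply: differentiable_continuous; have [] := elementary_diff eg.
  have [c Ac Hc] := EVT_max_rV A0 cA cg.
  exists (`|g c| * (1 + `|M|) ^+ k) => x.
  have [Ax|Ax] := leP `|x| `|M|; last first.
    rewrite g0 ?cnorm0 ?mulr_ge0 ?decay_ge0 ?exprn_ge0 ?addr_ge0//.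
    by rewrite (le_lt_trans (ler_norm _)).
  rewrite cnorm_real -mulrA -[leLHS]mulr1 ler_pM// ?Hc ?inE//.
  rewrite /decay ler_pdivlMr ?exprn_gt0 ?ltr_pwDl// mul1r lerXn2r ?nnegrE ?addr_ge0//.
  by rewrite lerD2l.
- move=> _ i [g [eg g0 ->]]; exists (fun x => 'D_(basis i) g x); split.
  + exact: elementary_derive.
  + move=> x Mx; have e0 : 0 < `|x| - M by rewrite subr_gt0.
    have [|_ ->] := @differentiable_local_eq _ _ g (fun=> 0) x _ e0 _ (differentiable_cst 0 x).
      move=> h hM; apply: g0.
      have : `|x| <= `|x + h| + `|h|.
        by rewrite -{1}(addrK h x); exact: ler_normB.
      by lra.
    exact: derive_cst.
  + exact: partial_real.
- by move=> _ x [g [eg _ ->]]; apply: cdiff_real; have [] := elementary_diff eg.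
Qed.

End compactly_supported.

(** * The Fourier transform of integrable functions *)

Section characters.
Context {R : realType}.

Lemma cisD (a b : R) : cis (a + b) = cis a * cis b.
Proof. by apply: complex_ext; rewrite ?cReM ?cImM/= ?cosD ?sinD// addrC. Qed.

Lemma cis0 : cis (0 : R) = 1.
Proof. by apply: complex_ext; rewrite /= ?cos0 ?sin0. Qed.

Lemma mean_value0 (f df : R -> R) (t : R) : 0 <= t ->
  (forall x : R, is_derive x (1 : R) f (df x)) ->
  exists2 c, 0 <= c <= t & f t - f 0 = df c * t.
Proof.
move=> t0 H; have [|c c0 E] := @MVT_segment R f df 0 t t0 (fun x _ => H x).
  apply: continuous_subspaceT => x; apply: differentiable_continuous.
  by apply/derivable1_diffP; have [] := H x.
by exists c; [move: c0; rewrite in_itv|rewrite E subr0].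
Qed.

Lemma cis_expansion (t : R) : cnorm (cis t - 1 - (0 +i* t)) <= 2 * t ^+ 2.
Proof.
have sin_le (u : R) : 0 <= u -> `|sin u| <= u.
  move=> u0; have [c _] := mean_value0 u0 (@is_derive_sin R).
  rewrite sin0 subr0 => ->; rewrite normrM (ger0_norm u0) ler_piMl//.
  by rewrite ler_norml cos_geN1 cos_le1.
have cos_le (u : R) : 0 <= u -> `|cos u - 1| <= u * Num.min 1 u.
  move=> u0; have [c /andP[c0 cu]] := mean_value0 u0 (@is_derive_cos R).
  rewrite cos0 => ->; rewrite normrM normrN (ger0_norm u0) mulrC ler_wpM2l//.
  by rewrite le_min sin_max/= (le_trans (sin_le c c0)).
have pos (u : R) : 0 <= u -> `|cos u - 1| <= u ^+ 2 /\ `|sin u - u| <= u ^+ 2.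
  move=> u0; split.
    by apply: (le_trans (cos_le u u0)); rewrite expr2 ler_wpM2l// ge_min lexx orbT.
  have H (x : R) : is_derive x (1 : R) (fun y => sin y - y) (cos x - 1).
    by have := is_deriveB (is_derive_sin x) (is_derive_id x (1 : R)).
  have [c /andP[c0 cu]] := mean_value0 u0 H.
  rewrite sin0 !subr0 => ->; rewrite normrM (ger0_norm u0) expr2 ler_wpM2r//.
  apply: (le_trans (cos_le c c0)); apply: le_trans cu.
  by rewrite ler_piMr// ge_min lexx.
have [h1 h2] : `|cos t - 1| <= t ^+ 2 /\ `|sin t - t| <= t ^+ 2.
  have [t0|t0] := leP 0 t; first exact: pos.
  have [] := pos (- t); first by rewrite oppr_ge0 ltW.
  by rewrite cosN sinN sqrrN -opprD normrN => h1 h2; split.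
apply: (le_trans (cnorm_le_ReIm _)); rewrite mulr_natl mulr2n.
by rewrite !(cReD, cImD, cReN, cImN)/= oppr0 !addr0; exact: lerD.
Qed.

Lemma dotpC n (x y : 'rV[R]_n) : dotp x y = dotp y x.
Proof. by apply: eq_bigr => i _; rewrite mulrC. Qed.

Lemma dotpDl n (x y z : 'rV[R]_n) : dotp (x + y) z = dotp x z + dotp y z.
Proof. by rewrite -big_split/=; apply: eq_bigr => i _; rewrite mxE mulrDl. Qed.

Lemma dotpZl n (r : R) (x z : 'rV[R]_n) : dotp (r *: x) z = r * dotp x z.
Proof. by rewrite mulr_sumr; apply: eq_bigr => i _; rewrite mxE mulrA. Qed.

Lemma dotpDr n (x y z : 'rV[R]_n) : dotp z (x + y) = dotp z x + dotp z y.
Proof. by rewrite dotpC dotpDl !(dotpC z). Qed.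

Lemma dotpZr n (r : R) (x z : 'rV[R]_n) : dotp z (r *: x) = r * dotp z x.
Proof. by rewrite dotpC dotpZl dotpC. Qed.

Lemma dotp_le n (x y : 'rV[R]_n) : `|dotp x y| <= n%:R * (`|x| * `|y|).
Proof.
apply: (le_trans (ler_norm_sum _ _ _)).
apply: (@le_trans _ _ (\sum_(i < n) (`|x| * `|y|))).
  by apply: ler_sum => i _; rewrite normrM ler_pM// coord_le_norm.
by rewrite sumr_const card_ord mulr_natl.
Qed.

End characters.

Section fourier_basic.
Context {R : realType} {n : nat}.
Local Notation V := 'rV[R]_n.
Implicit Types (f g : V -> R[i]).

(** The transform with frequency scale [s]: [s = - 2 pi] is the Fourier
    transform and [s = 2 pi] the inverse transform, so one set of lemmas covers both. *)
Definition Fs (s : R) f : V -> R[i] :=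
  fun xi => cintegral (fun x => cis (s * dotp x xi) * f x).

Lemma fourierE f : fourier f = Fs (- (2 * pi)) f.
Proof. by apply/funext => xi; congr cintegral; apply/funext => x; rewrite mulNr. Qed.

Definition chi (s : R) (xi x : V) : R[i] := cis (s * dotp x xi).

Lemma chi_expansion s xi x h :
  cnorm (chi s xi (x + h) - chi s xi x -
    clinform (fun j => chi s xi x * (0 +i* (s * xi 0 j))) h) <=
  2 * (s * (n%:R * `|xi|)) ^+ 2 * `|h| ^+ 2.
Proof.
rewrite /chi dotpDl mulrDr cisD.
have -> : clinform (fun j => cis (s * dotp x xi) * (0 +i* (s * xi 0 j))) h =
    cis (s * dotp x xi) * (0 +i* (s * dotp h xi)).
  rewrite /clinform; apply: complex_ext; rewrite ?Re_sum ?Im_sum ?cReM ?cImM /= ?mulr0 ?mul0r ?sub0r ?addr0 ?add0r.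
    rewrite [dotp h xi]/dotp !mulr_sumr -sumrN; apply: eq_bigr => j _; ring.
  rewrite [dotp h xi]/dotp !mulr_sumr; apply: eq_bigr => j _; ring.
rewrite (_ : _ - _ - _ = cis (s * dotp x xi) * (cis (s * dotp h xi) - 1 - (0 +i* (s * dotp h xi)))); last by ring.
rewrite cnormM cnorm_cis mul1r; apply: (le_trans (cis_expansion _)).
rewrite -mulrA ler_wpM2l// -exprMn -!(real_normK (num_real (_ * _))).
rewrite lerXn2r ?nnegrE// !normrM -mulrA ler_wpM2l//.
apply: (le_trans (dotp_le _ _)); rewrite !normr_id ger0_norm ?ler0n//.
by rewrite -mulrA [`|h| * _]mulrC.
Qed.

Lemma chi_diff s xi x : cdiff (chi s xi) x /\
  forall i, partial i (chi s xi) x = chi s xi x * (0 +i* (s * xi 0 i)).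
Proof. by apply: expansion_cdiff => h _; exact: chi_expansion. Qed.

Lemma tame_chi s xi : tame (chi s xi).
Proof.
apply: (tame_ind (P := fun h => exists c, h = fun x => c * chi s xi x)); last first.
- by exists 1; apply/funext => x; rewrite mul1r.
- move=> _ [c ->]; exists 0%N, (cnorm c) => x.
  by rewrite cnormM cnorm_cis mulr1.
- move=> _ i [c ->]; exists (c * (0 +i* (s * xi 0 i))); apply/funext => x.
  have [d e] := chi_diff s xi x.
  by rewrite partialZ// e mulrAC mulrA.
- move=> _ x [c ->]; apply: cdiffM; first exact: cdiff_cst.
  by have [] := chi_diff s xi x.
Qed.

Lemma chi_meas s : cmeas (fun p : V * V => chi s p.1 p.2).
Proof.
have md : measurable_fun setT (fun p : V * V => s * dotp p.2 p.1 : measurableTypeR R).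
  apply: measurable_funM => //; apply: measurable_sum => i.
  apply: measurable_funM.
    by apply: (measurableT_comp (measurable_rV_coord i)); exact: measurable_snd.
  by apply: (measurableT_comp (measurable_rV_coord i)); exact: measurable_fst.
split.
  apply: (measurableT_comp (f := cos) _ md).
  by apply: continuous_measurable_fun; exact: continuous_cos.
apply: (measurableT_comp (f := sin) _ md).
by apply: continuous_measurable_fun; exact: continuous_sin.
Qed.

Lemma cint_chi s xi f : cint f -> cint (fun x => chi s xi x * f x).
Proof.
move=> cf; apply: (cint_dom _ (cint_cnorm cf)).
  by apply: cmeasM; [exact/tame_cmeas/tame_chi|exact: cint_meas].
by move=> x; rewrite cnormM cnorm_cis mul1r.
Qed.

Lemma Fs_le s f b xi : cint f -> rint b -> (forall x, cnorm (f x) <= b x) ->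
  cnorm (Fs s f xi) <= 2 * \int[lebesgue_rV R n]_x b x.
Proof.
move=> cf ib fb; apply: (cintegral_le _ ib).
  by apply: cint_meas; exact: cint_chi.
by move=> x; rewrite cnormM cnorm_cis mul1r.
Qed.

(** Fubini for the kernel cis (s x.y), symmetric in x and y. *)
Lemma multiplication_formula s f g : cint f -> cint g ->
  cintegral (fun x => Fs s f x * g x) = cintegral (fun y => f y * Fs s g y).
Proof.
move=> cf cg.
transitivity (cintegral (fun x => cintegral (fun y => chi s x y * f y * g x))).
  congr cintegral; apply/funext => x; rewrite mulrC /Fs -cintegralZ; last exact: cint_chi.
  by congr cintegral; apply/funext => y; rewrite mulrC.
rewrite (@cfubini _ _ (fun x y => chi s x y * f y * g x) (fun x => cnorm (g x)) (fun y => cnorm (f y))).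
- congr cintegral; apply/funext => y; rewrite /Fs -cintegralZ; last exact: cint_chi.
  by congr cintegral; apply/funext => x; rewrite /chi dotpC [RHS]mulrA [f y * _]mulrC.
- apply: cmeasM; last exact: (cmeas_comp measurable_fst (cint_meas cg)).
  apply: cmeasM; last exact: (cmeas_comp measurable_snd (cint_meas cf)).
  exact: chi_meas.
- exact: cint_cnorm.
- exact: cint_cnorm.
- by move=> x y; rewrite !cnormM cnorm_cis mul1r mulrC.
Qed.

Lemma Fs_scale s f (e : R) xi : e != 0 -> cint f ->
  Fs s (fun x => f (e *: x)) xi = (`|e| ^- n)%:C * Fs s f (e^-1 *: xi).
Proof.
move=> e0 cf; rewrite /Fs -(@cintegral_affine _ _ 0 e) //; last exact: cint_chi.
congr cintegral; apply/funext => x; rewrite add0r dotpZl dotpZr.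
by rewrite [e * _]mulrA mulfV// mul1r.
Qed.

Lemma Fs_translate s f (c : V) xi : cint f ->
  Fs s (fun x => f (c + x)) xi = cis (- (s * dotp c xi)) * Fs s f xi.
Proof.
move=> cf; rewrite /Fs -(@cintegralZ _ _ (cis _)); last exact: cint_chi.
have cg : cint (fun x => cis (- (s * dotp c xi)) * (cis (s * dotp x xi) * f x)).
  by apply: cintZ; exact: cint_chi.
have := @cintegral_affine _ _ c 1 _ (oner_neq0 _) cg.
rewrite normr1 expr1n invr1 mul1r => <-; congr cintegral; apply/funext => x.
by rewrite scale1r mulrA -cisD; congr (cis _ * _); rewrite dotpDl; ring.
Qed.

(** The mean value inequality for f minus its linear part, whose derivatives are
    in turn bounded by the mean value inequality. *)
Lemma taylor2 f x h (B : R) : (forall y, cdiff f y) ->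
  (forall i y, cdiff (partial i f) y) -> 0 <= B ->
  (forall (t : R) i j, 0 <= t <= 1 -> cnorm (partial j (partial i f) (x + t *: h)) <= B) ->
  cnorm (f (x + h) - f x - clinform (fun i => partial i f x) h) <=
  ((2 * n)%:R ^+ 2 * B) * `|h| ^+ 2.
Proof.
move=> df ddf B0 HB.
pose L := clinform (fun i => partial i f x).
pose k y := f (x + y) + (- 1) * L y.
have dsh y : cdiff (fun z => f (x + z)) y /\
    forall i, partial i (fun z => f (x + z)) y = partial i f (x + y).
  have E : (fun z => f (x + z)) = fun z => f (x + 1 *: z).
    by apply/funext => z; rewrite scale1r.
  rewrite E; split=> [|i].
    (* partial_affine takes a coordinate; without any, functions are constant *)
    case: (posnP n) => [n0|n0]; last by have [] := @partial_affine _ _ f x 1 y (Ordinal n0) df.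
    have En z : z = 0 :> V.
      by apply/rowP => j; have /lt0n_neq0/eqP := leq_ltn_trans (leq0n _) (ltn_ord j).
    apply: (@cdiff_local _ _ _ (fun=> f (x + 1 *: y)) y 1 _ _ (cdiff_cst _ _)).1 => //.
    by move=> z _; rewrite (En z) addr0.
  have [_ ->] := @partial_affine _ _ f x 1 y i df.
  by rewrite mul1r scale1r.
have dL y : cdiff L y /\ forall i, partial i L y = partial i f x.
  exact: clinform_local.
have dk y : cdiff k y.
  by apply: cdiffD; [have [] := dsh y|apply: cdiffM; [exact: cdiff_cst|have [] := dL y]].
have := @cmean_value _ _ k 0 h ((2 * n)%:R * B * `|h|) dk.
rewrite /k add0r /L (_ : clinform _ 0 = 0); last first.
  by rewrite /clinform big1// => j _; rewrite mxE mul0r.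
rewrite mulr0 !addr0 mulN1r => H.
rewrite addrAC; apply: le_trans (H _) _ => [t j t01|]; last by rewrite -subr_ge0 (_ : _ - _ = 0)//; ring.
rewrite add0r partialD; last 2 first.
- by have [] := dsh (t *: h).
- by apply: cdiffM; [exact: cdiff_cst|have [] := dL (t *: h)].
have [_ ->] := dsh (t *: h).
have [dLt eL] := dL (t *: h); rewrite partialZ// eL mulN1r.
apply: (@le_trans _ _ ((2 * n)%:R * B * `|t *: h|)).
  apply: cmean_value; first exact: ddf.
  move=> u i u01; rewrite scalerA; apply: HB.
  by move: t01 u01 => /andP[t0 t1] /andP[u0 u1]; rewrite mulr_ge0//= mulr_ile1.
rewrite ler_wpM2l ?mulr_ge0// normrZ ler_piMl//.
by move: t01 => /andP[t0 t1]; rewrite ger0_norm.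
Qed.

End fourier_basic.

(** * The Fourier transform of Schwartz functions *)

Section fourier_schwartz.
Context {R : realType} {n : nat}.
Local Notation V := 'rV[R]_n.
Implicit Types (f g : V -> R[i]).

Lemma cintB f g : cint f -> cint g -> cint (fun x => f x - g x).
Proof.
move=> cf cg; rewrite (_ : (fun x => _) = fun x => f x + (-1) * g x).
  by apply: cintD => //; exact: cintZ.
by apply/funext => x; rewrite mulN1r.
Qed.

Lemma ler_of_eq (x y : R) : x = y -> x <= y.
Proof. by move=> ->. Qed.

(** The form in which limits t -> 0 are taken. *)
Lemma le0_of_small_bound (a K : R) : (forall t, 0 < t <= 1 -> a <= K * t) -> a <= 0.
Proof.
move=> H; apply/ler_addgt0Pr => e e0; rewrite add0r.
pose t := Num.min 1 (e / (`|K| + 1)).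
have K0 : 0 < `|K| + 1 by rewrite ltr_pwDr.
have t0 : 0 < t by rewrite lt_min ltr01 divr_gt0.
have t1 : t <= 1 by rewrite ge_min lexx.
apply: (le_trans (H t _)); first by rewrite t0.
apply: (@le_trans _ _ ((`|K| + 1) * t)).
  by rewrite ler_wpM2r ?(ltW t0)// (le_trans (ler_norm _))// lerDl.
by rewrite mulrC -ler_pdivlMr// ge_min lexx orbT.
Qed.

Lemma clinform_scale_basis d (t : R) j : clinform d (t *: basis j : V) = t%:C * d j.
Proof.
rewrite /clinform (bigD1 j)//= !mxE !eqxx mulr1 big1 ?addr0// => i ij.
by rewrite !mxE (negbTE ij) andbF mulr0 mul0r.
Qed.

(** Difference quotients of g have integral 0 by translation invariance, and they
    approximate the derivative up to t times an integrable weight. *)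
Lemma cintegral_partial g j : sch g -> cintegral (partial j g) = 0.
Proof.
move=> sg.
have [C C0 HC] := sch_unif 2 (2 * n) sg.
pose K := (2 * n)%:R ^+ 2 * (C * 2 ^+ (2 * n)).
have T t : 0 < t <= 1 -> forall x, cnorm (g (x + t *: basis j) - g x - t%:C * partial j g x) <=
    (K * t ^+ 2) * decay (2 * n) x.
  move=> /andP[t0 t1] x.
  have B0 : 0 <= C * 2 ^+ (2 * n) * decay (2 * n) x.
    by rewrite !mulr_ge0 ?exprn_ge0 ?decay_ge0.
  have H := @taylor2 R n g x (t *: basis j) _ (fun y => sch_cdiff y sg)
    (fun i y => sch_cdiff y (sch_partial i sg)) B0.
  rewrite clinform_scale_basis in H; apply: le_trans (H _) _ => [u i l /andP[u0 u1]|].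
    apply: (le_trans (HC [:: l; i] isT _)); rewrite -mulrA ler_wpM2l//.
    apply: (le_trans (decay_peetre _ _ _)); rewrite ler_wpM2r ?decay_ge0//.
    rewrite lerXn2r ?nnegrE ?addr_ge0// scalerA normrZ norm_basis mulr1 ger0_norm ?mulr_ge0 ?(ltW t0)//.
    have : u * t <= 1 by rewrite mulr_ile1// ltW.
    by lra.
  rewrite normrZ norm_basis mulr1 gtr0_norm// /K.
  by move: (2 ^+ _) (_%:R) (decay _ x) => a b c; apply: ler_of_eq; ring.
have cg := sch_cint sg; have cpg := sch_cint (sch_partial j sg).
suff : cnorm (cintegral (partial j g)) <= 0.
  move=> h; apply: cnorm_eq0; apply/eqP; rewrite eq_le h; exact: cnorm_ge0.
apply: (@le0_of_small_bound _ (2 * (K * @decay_mass R n))) => t /andP[t0 t1].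
have cgt : cint (fun x => g (x + t *: basis j)).
  have := cint_affine (t *: basis j) (oner_neq0 _) cg.
  by congr cint; apply/funext => x; rewrite scale1r addrC.
have Et : cintegral (fun x => g (x + t *: basis j)) = cintegral g.
  have := cintegral_affine (t *: basis j) (oner_neq0 _) cg.
  rewrite normr1 expr1n invr1 mul1r => <-.
  by congr cintegral; apply/funext => x; rewrite scale1r addrC.
have I : cintegral (fun x => g (x + t *: basis j) - g x - t%:C * partial j g x) =
    - (t%:C * cintegral (partial j g)).
  rewrite cintegralB; [|exact: cintB|exact: cintZ].
  by rewrite cintegralB// Et subrr sub0r cintegralZ.
have := @cintegral_decay_le _ _ (fun x => g (x + t *: basis j) - g x - t%:C * partial j g x) (K * t ^+ 2).
rewrite I cnormN cnormM cnorm_real gtr0_norm// => H.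
rewrite -(ler_pM2l t0); apply: le_trans (H _ _) _.
- apply: cint_meas; apply: cintB; last exact: cintZ.
  exact: cintB.
- by apply: T; rewrite t0.
- by apply: ler_of_eq; ring.
Qed.

Lemma Fs_partial s f j xi : sch f ->
  Fs s (partial j f) xi = - (0 +i* (s * xi 0 j)) * Fs s f xi.
Proof.
move=> sf; have tc := @tame_chi R n s xi.
have scf : sch (fun x => chi s xi x * f x).
  have := schM sf tc; congr sch; apply/funext => x; exact: mulrC.
have := cintegral_partial j scf.
have -> : partial j (fun x => chi s xi x * f x) = fun x =>
    (0 +i* (s * xi 0 j)) * (chi s xi x * f x) + chi s xi x * partial j f x.
  apply/funext => x; rewrite partialM; [|exact: tame_cdiff|exact: sch_cdiff].
  by have [_ ->] := chi_diff s xi x; congr (_ + _); rewrite [chi s xi x * _]mulrC mulrA.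
have c1 := sch_cint scf.
rewrite cintegralD; [|exact: cintZ|exact: (cint_chi s xi (sch_cint (sch_partial j sf)))].
rewrite cintegralZ// => /eqP; rewrite addrC addr_eq0 => /eqP E.
by rewrite mulNr; exact: E.
Qed.

Lemma Fs_iter_partial s f j k xi : sch f ->
  Fs s (iter k (partial j) f) xi = (- (0 +i* (s * xi 0 j))) ^+ k * Fs s f xi.
Proof.
move=> sf; elim: k => [|k IH]; first by rewrite expr0 mul1r.
rewrite iterS Fs_partial; last by elim: k {IH} => //= k IH; exact: sch_partial.
by rewrite IH mulrA -exprS.
Qed.

Lemma cint_sum (I : Type) (r : seq I) (F : I -> V -> R[i]) :
  (forall i, cint (F i)) -> cint (fun x => \sum_(i <- r) F i x) /\
  cintegral (fun x => \sum_(i <- r) F i x) = \sum_(i <- r) cintegral (F i).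
Proof.
move=> cF; elim: r => [|i r [IH1 IH2]].
  rewrite big_nil (_ : (fun x => _) = fun=> 0); last by apply/funext => x; rewrite big_nil.
  have c0 : cint ((fun=> 0) : V -> R[i]).
    apply: (cint_decay (C := 0)) => [|x]; last by rewrite cnorm0 mul0r.
    by split; exact: measurable_cst.
  split=> //; have := cintegralZ 0 c0; rewrite [X in _ = X]mul0r => E; rewrite -[RHS]E.
  by congr cintegral; apply/funext => x; rewrite mul0r.
rewrite big_cons (_ : (fun x => _) = fun x => F i x + \sum_(j <- r) F j x); last first.
  by apply/funext => x; rewrite big_cons.
by split; [exact: cintD|rewrite cintegralD// IH2].
Qed.

Definition mulx (s : R) (i : 'I_n) f : V -> R[i] := fun x => (0 +i* (s * x 0 i)) * f x.

Lemma sch_mulx s i f : sch f -> sch (mulx s i f).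
Proof.
move=> sf.
have := schM (schZ (0 +i* s) sf) (tame_clinform (fun j => (j == i)%:R)).
congr sch; apply/funext => x; rewrite /mulx /clinform (bigD1 i)//= eqxx mulr1 big1.
  rewrite addr0 mulrAC; congr (_ * _).
  by apply: complex_ext; rewrite ?cReM ?cImM /=; ring.
by move=> j /negbTE ->; rewrite mulr0.
Qed.

Lemma sch_decay_sq f : sch f -> exists2 C : R, 0 <= C &
  forall x, `|x| ^+ 2 * cnorm (f x) <= C * decay (2 * n) x.
Proof.
move=> sf; have [C C0 HC] := sch_unif 0 (2 * n + 2) sf.
exists C => // x; apply: (@le_trans _ _ ((1 + `|x|) ^+ 2 * (C * decay (2 * n + 2) x))).
  rewrite ler_pM ?exprn_ge0 ?cnorm_ge0//; last exact: (HC [::]).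
  by rewrite lerXn2r ?nnegrE ?addr_ge0// lerDr.
rewrite mulrCA decayD [decay 2 x](_ : _ = (1 + `|x|) ^- 2)//.
by rewrite [decay _ _ / _]mulrC mulVKf// gt_eqF// exprn_gt0// ltr_pwDl.
Qed.

(** Differentiation under the integral sign: the remainder of the character is of
    size |x| ^ 2 |h| ^ 2, and the decay of f absorbs |x| ^ 2. *)
Lemma Fs_diff s f xi : sch f -> cdiff (Fs s f) xi /\
  forall i, partial i (Fs s f) xi = Fs s (mulx s i f) xi.
Proof.
move=> sf; have [C C0 HC] := sch_decay_sq sf.
pose K := 2 * ((2 * (s * n%:R) ^+ 2) * C * @decay_mass R n).
apply: (@expansion_cdiff _ _ _ _ _ K) => h _.
have cf := sch_cint sf.
have cd j : cint (fun x => (h 0 j)%:C * (chi s xi x * mulx s j f x)).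
  by apply: cintZ; apply: cint_chi; apply: sch_cint; exact: sch_mulx.
have [cS ES] := cint_sum (index_enum 'I_n) cd.
have EG : (fun x => (chi s x (xi + h) - chi s x xi -
    clinform (fun j => chi s x xi * (0 +i* (s * x 0 j))) h) * f x) =
    fun x => chi s (xi + h) x * f x - chi s xi x * f x -
      \sum_(j < n) (h 0 j)%:C * (chi s xi x * mulx s j f x).
  apply/funext => x; rewrite !mulrBl mulr_suml /chi ![dotp x _]dotpC.
  by congr (_ - _); apply: eq_bigr => j _; rewrite /mulx -!mulrA.
have cG : cint (fun x => chi s (xi + h) x * f x - chi s xi x * f x -
      \sum_(j < n) (h 0 j)%:C * (chi s xi x * mulx s j f x)).
  by apply: cintB => //; apply: cintB; exact: cint_chi.
have -> : Fs s f (xi + h) - Fs s f xi - clinform (fun j => Fs s (mulx s j f) xi) h =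
  cintegral (fun x => (chi s x (xi + h) - chi s x xi -
    clinform (fun j => chi s x xi * (0 +i* (s * x 0 j))) h) * f x).
  rewrite EG cintegralB//; last by apply: cintB; exact: cint_chi.
  rewrite cintegralB; [|exact: cint_chi|exact: cint_chi].
  congr (_ - _); rewrite ES; apply: eq_bigr => j _; rewrite cintegralZ//.
  by apply: cint_chi; apply: sch_cint; exact: sch_mulx.
have b x : cnorm ((chi s x (xi + h) - chi s x xi -
    clinform (fun j => chi s x xi * (0 +i* (s * x 0 j))) h) * f x) <=
    (2 * (s * n%:R) ^+ 2 * C * `|h| ^+ 2) * decay (2 * n) x.
  rewrite cnormM; apply: (@le_trans _ _ (2 * (s * (n%:R * `|x|)) ^+ 2 * `|h| ^+ 2 * cnorm (f x))).
    by rewrite ler_wpM2r ?cnorm_ge0//; exact: chi_expansion.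
  rewrite mulrA exprMn [leLHS](_ : _ = 2 * (s * n%:R) ^+ 2 * `|h| ^+ 2 * (`|x| ^+ 2 * cnorm (f x))); last by ring.
  rewrite [leRHS](_ : _ = 2 * (s * n%:R) ^+ 2 * `|h| ^+ 2 * (C * decay (2 * n) x)); last by ring.
  by apply: ler_wpM2l; [rewrite mulr_ge0 ?sqr_ge0// mulr_ge0 ?sqr_ge0|exact: HC].
apply: le_trans (cintegral_decay_le _ b) _; last by rewrite /K; apply: ler_of_eq; ring.
by rewrite EG; exact: cint_meas.
Qed.

(** Derivatives of the transform are transforms of functions x_i f, and k
    derivatives of f give k powers of decay of its transform. *)
Lemma Fs_sch s f : s != 0 -> sch f -> sch (Fs s f).
Proof.
move=> s0 sf.
apply: (sch_ind (P := fun h => exists g, sch g /\ h = Fs s g)); last by exists f.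
- by move=> _ xi [g [sg ->]]; have [] := Fs_diff s xi sg.
- move=> _ i [g [sg ->]]; exists (mulx s i g); split; first exact: sch_mulx.
  by apply/funext => xi; have [_ ->] := Fs_diff s xi sg.
- move=> _ k [g [sg ->]]; have [C C0 HC] := sch_unif k (2 * n) sg.
  pose M := 2 * (C * @decay_mass R n).
  have M0 : 0 <= M by rewrite !mulr_ge0// decay_mass_ge0.
  have bw w xi : (size w <= k)%N -> cnorm (Fs s (foldr partial g w) xi) <= M.
    move=> wk.
    have sw : sch (foldr partial g w) by elim: (w) => //= i v; exact: sch_partial.
    have := Fs_le s xi (sch_cint sw) (rintZ C (rint_decay (leqnn _))) (HC w wk).
    by rewrite RintegralZl//; exact: rint_decay.
  pose r := `|s| ^- k.
  have r0 : 0 <= r by rewrite invr_ge0 exprn_ge0.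
  exists (2 ^+ k * ((1 + r) * M + (1 + r) * M)) => xi.
  apply: decay_from_coords; first exact: cnorm_ge0.
    apply: (le_trans (bw [::] xi isT)).
    by rewrite ler_peMl// lerDl.
  move=> j; have := bw (nseq k j) xi; rewrite size_nseq => /(_ (leqnn _)).
  have -> : foldr partial g (nseq k j) = iter k (partial j) g by elim: (k) => //= l ->.
  rewrite Fs_iter_partial// cnormM.
  have -> : cnorm ((- (0 +i* (s * xi 0 j))) ^+ k) = `|s| ^+ k * `|xi 0 j| ^+ k.
    elim: (k) => [|l IH]; first by rewrite !expr0 mulr1 cnormE/= expr1n expr0n/= addr0 sqrtr1.
    rewrite !exprS cnormM IH cnormN cnormE/= expr0n/= add0r sqrtr_sqr normrM.
    ring.
  rewrite -mulrA => H; apply: (@le_trans _ _ (r * M)).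
    by rewrite /r ler_pdivlMl ?exprn_gt0 ?normr_gt0.
  by rewrite ler_wpM2r// lerDr.
Qed.

(** An approximate identity, with its rate of convergence. *)
Lemma cintegral_rescale f g : sch f -> sch g ->
  exists K : R, forall e, 0 < e <= 1 ->
    cnorm (cintegral (fun y => f (e *: y) * g y) - f 0 * cintegral g) <= K * e.
Proof.
move=> sf sg.
have [C C0 HC] := sch_unif 1 0 sf.
have [D D0 HD] := sch_unif 0 (2 * n + 1) sg.
exists (2 * (((2 * n)%:R * C * D) * @decay_mass R n)) => e /andP[e0 e1].
have cg := sch_cint sg.
have ef : cint (fun y => f (e *: y) * g y).
  apply: (cint_dom _ (rintZ C (cint_cnorm cg))).
    apply: cmeasM; last exact: sch_cmeas.
    exact: sch_cmeas (sch_scale (lt0r_neq0 e0) sf).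
  move=> x; rewrite cnormM ler_wpM2r ?cnorm_ge0//.
  by have := HC [::] isT (e *: x); rewrite /decay expr0 invr1 mulr1.
rewrite -cintegralZ// -cintegralB//; last exact: cintZ.
have b y : cnorm (f (e *: y) * g y - f 0 * g y) <= ((2 * n)%:R * C * D * e) * decay (2 * n) y.
  rewrite -mulrBl cnormM.
  have h1 : cnorm (f (e *: y) - f 0) <= (2 * n)%:R * C * `|e *: y|.
    have := @cmean_value R n f 0 (e *: y) C (fun z => sch_cdiff z sf); rewrite add0r; apply.
    by move=> t j _; have := HC [:: j] isT (0 + t *: (e *: y)); rewrite /decay expr0 invr1 mulr1.
  apply: (le_trans (ler_pM (cnorm_ge0 _) (cnorm_ge0 _) h1 (HD [::] isT y))).
  rewrite normrZ gtr0_norm// decayD.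
  have : `|y| * decay 1 y <= 1.
    by rewrite /decay expr1 ler_pdivrMr ?ltr_pwDl// mul1r lerDr.
  have := decay_ge0 (2 * n) y; have := mulr_ge0 (mulr_ge0 (mulr_ge0 (ler0n R (2 * n)) C0) D0) (ltW e0).
  move: (decay (2 * n) y) (decay 1 y) (_%:R) => a c m h0 a0 yc.
  have : 0 <= (m * C * D * e * a) * (1 - `|y| * c) by rewrite mulr_ge0 ?subr_ge0// mulr_ge0.
  by lra.
apply: (le_trans (cintegral_decay_le _ b)); last by apply: ler_of_eq; ring.
by apply: cint_meas; apply: cintB => //; exact: cintZ.
Qed.

(** Apply the multiplication formula to f (e x) and g, and let e tend to 0. The
    inversion constant comes out as an integral of the transform of g, without
    any transform being computed. *)
Lemma inversion_at0 s f g : s != 0 -> sch f -> sch g ->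
  f 0 * cintegral (Fs s g) = g 0 * cintegral (Fs s f).
Proof.
move=> s0 sf sg.
have sFf := Fs_sch s0 sf; have sFg := Fs_sch s0 sg.
have [K1 H1] := cintegral_rescale sf sFg.
have [K2 H2] := cintegral_rescale sg sFf.
apply/eqP; rewrite -subr_eq0; apply/eqP; apply: cnorm_eq0; apply/eqP.
rewrite eq_le cnorm_ge0 andbT; apply: (@le0_of_small_bound _ (K1 + K2)) => e e01.
have /andP[e0 e1] := e01.
have E : cintegral (fun y => f (e *: y) * Fs s g y) = cintegral (fun y => g (e *: y) * Fs s f y).
  have sfe : sch (fun x => f (e *: x)).
    exact: sch_scale (lt0r_neq0 e0) sf.
  rewrite -multiplication_formula; [|exact: sch_cint|exact: sch_cint].
  have sI : sch (fun x => g (e *: x) * Fs s f x).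
    apply: schM; last exact: sch_tame.
    exact: sch_scale (lt0r_neq0 e0) sg.
  have ei0 : e^-1 != 0 by rewrite invr_neq0// gt_eqF.
  have := cintegral_affine 0 ei0 (sch_cint sI).
  rewrite normfV exprVn invrK gtr0_norm//.
  move=> /(congr1 (fun z => (e ^- n)%:C * z)); rewrite mulrA -rmorphM/= mulVf; last first.
    by rewrite expf_eq0 (gt_eqF e0) andbF.
  rewrite mul1r => <-; rewrite -cintegralZ; last exact: (cint_affine 0 ei0 (sch_cint sI)).
  congr cintegral; apply/funext => x; rewrite add0r scalerA divff ?gt_eqF// scale1r.
  rewrite Fs_scale; [|by rewrite gt_eqF|exact: sch_cint].
  by rewrite gtr0_norm// -mulrA [g x * _]mulrC.
have -> : f 0 * cintegral (Fs s g) - g 0 * cintegral (Fs s f) =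
  (cintegral (fun y => g (e *: y) * Fs s f y) - g 0 * cintegral (Fs s f)) -
  (cintegral (fun y => f (e *: y) * Fs s g y) - f 0 * cintegral (Fs s g)).
  by rewrite -E opprB [RHS]addrC addrA subrK.
apply: (le_trans (cnormB _ _)); rewrite mulrDl addrC; apply: lerD; [exact: H1|exact: H2].
Qed.

(** Translation brings every point to the origin. *)
Lemma Fs_inversion s f g xi : s != 0 -> sch f -> sch g ->
  g 0 * Fs (- s) (Fs s f) xi = f xi * cintegral (Fs s g).
Proof.
move=> s0 sf sg.
have sfx : sch (fun x => f (xi + x)).
  by have := sch_affine xi (oner_neq0 _) sf; congr sch; apply/funext => x; rewrite scale1r.
have := inversion_at0 s0 sfx sg; rewrite addr0 => ->; congr (_ * _).
rewrite {1}/Fs; congr cintegral; apply/funext => x.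
rewrite Fs_translate; last exact: sch_cint.
by rewrite dotpC mulNr.
Qed.

End fourier_schwartz.

(** * Nonvanishing of the inversion constant *)

Section inversion_constant.
Context {R : realType} {n : nat}.
Local Notation V := 'rV[R]_n.
Local Notation mu := (lebesgue_rV R n).
Implicit Types (f g : V -> R[i]).

Lemma cube_near (c y : V) (r : R) : 0 <= r -> cube c r y -> `|y - c| <= r.
Proof.
move=> r0 cy; rewrite /Num.norm/= mx_normrE; apply/bigmax_leP; split => //= -[z i] _ /=.
rewrite (ord1 z) !mxE; have /andP[h1 h2] := cy i.
by rewrite ger0_norm ?subr_ge0// lerBlDl.
Qed.

Lemma integral_cube_ge (h : V -> \bar R) (c : V) (r m : R) : 0 < r -> 0 <= m ->
  measurable_fun (cube c r) h -> (forall y, cube c r y -> (m%:E <= h y)%E) ->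
  ((m * r ^+ n)%:E <= \int[mu]_(y in cube c r) h y)%E.
Proof.
move=> r0 m0 mh Hm; rewrite EFinM -(lebesgue_cube c r0).
rewrite -integral_cst; last exact: measurable_cube.
by apply: ge0_le_integral => //; exact: measurable_cube.
Qed.

Lemma gt_on_cube (h : V -> R) (x : V) (m : R) : continuous h -> m < h x ->
  exists2 r, 0 < r & forall y, cube x r y -> m < h y.
Proof.
move=> ch mx; have hm : 0 < h x - m by rewrite subr_gt0.
have /cvgrPdist_lt/(_ _ hm)/nbhs_ballP[d /= d0 Hd] := ch x.
exists (d / 2); first by rewrite divr_gt0.
move=> y cy.
have : `|h x - h y| < h x - m.
  apply: Hd; rewrite -ball_normE/= distrC; apply: (le_lt_trans (cube_near _ cy)).
    by rewrite divr_ge0// ltW.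
  by rewrite ltr_pdivrMr// ltr_pMr// ltr1n.
by rewrite ltr_norml; lra.
Qed.

Lemma Rintegral_pos (h : V -> R) (x : V) : continuous h -> (forall y, 0 <= h y) ->
  rint h -> 0 < h x -> 0 < \int[mu]_y h y.
Proof.
move=> ch h0 ih hx.
have [|r r0 Hr] := gt_on_cube ch (_ : h x / 2 < h x).
  by rewrite ltr_pdivrMr// ltr_pMr// ltr1n.
have m0 : 0 < h x / 2 by rewrite divr_gt0.
have mh : measurable_fun setT (EFin \o h) by apply/measurable_EFinP; exact: continuous_measurable_rV.
have : ((h x / 2 * r ^+ n)%:E <= \int[mu]_y (h y)%:E)%E.
  apply: le_trans (integral_cube_ge r0 (ltW m0) (measurable_funS measurableT _ mh) _) _ => //.
    by move=> y cy; rewrite lee_fin ltW// Hr.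
  apply: ge0_subset_integral => //; first exact: measurable_cube.
  by move=> y _; rewrite /= lee_fin.
rewrite /Rintegral -[X in (_ <= X)%E]fineK; last exact: (integrable_fin_num measurableT ih).
by rewrite lee_fin; apply: lt_le_trans; rewrite mulr_gt0// exprn_gt0.
Qed.

Definition conjf f : V -> R[i] := fun x => ((f x)^*)%C.

Lemma Re_conjf f x : complex.Re (conjf f x) = complex.Re (f x).
Proof. by rewrite /conjf; case: (f x). Qed.

Lemma Im_conjf f x : complex.Im (conjf f x) = - complex.Im (f x).
Proof. by rewrite /conjf; case: (f x). Qed.

Lemma sch_conjf f : sch f -> sch (conjf f).
Proof.
move=> sf; apply: (sch_ind (P := fun h => exists g, sch g /\ h = conjf g)); last by exists f.
- move=> _ x [g [sg ->]]; have [d1 d2] := sch_cdiff x sg; split.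
    by rewrite (_ : (fun y => _) = fun y => complex.Re (g y))//; apply/funext => y; exact: Re_conjf.
  rewrite (_ : (fun y => _) = - (fun y => complex.Im (g y))); first exact: differentiableN.
  by apply/funext => y; exact: Im_conjf.
- move=> _ i [g [sg ->]]; exists (partial i g); split; first exact: sch_partial.
  apply/funext => x; have [d1 d2] := sch_cdiff x sg; apply: complex_ext.
    rewrite Re_conjf /partial/=.
    by rewrite (_ : (fun y => _) = fun y => complex.Re (g y))//; apply/funext => y; exact: Re_conjf.
  rewrite Im_conjf /partial/=.
  rewrite (_ : (fun y => _) = - (fun y => complex.Im (g y))); first by rewrite deriveN//; exact: diff_derivable.
  by apply/funext => y; exact: Im_conjf.
- move=> _ k [g [sg ->]]; have [C HC] := sch_bounded k sg; exists C => x.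
  by apply: le_trans (HC x); rewrite !cnormE Re_conjf Im_conjf sqrrN.
Qed.

Lemma Fs_conjf s f xi : cint f -> Fs (- s) (conjf f) xi = conjf (Fs s f) xi.
Proof.
move=> cf; have [c1 c2] := cint_chi s xi cf.
apply: complex_ext; rewrite ?Re_conjf ?Im_conjf /Fs/cintegral/=.
  apply: eq_Rintegral => x _.
  by rewrite !cReM/= Re_conjf Im_conjf mulNr cosN sinN mulrNN.
transitivity (\int[mu]_x (-1 * complex.Im (chi s xi x * f x))); last first.
  by rewrite RintegralZl// mulN1r.
apply: eq_Rintegral => x _.
by rewrite !cImM/= Re_conjf Im_conjf [- s * _]mulNr cosN sinN; ring.
Qed.

(** The constant is nonzero by Plancherel's identity: were it zero, the
    transform of every Schwartz function would vanish, yet the transform of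
    [phi] at the origin is its integral. *)
Lemma fourier_inversion (phi : V -> R[i]) : sch phi -> cintegral phi != 0 ->
  exists2 c : R[i], c != 0 & forall f : V -> R[i], sch f -> forall x,
    fourier (Fs (2 * pi) f) x = c * f x.
Proof.
move=> sp ip; set s := 2 * pi.
have s0 : s != 0 by rewrite mulf_neq0// gt_eqF// pi_gt0.
have [x0 px0] : exists x0, phi x0 != 0.
  apply: contrapT => H; move/eqP: ip; apply.
  rewrite -[RHS](@cintegral0 R n); congr cintegral; apply/funext => x.
  by apply/eqP; apply: contraT => h; case: H; exists x.
pose g x := phi (x0 + x).
have sg : sch g.
  by have := sch_affine x0 (oner_neq0 _) sp; congr sch; apply/funext => x; rewrite scale1r.
have g0 : g 0 != 0 by rewrite /g addr0.
pose c := cintegral (Fs s g) / g 0.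
have inv f : sch f -> forall x, fourier (Fs s f) x = c * f x.
  move=> sf x; rewrite fourierE; apply: (mulfI g0).
  by rewrite (Fs_inversion x s0 sf sg) /c mulrA mulrCA divff// mulr1 mulrC.
exists c => //; apply/eqP => c0.
have cpf := sch_cint (sch_conjf sp); have sF := Fs_sch s0 sp.
(* the integrand is the squared modulus of Fs s phi *)
have E0 : cintegral (fun x => Fs s phi x * Fs (- s) (conjf phi) x) = 0.
  rewrite -multiplication_formula//; last exact: sch_cint.
  rewrite -[RHS](@cintegral0 R n); congr cintegral; apply/funext => x.
  by rewrite -fourierE inv// c0 mul0r mul0r.
have Re0 x : complex.Re (Fs s phi x * Fs (- s) (conjf phi) x) =
    complex.Re (Fs s phi x) ^+ 2 + complex.Im (Fs s phi x) ^+ 2.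
  by rewrite (Fs_conjf s x (sch_cint sp)) cReM Re_conjf Im_conjf; ring.
have F0 : Fs s phi 0 = cintegral phi.
  congr cintegral; apply/funext => x.
  rewrite (_ : dotp x 0 = 0) ?mulr0 ?cis0 ?mul1r// /dotp big1// => i _.
  by rewrite mxE mulr0.
have I0 : \int[mu]_x complex.Re (Fs s phi x * Fs (- s) (conjf phi) x) = 0 :=
  congr1 (@complex.Re R) E0.
have sFF : sch (fun x => Fs s phi x * Fs (- s) (conjf phi) x).
  apply: schM => //; apply: sch_tame; apply: Fs_sch; last exact: sch_conjf.
  by rewrite oppr_eq0.
have Re0' : (fun x => complex.Re (Fs s phi x * Fs (- s) (conjf phi) x)) =
    fun x => complex.Re (Fs s phi x) ^+ 2 + complex.Im (Fs s phi x) ^+ 2.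
  by apply/funext => x; exact: Re0.
have : 0 < \int[mu]_x (complex.Re (Fs s phi x) ^+ 2 + complex.Im (Fs s phi x) ^+ 2).
  apply: (@Rintegral_pos _ 0).
  - rewrite -Re0' => x; have [d1 _] := sch_cdiff x sFF.
    exact: differentiable_continuous d1.
  - by move=> y; rewrite addr_ge0// sqr_ge0.
  - by rewrite -Re0'; have [] := sch_cint sFF.
  - have : 0 < cnorm (Fs s phi 0) by apply: cnorm_gt0; rewrite F0.
    by rewrite cnormE sqrtr_gt0.
by rewrite (_ : \int[mu]_x _ = 0) ?ltxx// -I0 Re0'.
Qed.

End inversion_constant.

(** * Finite differences *)

Section finite_differences.
Context {R : realType} {n : nat}.
Local Notation V := 'rV[R]_n.
Implicit Types (f g : V -> R[i]).

Definition diffh (h : V) f : V -> R[i] := fun x => f (x + h) - f x.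

Lemma sch_foldr w f : sch f -> sch (foldr partial f w).
Proof. by move=> sf; elim: w => [|i w IH] //=; exact: sch_partial. Qed.

Lemma sch_diffh h f : sch f -> sch (diffh h f).
Proof. by move=> sf; apply: schB => //; exact: sch_shift. Qed.

Lemma sch_iter_diffh h f N : sch f -> sch (iter N (diffh h) f).
Proof. by move=> sf; elim: N => //= N; exact: sch_diffh. Qed.

Lemma partial_diffh i h f : sch f -> partial i (diffh h f) = diffh h (partial i f).
Proof.
move=> sf; apply/funext => x; have dsf y : cdiff f y by exact: sch_cdiff.
have E : (fun y => f (y + h)) = fun y => f (h + 1 *: y).
  by apply/funext => y; rewrite scale1r addrC.
have [d1 e1] := partial_affine h 1 x i dsf.
rewrite /diffh (_ : (fun y => _) = fun y => f (h + 1 *: y) + (-1) * f y); last first.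
  by apply/funext => y; rewrite scale1r [h + y]addrC mulN1r.
rewrite partialD//; last by apply: cdiffM => //; exact: cdiff_cst.
by rewrite e1 partialZ// rmorph1 mul1r mulN1r scale1r [h + x]addrC.
Qed.

Lemma partial_iter_diffh i h f N : sch f ->
  partial i (iter N (diffh h) f) = iter N (diffh h) (partial i f).
Proof.
move=> sf; elim: N => //= N IH; rewrite partial_diffh ?IH//; exact: sch_iter_diffh.
Qed.

(** Differences commute with derivatives, and each of them is bounded by |k| times
    a derivative through the mean value inequality. *)
Lemma diffh_bound f N L (H : R) : sch f -> exists2 C : R, 0 <= C &
  forall k z, `|k| <= H -> cnorm (iter N (diffh k) f z) <= C * `|k| ^+ N * decay L z.
Proof.
elim: N f => [|N IH] f sf.
  have [C C0 HC] := sch_unif 0 L sf; exists C => // k z _.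
  by rewrite expr0 mulr1; exact: (HC [::]).
have /choice[c Hc] : forall i, exists c : R, 0 <= c /\ forall k z, `|k| <= H ->
    cnorm (iter N (diffh k) (partial i f) z) <= c * `|k| ^+ N * decay L z.
  by move=> i; have [c c0 hc] := IH _ (sch_partial i sf); exists c.
pose S := \sum_i c i.
have S0 : 0 <= S by apply: sumr_ge0 => i _; have [] := Hc i.
exists ((2 * n)%:R * (S * (1 + `|H|) ^+ L)).
  by rewrite !mulr_ge0 ?ler0n// exprn_ge0// addr_ge0.
move=> k z kH; rewrite iterS.
pose B := S * (1 + `|H|) ^+ L * `|k| ^+ N * decay L z.
have := @cmean_value R n (iter N (diffh k) f) z k B
  (fun y => sch_cdiff y (sch_iter_diffh k N sf)).
move=> M; apply: le_trans (M _) _ => [t j /andP[t0 t1]|]; last first.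
  rewrite /B exprSr; apply: ler_of_eq.
  by move: (_%:R) (_ ^+ L) (decay _ _) (`|k| ^+ N) => a b d e; ring.
rewrite partial_iter_diffh//; have [c0 hc] := Hc j.
apply: (le_trans (hc k _ kH)).
have cS : c j <= S.
  by rewrite /S (bigD1 j)//= lerDl sumr_ge0// => i _; have [] := Hc i.
apply: (@le_trans _ _ (S * `|k| ^+ N * decay L (z + t *: k))).
  by rewrite ler_wpM2r ?decay_ge0// ler_wpM2r// exprn_ge0.
have pt : decay L (z + t *: k) <= (1 + `|H|) ^+ L * decay L z.
  apply: (le_trans (decay_peetre _ _ _)); rewrite ler_wpM2r ?decay_ge0//.
  rewrite lerXn2r ?nnegrE ?addr_ge0// lerD2l normrZ ger0_norm//.
  apply: le_trans (ler_norm _); apply: le_trans kH.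
  by rewrite ler_piMl.
apply: (@le_trans _ _ (S * `|k| ^+ N * ((1 + `|H|) ^+ L * decay L z))).
  by rewrite ler_wpM2l// mulr_ge0// exprn_ge0.
rewrite /B; apply: ler_of_eq.
by move: (_ ^+ L) (decay _ _) (`|k| ^+ N) => b d e; ring.
Qed.

Lemma diffh_scale h f N (r : R) x :
  iter N (diffh h) (fun y => f (r *: y)) x = iter N (diffh (r *: h)) f (r *: x).
Proof.
elim: N x => //= N IH x.
by rewrite /diffh /= -/(diffh h) -/(diffh (r *: h)) !IH scalerDr.
Qed.

Lemma diffh_Zl h (a : R[i]) f N x :
  iter N (diffh h) (fun y => a * f y) x = a * iter N (diffh h) f x.
Proof. by elim: N x => //= N IH x; rewrite /diffh /= -/(diffh h) !IH mulrBr. Qed.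

Lemma diffh_reflect h f N (x : V) :
  iter N (diffh h) (fun y => f (x - y)) = fun y => iter N (diffh (- h)) f (x - y).
Proof.
elim: N => //= N ->; apply/funext => y; rewrite /diffh.
by rewrite opprD addrA.
Qed.

Definition conv f k : V -> R[i] := fun x => cintegral (fun y => f (x - y) * k y).

(** The multiplication formula, with the character at xi put on g, where it becomes
    a translation of its transform. *)
Lemma Fs_convolution s f g xi : cint f -> cint g ->
  Fs s (fun x => Fs (- s) f x * g x) xi = cintegral (fun y => f y * Fs s g (xi - y)).
Proof.
move=> cf cg.
transitivity (cintegral (fun x => Fs (- s) f x * (chi s xi x * g x))).
  by congr cintegral; apply/funext => x; rewrite mulrCA.
rewrite multiplication_formula; [|exact: cf|exact: cint_chi].
congr cintegral; apply/funext => y; congr (_ * _).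
congr cintegral; apply/funext => x; rewrite mulrA -cisD; congr (cis _ * _).
have -> : - y = (-1) *: y by rewrite scaleN1r.
by rewrite dotpDr dotpZr; ring.
Qed.

Lemma cintegral_reflect f (x : V) : cint f ->
  cintegral (fun y => f (x - y)) = cintegral f.
Proof.
move=> cf; have N1 : (-1 : R) != 0 by rewrite oppr_eq0 oner_neq0.
have := cintegral_affine x N1 cf; rewrite normrN1 expr1n invr1 mul1r => <-.
by congr cintegral; apply/funext => y; rewrite scaleN1r.
Qed.

Lemma sch_reflect f (x : V) : sch f -> sch (fun y => f (x - y)).
Proof.
move=> sf; have N1 : (-1 : R) != 0 by rewrite oppr_eq0 oner_neq0.
by have := sch_affine x N1 sf; congr sch; apply/funext => y; rewrite scaleN1r.
Qed.

Lemma diffh_parts h f g N : sch f -> sch g ->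
  cintegral (fun y => iter N (diffh h) f y * g y) =
  cintegral (fun y => f y * iter N (diffh (- h)) g y).
Proof.
elim: N g => //= N IH g sf sg.
set u := iter N (diffh h) f; have su : sch u by exact: sch_iter_diffh.
have prod (a b : V -> R[i]) : sch a -> sch b -> cint (fun y => a y * b y).
  by move=> sa sb; apply: sch_cint; apply: schM => //; exact: sch_tame.
transitivity (cintegral (fun y => u y * diffh (- h) g y)).
  transitivity (cintegral (fun y => u (y + h) * g y) - cintegral (fun y => u y * g y)).
    rewrite -cintegralB; [|exact: (prod _ _ (sch_shift h su))|exact: prod].
    by congr cintegral; apply/funext => y; rewrite /diffh mulrBl.
  transitivity (cintegral (fun y => u y * g (y - h)) - cintegral (fun y => u y * g y)).
    congr (_ - _); have cug := prod _ _ su (sch_shift (- h) sg).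
    have := cintegral_affine h (oner_neq0 _) cug.
    rewrite normr1 expr1n invr1 mul1r => <-; congr cintegral; apply/funext => y.
    by rewrite scale1r [h + y]addrC addrK.
  rewrite -cintegralB; [|exact: (prod _ _ su (sch_shift (- h) sg))|exact: prod].
  by congr cintegral; apply/funext => y; rewrite /diffh mulrBr.
rewrite /u IH//; last exact: sch_diffh.
by congr cintegral; apply/funext => y; rewrite -iterSr.
Qed.

(** Peetre's inequality moves the decay of f to the point x, at the cost of m
    powers of 1 + |y|, which k supplies. *)
Lemma conv_bound f k (m : nat) (A B : R) : sch f -> cmeas k -> 0 <= A -> 0 <= B ->
  (forall y, cnorm (f y) <= A * decay m y) ->
  (forall y, cnorm (k y) <= B * decay (m + 2 * n) y) ->
  forall x, cnorm (conv f k x) <= 2 * (A * B * @decay_mass R n) * decay m x.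
Proof.
move=> sf mk A0 B0 HA HB x.
have b y : cnorm (f (x - y) * k y) <= A * B * decay m x * decay (2 * n) y.
  rewrite cnormM; apply: (le_trans (ler_pM (cnorm_ge0 _) (cnorm_ge0 _) (HA _) (HB _))).
  have := decay_peetre m x (- y); rewrite normrN => P.
  apply: (@le_trans _ _ (A * ((1 + `|y|) ^+ m * decay m x) * (B * decay (m + 2 * n) y))).
    rewrite ler_wpM2r ?mulr_ge0 ?decay_ge0//.
    by rewrite ler_wpM2l.
  rewrite decayD [decay m y](_ : _ = (1 + `|y|) ^- m)//.
  have y0 : (1 + `|y|) ^+ m != 0 by rewrite gt_eqF// exprn_gt0// ltr_pwDl.
  move: y0; move: (_ ^+ m) => p p0; apply: ler_of_eq.
  by field.
apply: (le_trans (cintegral_decay_le _ b)).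
  apply: cmeasM => //; exact: sch_cmeas (sch_reflect x sf).
by apply: ler_of_eq; ring.
Qed.

End finite_differences.

(** * Frequency cutoffs *)

Section spectrum_at_origin.
Context {R : realType} {n : nat}.
Local Notation V := 'rV[R]_n.
Implicit Types (f g : V -> R[i]).

Definition sqnorm (x : V) : R := \sum_(i < n) x 0 i ^+ 2.

Lemma sqnorm_ge (x : V) : `|x| ^+ 2 <= sqnorm x.
Proof.
have s0 : 0 <= sqnorm x by apply: sumr_ge0 => i _; exact: sqr_ge0.
have [x0|x0] := eqVneq `|x| 0; first by rewrite x0 expr0n.
have [[z i] /= xi] := mx_norm_neq0 x0.
rewrite -[`|x|]/(mx_norm x) xi (ord1 z) real_normK ?num_real//.
by rewrite /sqnorm (bigD1 i)//= lerDl sumr_ge0// => j _; exact: sqr_ge0.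
Qed.

Lemma elementary_sqnorm : elementary sqnorm.
Proof.
rewrite /sqnorm; elim: (index_enum _) => [|i s IH].
  rewrite (_ : (fun x => _) = fun=> 0); first exact: elem_cst.
  by apply/funext => x; rewrite big_nil.
rewrite (_ : (fun x : V => _) = fun x => x 0 i * x 0 i + \sum_(j <- s) x 0 j ^+ 2).
  by apply: elem_add => //; apply: elem_mul; exact: elem_coord.
by apply/funext => x; rewrite big_cons.
Qed.

(** The inner bump freezes the outer one to its value at 1/2 on the unit ball,
    and pushes its argument below 0 far away: a composition of flat functions
    that is exactly constant near the origin. *)
Definition cutoff (x : V) : R := flat 0 (2^-1 - flat 0 (sqnorm x - 1)).

Definition cutoff0 : R := flat 0 (2^-1).

Lemma cutoff0_gt0 : 0 < cutoff0.
Proof. by apply: flat_gt0; rewrite invr_gt0. Qed.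

Lemma cutoff_near0 x : sqnorm x <= 1 -> cutoff x = cutoff0.
Proof.
rewrite -subr_le0 => x1; rewrite /cutoff.
by rewrite (_ : flat 0 (sqnorm x - 1) = 0) ?subr0//; exact: flat_le0.
Qed.

Lemma sch_cutoff : sch (fun x => (cutoff x)%:C).
Proof.
apply: (@elementary_sch _ _ _ 2).
  apply: elem_flat.
  rewrite (_ : (fun x => _) = fun x => 2^-1 + (-1) * flat 0 (sqnorm x + (-1))).
    apply: elem_add; first exact: elem_cst.
    apply: elem_mul; first exact: elem_cst.
    apply: elem_flat; apply: elem_add; [exact: elementary_sqnorm|exact: elem_cst].
  by apply/funext => x; rewrite mulN1r.
move=> x x2; apply: flat_le0; rewrite subr_le0.
have q2 : 2 <= sqnorm x - 1.
  have : 2 ^+ 2 <= `|x| ^+ 2 by rewrite lerXn2r ?nnegrE.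
  have := sqnorm_ge x; rewrite [2 ^+ 2]expr2; lra.
have q0 : 0 < sqnorm x - 1 by apply: lt_le_trans q2.
rewrite /flat q0 powRr0 mul1r; apply: le_trans (expR_ge1Dx _).
have : (sqnorm x - 1)^-1 <= 2^-1 by rewrite lef_pV2 ?posrE//.
by lra.
Qed.

Lemma enorm_sq (x : V) : enorm x ^+ 2 = sqnorm x.
Proof. by rewrite sqr_sqrtr// sumr_ge0// => i _; exact: sqr_ge0. Qed.

Lemma partial_Fs_product s f (k : V -> R[i]) j : sch f -> sch k -> s != 0 ->
  partial j (Fs s (fun x => Fs (- s) f x * k x)) =
  Fs s (fun x => Fs (- s) (partial j f) x * k x).
Proof.
move=> sf sk s0; have s0' : - s != 0 by rewrite oppr_eq0.
have sI : sch (fun x => Fs (- s) f x * k x).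
  by apply: schM; [exact: Fs_sch|exact: sch_tame].
apply/funext => xi; have [_ ->] := Fs_diff s xi sI.
congr cintegral; apply/funext => x; congr (_ * _).
rewrite /mulx Fs_partial// mulrA; congr (_ * _ * _).
by apply: complex_ext; rewrite ?cReN ?cImN/= ?oppr0// mulNr opprK.
Qed.

Lemma foldr_Fs_product s f (k : V -> R[i]) w : sch f -> sch k -> s != 0 ->
  foldr partial (Fs s (fun x => Fs (- s) f x * k x)) w =
  Fs s (fun x => Fs (- s) (foldr partial f w) x * k x).
Proof.
move=> sf sk s0; elim: w => [|i w IH]; first by [].
rewrite [LHS]/= IH; exact: partial_Fs_product (sch_foldr w sf) sk s0.
Qed.

Lemma foldr_diffh w h f N : sch f ->
  foldr partial (iter N (diffh h) f) w = iter N (diffh h) (foldr partial f w).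
Proof.
move=> sf; elim: w => [|i w IH]; first by [].
by rewrite /= IH (partial_iter_diffh i h N (sch_foldr w sf)).
Qed.

Lemma Fs_cutoff_conv s f h N (e : R) x : s != 0 -> 0 < e -> sch f ->
  Fs s (fun xi => Fs (- s) (iter N (diffh h) f) xi * (cutoff (e^-1 *: xi))%:C) x =
  conv f (fun y => (e ^+ n)%:C *
    iter N (diffh (e *: h)) (Fs s (fun xi => (cutoff xi)%:C)) (e *: y)) x.
Proof.
move=> s0 e0 sf; have ei : e^-1 != 0 by rewrite invr_neq0// gt_eqF.
have sX := Fs_sch s0 sch_cutoff.
have sc : sch (fun xi => (cutoff (e^-1 *: xi))%:C).
  exact: (@sch_scale _ _ (fun y => (cutoff y)%:C) _ ei sch_cutoff).
have sfN := sch_iter_diffh h N sf.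
rewrite Fs_convolution; [|exact: sch_cint|exact: sch_cint].
pose k z := (e ^+ n)%:C * Fs s (fun xi => (cutoff xi)%:C) (e *: z).
have Ek : Fs s (fun xi => (cutoff (e^-1 *: xi))%:C) = k.
  apply/funext => z; rewrite (@Fs_scale _ _ s (fun xi => (cutoff xi)%:C))//.
    by rewrite normfV exprVn !invrK gtr0_norm.
  exact: sch_cint sch_cutoff.
have sk : sch k.
  by apply: schZ; exact: (sch_scale (lt0r_neq0 e0) sX).
rewrite Ek (diffh_parts h N sf (sch_reflect x sk)).
rewrite -(@cintegral_reflect _ _ _ x); last first.
  apply: sch_cint; apply: schM => //; apply: sch_tame; apply: sch_iter_diffh.
  exact: sch_reflect.
congr cintegral; apply/funext => y; congr (_ * _).
rewrite diffh_reflect opprK subKr /k.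
rewrite (diffh_Zl h _ (fun z => Fs s (fun xi => (cutoff xi)%:C) (e *: z))).
by rewrite diffh_scale.
Qed.

(** A cutoff to frequencies of size e is a convolution with a kernel of width
    1 / e. Put on that kernel, N differences of step h gain e ^ N, while the
    decay of order m + 2 n asked of the kernel loses e ^ (m + 2 n): one more
    difference leaves a factor e. *)
Lemma Fs_cutoff_small s f h m : s != 0 -> sch f -> exists2 K : R, 0 <= K &
  forall e, 0 < e <= 1 ->
  (schwartz_seminorm m (Fs s (fun xi =>
     (Fs (- s) (iter (m + 2 * n).+1 (diffh h) f) xi * (cutoff (e^-1 *: xi))%:C)%R)) <=
   (K * e)%:E)%E.
Proof.
move=> s0 sf; set L := (m + 2 * n)%N.
have sX := Fs_sch s0 sch_cutoff.
have [A A0 HA] := sch_unif m m sf.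
have [B B0 HB] := diffh_bound L.+1 L `|h| sX.
exists (2 * (A * (B * `|h| ^+ L.+1) * @decay_mass R n)).
  by rewrite !mulr_ge0// ?exprn_ge0// decay_mass_ge0.
move=> e /andP[e0 e1]; apply: seminorm_le => w wm x.
have ei : e^-1 != 0 by rewrite invr_neq0// gt_eqF.
have sc : sch (fun xi => (cutoff (e^-1 *: xi))%:C).
  exact: (@sch_scale _ _ (fun y => (cutoff y)%:C) _ ei sch_cutoff).
have sfw := sch_foldr w sf.
rewrite foldr_Fs_product//; last exact: sch_iter_diffh.
rewrite foldr_diffh// Fs_cutoff_conv//.
have BB0 : 0 <= B * `|h| ^+ L.+1 * e by rewrite !mulr_ge0 ?exprn_ge0// ltW.
have := @conv_bound _ _ (foldr partial f w) (fun y => (e ^+ n)%:C *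
    iter L.+1 (diffh (e *: h)) (Fs s (fun xi => (cutoff xi)%:C)) (e *: y)) m A _ sfw _ A0 BB0 (HA w wm).
move=> H; apply: le_trans (H _ _ x) _.
- apply: cmeasM; first by split; exact: measurable_cst.
  exact: sch_cmeas (sch_scale (lt0r_neq0 e0) (sch_iter_diffh (e *: h) L.+1 sX)).
- move=> y; rewrite cnormM cnorm_real ger0_norm ?exprn_ge0 ?(ltW e0)//.
  have hk : `|e *: h| <= `|h| by rewrite normrZ gtr0_norm// ler_piMl.
  have en : e ^+ n <= 1 by rewrite exprn_ile1// ltW.
  apply: (@le_trans _ _ (1 * (B * `|e *: h| ^+ L.+1 * decay L (e *: y)))).
    by rewrite ler_pM ?exprn_ge0 ?(ltW e0) ?cnorm_ge0//; exact: HB.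
  rewrite mul1r normrZ gtr0_norm// exprMn.
  have dl : decay L (e *: y) <= e ^- L * decay L y.
    rewrite /decay -invfM lef_pV2 ?posrE ?mulr_gt0 ?exprn_gt0 ?ltr_pwDl// -exprMn.
    rewrite lerXn2r ?nnegrE ?mulr_ge0 ?addr_ge0 ?(ltW e0)// normrZ gtr0_norm//.
    by rewrite mulrDr mulr1 lerD2r.
  apply: (@le_trans _ _ (B * (e ^+ L.+1 * `|h| ^+ L.+1) * (e ^- L * decay L y))).
    by rewrite ler_wpM2l// !mulr_ge0 ?exprn_ge0// ltW.
  have eL : e ^+ L != 0 by rewrite expf_eq0 (gt_eqF e0) andbF.
  rewrite exprS; move: eL; move: (e ^+ L) (`|h| ^+ L.+1) (decay L y) => a b d a0.
  by apply: ler_of_eq; field.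
- by move: (decay m x) (`|h| ^+ L.+1) => a b; apply: ler_of_eq; ring.
Qed.

End spectrum_at_origin.

(** * Tempered distributions with spectrum at the origin *)

Section tempered_distributions.
Context {R : realType} {n : nat}.
Local Notation V := 'rV[R]_n.
Implicit Types (f g : V -> R[i]) (D : (V -> R[i]) -> R[i]).

Lemma lipschitz_continuous (g : V -> R) :
  (forall x, exists C : R, forall k, `|k| <= 1 -> `|g (x + k) - g x| <= C * `|k|) ->
  continuous g.
Proof.
move=> H x; have [C HC] := H x.
have C0 : 0 < `|C| + 1 by rewrite ltr_pwDr.
apply/(@cvgrPdist_le _ _ _ (nbhs x)) => e e0.
apply/nbhs_ballP; exists (Num.min 1 (e / (`|C| + 1))) => /=.
  by rewrite lt_min ltr01 divr_gt0.
move=> y; rewrite -ball_normE /= lt_min distrC => /andP[/ltW y1 /ltW ye].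
have yE : x + (y - x) = y by rewrite addrC subrK.
have := HC (y - x) y1; rewrite yE [`|g x - g y|]distrC => h; apply: (le_trans h).
apply: (@le_trans _ _ ((`|C| + 1) * `|y - x|)).
  by rewrite ler_wpM2r//; apply: le_trans (ler_norm _) _; rewrite lerDl.
by rewrite mulrC -ler_pdivlMr.
Qed.

Lemma tempered_lin D (c : R[i]) f g : tempered D -> sch f -> sch g ->
  D (fun x => c * f x + g x) = c * D f + D g.
Proof. by move=> [lD _] sf sg; apply: lD; exact: sch_schwartz. Qed.

Lemma tempered_sub D f g : tempered D -> sch f -> sch g ->
  D (fun x => f x - g x) = D f - D g.
Proof.
move=> tD sf sg; have := tempered_lin (-1) tD sg sf; rewrite mulN1r addrC => <-.
by congr (D _); apply/funext => x; rewrite mulN1r addrC.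
Qed.

Lemma tempered_bound D : tempered D -> exists m (C : R), 0 <= C /\
  forall f (K : R), sch f -> (schwartz_seminorm m f <= K%:E)%E ->
  cnorm (D f) <= C * K.
Proof.
move=> [_ [m [C HC]]]; exists m, `|C|; split=> // f K sf fK.
rewrite -lee_fin; apply: (le_trans (HC f (sch_schwartz sf))).
apply: (@le_trans _ _ (`|C|%:E * schwartz_seminorm m f)%E).
  by apply: lee_wpmul2r; [exact: seminorm_ge0|rewrite lee_fin ler_norm].
by rewrite EFinM; apply: lee_wpmul2l; rewrite ?lee_fin.
Qed.

Lemma seminorm_diffh f m : sch f -> exists C : R, forall k, `|k| <= 1 ->
  (schwartz_seminorm m (diffh k f) <= (C * `|k|)%:E)%E.
Proof.
move=> sf; have [C C0 HC] := sch_unif m.+1 m sf.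
exists ((2 * n)%:R * (C * 2 ^+ m)) => k k1; apply: seminorm_le => w wm x.
rewrite (foldr_diffh w k 1 sf) /= /diffh.
have M := @cmean_value _ _ (foldr partial f w) x k (C * 2 ^+ m * decay m x)
  (fun y => sch_cdiff y (sch_foldr w sf)).
apply: (le_trans (M _)) => [t j /andP[t0 t1]|]; last first.
  by apply: ler_of_eq;
    move: (_%:R) (_ ^+ m) (decay _ _) => a b d; ring.
apply: (le_trans (HC (j :: w) _ _)) => //.
rewrite -mulrA ler_wpM2l//; apply: (le_trans (decay_peetre _ _ _)).
rewrite ler_wpM2r ?decay_ge0// lerXn2r ?nnegrE ?addr_ge0//.
rewrite [2](_ : _ = 1 + 1)// lerD2l normrZ ger0_norm//.
by rewrite -[1]mulr1 ler_pM.
Qed.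

Lemma dist_conv_continuous D f : tempered D -> sch f ->
  continuous (fun x => complex.Re (dist_conv f D x)) /\
  continuous (fun x => complex.Im (dist_conv f D x)).
Proof.
move=> tD sf; have [m [C [C0 HC]]] := tempered_bound tD.
have H x : exists K : R, forall k, `|k| <= 1 ->
    cnorm (dist_conv f D (x + k) - dist_conv f D x) <= K * `|k|.
  have sr := sch_reflect x sf; have [K HK] := seminorm_diffh m sr.
  exists (C * K) => k k1.
  rewrite /dist_conv -tempered_sub//; last exact: sch_reflect.
  have -> : (fun y => f (x + k - y) - f (x - y)) = diffh (- k) (fun y => f (x - y)).
    apply/funext => y; rewrite /diffh; congr (f _ - _).
    by apply/rowP => l; rewrite !mxE; ring.
  by rewrite -mulrA -[`|k|]normrN; apply: HC; [exact: sch_diffh|apply: HK; rewrite normrN].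
split; apply: lipschitz_continuous => x; have [K HK] := H x; exists K => k k1;
  apply: le_trans (HK k k1).
- have -> : complex.Re (dist_conv f D (x + k)) - complex.Re (dist_conv f D x) =
    complex.Re (dist_conv f D (x + k) - dist_conv f D x) by rewrite cReD cReN.
  exact: normr_Re_le.
- have -> : complex.Im (dist_conv f D (x + k)) - complex.Im (dist_conv f D x) =
    complex.Im (dist_conv f D (x + k) - dist_conv f D x) by rewrite cImD cImN.
  exact: normr_Im_le.
Qed.

Lemma dist_conv_cmeas D f : tempered D -> sch f -> cmeas (dist_conv f D).
Proof.
move=> tD sf; have [c1 c2] := dist_conv_continuous tD sf.
by split; exact: continuous_measurable_rV.
Qed.

(** A distribution carried by the frequency 0 is annihilated by high order
    differences: D of the Fourier transform of g only sees g near 0, where the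
    transform of a difference of order N vanishes to order N, more than the
    seminorms controlling D can detect after rescaling the cutoff. *)
Lemma spectrum_at_origin_diffh (phi : V -> R[i]) D : sch phi -> cintegral phi != 0 ->
  tempered D ->
  (forall psi, sch psi ->
    (exists2 e : R, 0 < e & forall xi, enorm xi < e -> psi xi = 0) ->
    D (fourier psi) = 0) ->
  exists N, forall h f, sch f -> D (iter N (diffh h) f) = 0.
Proof.
move=> sp ip tD DF; have [c c0 Hc] := fourier_inversion sp ip.
have [m [C [C0 HC]]] := tempered_bound tD.
exists (m + 2 * n).+1 => h f sf; set fN := iter _ _ _.
have sN : sch fN by exact: sch_iter_diffh.
have s0 : - (2 * pi) != 0 :> R by rewrite oppr_eq0 mulf_neq0// gt_eqF// pi_gt0.
have [K K0 HK] := Fs_cutoff_small h m s0 sf.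
pose g := Fs (2 * pi) fN.
have sg : sch g by apply: Fs_sch sN; rewrite -oppr_eq0.
pose a : R[i] := (cutoff0)%:C * c.
have a0 : a != 0.
  rewrite mulf_neq0//; apply/eqP => -[e].
  by have := @cutoff0_gt0 R; rewrite e ltxx.
suff : cnorm (a * D fN) <= 0.
  move=> aD; have /eqP : a * D fN = 0.
    by apply: cnorm_eq0; apply/eqP; rewrite eq_le aD cnorm_ge0.
  by rewrite mulf_eq0 (negbTE a0) /= => /eqP.
apply: (@le0_of_small_bound _ _ (C * K)) => e /andP[e0 e1].
have ei : e^-1 != 0 by rewrite invr_neq0// gt_eqF.
pose k (xi : V) := (cutoff (e^-1 *: xi))%:C : R[i].
have sk : sch k by exact: (@sch_scale _ _ (fun y => (cutoff y)%:C) _ ei sch_cutoff).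
have sgk : sch (fun xi => g xi * k xi) by apply: schM => //; exact: sch_tame.
pose psi (xi : V) := g xi * k xi + (- cutoff0)%:C * g xi.
have spsi : sch psi by apply: schD => //; exact: schZ.
(* r is small, and differs from a fN by the transform of psi, which D kills *)
pose r := Fs (- (2 * pi)) (fun xi => g xi * k xi).
have Er : r = fun x => a * fN x + fourier psi x.
  apply/funext => x; rewrite fourierE /Fs.
  transitivity (a * fN x + (r x + (- cutoff0)%:C * fourier g x)).
    by rewrite Hc// /a rmorphN; ring.
  congr (_ + _); rewrite fourierE /r /Fs -cintegralZ -?cintegralD.
  - congr cintegral; apply/funext => y; rewrite /psi; ring.
  - exact: cint_chi (sch_cint sgk).
  - by apply: cintZ; apply: cint_chi; exact: sch_cint.
  - by apply: cint_chi; exact: sch_cint.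
have sF : sch (fourier psi) by rewrite fourierE; exact: Fs_sch.
have <- : D r = a * D fN.
  rewrite Er tempered_lin// DF ?addr0//; exists e => // xi xie.
  rewrite /psi /k cutoff_near0 ?rmorphN; first by ring.
  have -> : sqnorm (e^-1 *: xi) = (e^-1) ^+ 2 * sqnorm xi.
    by rewrite /sqnorm mulr_sumr; apply: eq_bigr => i _; rewrite mxE exprMn.
  rewrite -enorm_sq -exprMn expr_le1// ?mulr_ge0 ?sqrtr_ge0 ?invr_ge0 ?(ltW e0)//.
  by rewrite mulrC ler_pdivrMr// mul1r ltW.
rewrite -mulrA; apply: HC; first exact: Fs_sch.
by have := HK e; rewrite opprK e0 e1; apply.
Qed.

End tempered_distributions.

(** * Means over cubes *)

Section morrey_spaces.
Context {R : realType} {n : nat}.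
Local Notation V := 'rV[R]_n.
Local Notation mu := (lebesgue_rV R n).
Implicit Types (f g : V -> R[i]).

Lemma measurable_cnorm_powR f (q : R) : cmeas f ->
  measurable_fun setT (fun x => cnorm (f x) `^ q : measurableTypeR R).
Proof.
move=> [m1 m2].
apply: (@measurableT_comp _ _ _ _ _ _ (fun u : measurableTypeR R => u `^ q)).
  exact: measurable_powR.
have -> : (fun x => cnorm (f x)) =
    Num.sqrt \o (fun x => complex.Re (f x) ^+ 2 + complex.Im (f x) ^+ 2).
  by apply/funext => x /=; rewrite cnormE.
apply: measurableT_comp; first by apply: continuous_measurable_fun; exact: sqrt_continuous.
by apply: measurable_funD; exact: measurable_funX.
Qed.

Lemma powR_subadditive (a b q : R) : 0 <= a -> 0 <= b -> 0 < q <= 1 ->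
  (a + b) `^ q <= a `^ q + b `^ q.
Proof.
move=> a0 b0 /andP[q0 q1].
have [s0|s0] := eqVneq (a + b) 0.
  by rewrite s0 powR0 ?gt_eqF// addr_ge0 ?powR_ge0.
have sp : 0 < a + b by rewrite lt_neqAle eq_sym s0 addr_ge0.
have H (u : R) : 0 <= u -> u <= a + b -> u / (a + b) * (a + b) `^ q <= u `^ q.
  move=> u0 us; have [->|un] := eqVneq u 0; first by rewrite !mul0r powR_ge0.
  have up : 0 < u by rewrite lt_neqAle eq_sym un.
  have E : u `^ q = (u / (a + b)) `^ q * (a + b) `^ q.
    by rewrite -powRM ?divr_ge0 ?(ltW sp)// divfK.
  rewrite E ler_wpM2r ?powR_ge0// ger1_powR// divr_gt0//=.
  by rewrite ler_pdivrMr// mul1r.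
have Ha := H a a0; have Hb := H b b0.
have <- : a / (a + b) * (a + b) `^ q + b / (a + b) * (a + b) `^ q = (a + b) `^ q.
  by rewrite -mulrDl -mulrDl divff// mul1r.
by apply: lerD; [apply: Ha|apply: Hb]; rewrite ?lerDl ?lerDr.
Qed.

Lemma cnorm_powR_le (a b : R[i]) (q : R) : 0 < q <= 1 ->
  cnorm (a + b) `^ q <= cnorm a `^ q + cnorm b `^ q.
Proof.
move=> q01; apply: le_trans (powR_subadditive (cnorm_ge0 a) (cnorm_ge0 b) q01).
have /andP[q0 _] := q01.
by apply: ge0_ler_powR; rewrite ?(ltW q0)// ?nnegrE ?addr_ge0 ?cnorm_ge0// cnormD.
Qed.

(** No measurability is involved, because the integral of a nonnegative function
    is a supremum over the simple functions below it. Maximal functions, which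
    are suprema of uncountable families, are only met through this comparison. *)
Lemma le_integral_nonneg (D : set V) (f1 f2 : V -> \bar R) :
  (forall x, D x -> 0 <= f1 x)%E -> (forall x, D x -> f1 x <= f2 x)%E ->
  (\int[mu]_(x in D) f1 x <= \int[mu]_(x in D) f2 x)%E.
Proof.
move=> f0 f12.
have f20 x : D x -> (0 <= f2 x)%E by move=> Dx; apply: le_trans (f12 x Dx); exact: f0.
rewrite !ge0_integralE//; apply: le_ereal_sup => _ [h hf <-]; exists h => // x.
apply: (le_trans (hf x)); rewrite /patch; case: ifPn => // /set_mem; exact: f12.
Qed.

(** An N-th difference at x is a combination of the f (x + j h) in which f x has
    coefficient 1 or -1. For q <= 1 the triangle inequality survives as the
    subadditivity of the power q. *)
Lemma iter_diffh_le (q : R) N : 0 < q <= 1 -> exists2 K : R, 0 <= K &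
  forall f h x, cnorm (f x) `^ q <= cnorm (iter N (diffh h) f x) `^ q +
    K * \sum_(j < N) cnorm (f (x + j.+1%:R *: h)) `^ q.
Proof.
move=> q01; elim: N => [|N [K K0 HK]].
  by exists 0 => // f h x; rewrite mul0r addr0.
exists (2 * K + 1) => [|f h x]; first by rewrite addr_ge0// mulr_ge0.
set b := fun j : nat => cnorm (f (x + j%:R *: h)) `^ q.
have b0 j : 0 <= b j by exact: powR_ge0.
have H1 : cnorm (f x) `^ q <= cnorm (diffh h f x) `^ q + b 1%N.
  have := cnorm_powR_le (- diffh h f x) (f (x + h)) q01.
  by rewrite /b scale1r cnormN /diffh opprB addrNK.
have H2 := HK (diffh h f) h x; rewrite -iterSr in H2.
apply: (le_trans H1); apply: (le_trans (lerD H2 (lexx _))).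
rewrite -addrA lerD2l.
pose S := \sum_(j < N.+1) b j.+1; rewrite -[X in _ <= _ * X]/S.
have S1 : \sum_(j < N) b j.+1 <= S by rewrite /S big_ord_recr/= lerDl b0.
have S2 : \sum_(j < N) b j.+2 <= S by rewrite /S big_ord_recl/= lerDr b0.
have S3 : b 1%N <= S by rewrite /S big_ord_recl/= lerDl sumr_ge0// => j _; exact: b0.
have S4 : \sum_(j < N) cnorm (diffh h f (x + j.+1%:R *: h)) `^ q <=
    \sum_(j < N) b j.+2 + \sum_(j < N) b j.+1.
  rewrite -big_split/=; apply: ler_sum => j _.
  have := cnorm_powR_le (f (x + j.+1%:R *: h + h)) (- f (x + j.+1%:R *: h)) q01.
  rewrite cnormN; congr (_ <= cnorm (f _) `^ q + _).
  by rewrite -[j.+2%:R]natr1 scalerDl scale1r addrA.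
have S5 : K * \sum_(j < N) cnorm (diffh h f (x + j.+1%:R *: h)) `^ q <= K * (S + S).
  by rewrite ler_wpM2l//; apply: (le_trans S4); exact: lerD.
by apply: (le_trans (lerD S5 S3)); apply: ler_of_eq; ring.
Qed.

Lemma cube_affine (x c : V) (p r : R) y : 0 < p ->
  cube (x + p *: c) (p * r) (x + p *: y) <-> cube c r y.
Proof.
move=> p0; split=> H i; move: (H i); rewrite !mxE -!addrA !lerD2l -mulrDr.
  by rewrite !ler_pM2l.
by rewrite !ler_pM2l.
Qed.

Lemma integral_cube_affine (F : V -> \bar R) (x c : V) (p r : R) : 0 < p ->
  measurable_fun setT F -> (forall y, 0 <= F y)%E ->
  (\int[mu]_(y in cube c r) F (x + p *: y)%R =
   (p ^- n)%:E * \int[mu]_(y in cube (x + p *: c)%R (p * r)%R) F y)%E.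
Proof.
move=> p0 mF F0; rewrite integral_mkcond [in RHS]integral_mkcond.
have := @integral_affine R n x p (F \_ (cube (x + p *: c) (p * r))) (lt0r_neq0 p0).
rewrite gtr0_norm// => <-; last first.
- by move=> y; rewrite /patch; case: ifP.
- apply/(measurable_restrictT _ _).1; first exact: measurable_cube.
  exact: measurable_funTS.
apply: eq_integral => y _; rewrite /patch; congr (if _ then _ else _).
by apply/idP/idP => /set_mem h; apply/mem_set; move: h => /(cube_affine x c r y p0).
Qed.

(** Averaging over the step h the bound of a function by its translates x + j h,
    which N-th differences being 0 provides, turns mean decay over large cubes
    into pointwise vanishing. *)
Lemma annihilated_by_differences (G : V -> R[i]) (q d B : R) N :
  0 < q <= 1 -> 0 < d -> 0 <= B -> cmeas G ->
  (forall h x, iter N (diffh h) G x = 0) ->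
  (forall c r, 0 < r -> (\int[mu]_(x in cube c r) (cnorm (G x) `^ q)%:E <=
     (B * (r ^+ n * r `^ (- d)))%:E)%E) ->
  forall x, G x = 0.
Proof.
move=> q01 d0 B0 mG GN HB x; have /andP[q0 q1] := q01.
have [K K0 HK] := iter_diffh_le N q01.
pose F y := (cnorm (G y) `^ q)%:E.
have F0 y : (0 <= F y)%E by rewrite lee_fin powR_ge0.
have mF : measurable_fun setT F.
  by apply/measurable_EFinP; exact: measurable_cnorm_powR.
suff : cnorm (G x) `^ q <= 0.
  move=> h; have /eqP : cnorm (G x) `^ q = 0.
    by apply/eqP; rewrite eq_le h powR_ge0.
  by rewrite powR_eq0 => /andP[/eqP/cnorm_eq0].
apply: (@le0_of_small_bound _ _ (K * (N%:R * B))) => t /andP[t0 t1].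
(* large cubes, chosen so that r ^ (- d) = t *)
pose r := t `^ (- d^-1).
have r0 : 0 < r by exact: powR_gt0.
have rd : r `^ (- d) = t.
  by rewrite -powRrM mulrNN mulVf ?gt_eqF// powRr1// ltW.
have rn0 : 0 < r ^+ n by exact: exprn_gt0.
have Fj (j : nat) : (\int[mu]_(h in cube 0 r) F (x + j.+1%:R *: h)%R <=
    (B * (r ^+ n * t))%:E)%E.
  have p0 : 0 < j.+1%:R :> R by rewrite ltr0n.
  have p1 : 1 <= j.+1%:R :> R by rewrite ler1n.
  rewrite integral_cube_affine//.
  apply: (@le_trans _ _ ((j.+1%:R ^- n)%:E * (B * ((j.+1%:R * r) ^+ n * (j.+1%:R * r) `^ (- d)))%:E)%E).
    apply: lee_wpmul2l; first by rewrite lee_fin invr_ge0 exprn_ge0.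
    by apply: HB; rewrite mulr_gt0.
  rewrite -EFinM lee_fin powRM ?ler0n ?(ltW r0)// rd exprMn.
  have pd : j.+1%:R `^ (- d) <= 1 :> R.
    by rewrite -[leRHS](powRr0 j.+1%:R) ler_powR// oppr_le0 ltW.
  rewrite [leLHS](_ : _ = B * (r ^+ n * t) * j.+1%:R `^ (- d)).
    by rewrite ler_piMr// !mulr_ge0// ltW.
  have : (j.+1%:R : R) ^+ n != 0 by rewrite expf_neq0// gt_eqF.
  by move: (_ ^+ n) (_ `^ _) (r ^+ n) => a b e a0; field.
have avg : (((cnorm (G x) `^ q) * r ^+ n)%:E <=
    K%:E * \sum_(j < N) \int[mu]_(h in cube 0 r) F (x + j.+1%:R *: h)%R)%E.
  have mFj (j : nat) : measurable_fun (cube 0 r) (fun h : V => F (x + j.+1%:R *: h)).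
    by apply: measurable_funTS; apply: measurableT_comp => //; exact: measurable_affine.
  rewrite -ge0_integral_sum//; [|exact: measurable_cube].
  rewrite -ge0_integralZl//; [|exact: measurable_cube| |].
  - apply: integral_cube_ge => //; first exact: powR_ge0.
      by apply: measurable_funeM; exact: emeasurable_sum.
    move=> h _; have := HK G h x; rewrite GN cnorm0 powR0 ?gt_eqF// add0r => H.
    by rewrite /F sumEFin -EFinM lee_fin.
  - exact: emeasurable_sum.
  - by move=> h _; exact: sume_ge0.
have : (K%:E * \sum_(j < N) \int[mu]_(h in cube 0 r) F (x + j.+1%:R *: h)%R <=
    (K * (N%:R * B) * t * r ^+ n)%:E)%E.
  apply: (@le_trans _ _ (K%:E * \sum_(j < N) (B * (r ^+ n * t))%:E)%E).
    by apply: lee_wpmul2l => //; apply: lee_sum.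
  rewrite sumEFin sumr_const card_ord -EFinM lee_fin -mulr_natl.
  by apply: ler_of_eq; ring.
by move=> /(le_trans avg); rewrite lee_fin ler_pM2r.
Qed.

(** The Morrey condition on one cube, solved for the integral. The mean over the
    cube is O(r ^ (- n q / lam)), which tends to 0 for large cubes. *)
Lemma morrey_cube_bound (q lam : R) (g : V -> \bar R) (w : V -> R) :
  0 < q -> (morrey_norm q lam g < +oo)%E ->
  (forall x, 0 <= w x) -> (forall x, (w x)%:E <= g x)%E ->
  exists2 B : R, 0 <= B & forall c r, 0 < r ->
  (\int[mu]_(x in cube c r) (w x `^ q)%:E <=
    (B * (r ^+ n * r `^ (- (n%:R * q / lam))))%:E)%E.
Proof.
move=> q0 fin w0 wg.
pose I c r := (\int[mu]_(x in cube c r) poweR `|g x| q)%E.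
have I0 c r : (0 <= I c r)%E by apply: integral_ge0 => x _; exact: poweR_ge0.
have [A A0 HA] : exists2 A : R, 0 <= A & forall c r, 0 < r ->
    (((r ^+ n) `^ (lam^-1 - q^-1))%:E * poweR (I c r) q^-1 <= A%:E)%E.
  have N0 : (0 <= morrey_norm q lam g)%E.
    have H : (poweR (mu (cube 0%R 1%R)) (lam^-1 - q^-1)%R * poweR (I 0%R 1%R) q^-1%R <=
        morrey_norm q lam g)%E.
      by apply: ereal_sup_ubound; exists 0, 1; split; first exact: ltr01.
    by apply: le_trans H; rewrite mule_ge0// poweR_ge0.
  exists (fine (morrey_norm q lam g)); first exact: fine_ge0.
  move=> c r r0; rewrite fineK ?ge0_fin_numE//; apply: ereal_sup_ubound.
  by exists c, r; split=> //; rewrite lebesgue_cube.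
exists (A `^ q) => [|c r r0]; first exact: powR_ge0.
apply: (@le_trans _ _ (I c r)).
  apply: le_integral_nonneg => x _; first by rewrite lee_fin powR_ge0.
  rewrite -poweR_EFin; apply: gt0_ler_poweR; rewrite ?(ltW q0)// ?in_itv/= ?andbT ?lee_fin ?leey ?andbT//.
  by rewrite gee0_abs//; apply: le_trans (wg x); rewrite lee_fin.
set p := (r ^+ n) `^ (lam^-1 - q^-1).
have p0 : 0 < p by rewrite powR_gt0// exprn_gt0.
have Ip : (poweR (I c r) q^-1 <= (A / p)%:E)%E.
  have := HA c r r0; rewrite -/p => h.
  by rewrite mulrC EFinM lee_pdivlMl.
rewrite -[I c r]poweRe1// -(mulVf (lt0r_neq0 q0)) poweRrM.
apply: (@le_trans _ _ (poweR (A / p)%:E q)).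
  apply: gt0_ler_poweR; rewrite ?(ltW q0)// ?in_itv/= ?leey ?andbT ?poweR_ge0//.
  by rewrite lee_fin divr_ge0// ltW.
rewrite poweR_EFin lee_fin powRM ?invr_ge0 ?(ltW p0)//.
rewrite ler_wpM2l ?powR_ge0//; apply: ler_of_eq.
(* the exponent of r is - q n (1 / lam - 1 / q) = n - n q / lam *)
rewrite /p -powR_inv1 ?powR_ge0// -!powRrM -powR_mulrn ?(ltW r0)// -powRrM -powRD.
  congr (_ `^ _).
  by rewrite mulN1r mulrN mulrBl mulVf ?gt_eqF// opprB; ring.
by rewrite (gt_eqF r0) implybT.
Qed.

End morrey_spaces.

(** * Uniqueness in Hardy-Morrey spaces *)

Section uniqueness.
Context {R : realType} {n : nat}.
Local Notation V := 'rV[R]_n.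
Implicit Types (f g : V -> R[i]) (D : (V -> R[i]) -> R[i]).

Lemma seminorm_homo f (m1 m2 : nat) : (m1 <= m2)%N ->
  (schwartz_seminorm m1 f <= schwartz_seminorm m2 f)%E.
Proof.
move=> m12; apply: ge_ereal_sup => _ [a [b [x [am bm ->]]]].
by apply: cnorm_seminorm; exact: leq_trans m12.
Qed.

Lemma temperedB (v w : (V -> R[i]) -> R[i]) : tempered v -> tempered w ->
  tempered (fun f => v f - w f).
Proof.
move=> [lv [m1 [C1 H1]]] [lw [m2 [C2 H2]]]; split=> [c f g sf sg|].
  by rewrite lv// lw//; ring.
exists (maxn m1 m2), (`|C1| + `|C2|) => f sf.
apply: (@le_trans _ _ ((cnorm (v f))%:E + (cnorm (w f))%:E)%E).
  by rewrite -EFinD lee_fin; exact: cnormB.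
have b (C : R) m : (m <= maxn m1 m2)%N -> (C%:E * schwartz_seminorm m f <=
    `|C|%:E * schwartz_seminorm (maxn m1 m2) f)%E.
  move=> hm; apply: (@le_trans _ _ (`|C|%:E * schwartz_seminorm m f)%E).
    by apply: lee_wpmul2r; [exact: seminorm_ge0|rewrite lee_fin ler_norm].
  by apply: lee_wpmul2l => //; exact: seminorm_homo.
rewrite EFinD ge0_muleDl ?lee_fin//; apply: leeD.
  by apply: (le_trans (H1 f sf)); apply: b; exact: leq_maxl.
by apply: (le_trans (H2 f sf)); apply: b; exact: leq_maxr.
Qed.

Lemma iter_diffh_dist_conv D f h N x : tempered D -> sch f ->
  iter N (diffh h) (dist_conv f D) x = dist_conv (iter N (diffh h) f) D x.
Proof.
move=> tD sf; elim: N x => //= N IH x.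
rewrite {1}/diffh !IH /dist_conv -(tempered_sub tD).
- congr (D _); apply/funext => y; rewrite [RHS]/diffh.
  by congr (iter N (diffh h) f _ - _); apply/rowP => l; rewrite !mxE; ring.
- exact: sch_reflect (sch_iter_diffh h N sf).
- exact: sch_reflect (sch_iter_diffh h N sf).
Qed.

Lemma sch_dilate t f : 0 < t -> sch f -> sch (dilate t f).
Proof.
move=> t0 sf; apply: schZ; apply: sch_scale => //.
by rewrite invr_eq0 gt_eqF.
Qed.

Lemma maximal_ge (phi : V -> R[i]) D t x : 0 < t ->
  ((cnorm (dist_conv (dilate t phi) D x))%:E <= maximal phi D x)%E.
Proof. by move=> t0; apply: ereal_sup_ubound; exists t. Qed.

(** Two distributions in a Hardy-Morrey space with the same Fourier transform
    off the origin have the same maximal function: the differences annihilate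
    the mollifications of the difference of the two, whose means over large
    cubes tend to 0. *)
Lemma maximal_unique (phi : V -> R[i]) (q lam : R) v w : (0 < n)%N ->
  sch phi -> cintegral phi != 0 -> 0 < q <= 1 -> 0 < lam ->
  tempered v -> tempered w ->
  (hm_norm phi q lam v < +oo)%E -> (hm_norm phi q lam w < +oo)%E ->
  (forall psi, sch psi ->
    (exists2 e : R, 0 < e & forall xi, enorm xi < e -> psi xi = 0) ->
    v (fourier psi) = w (fourier psi)) ->
  maximal phi v = maximal phi w.
Proof.
move=> n0 sp ip q01 l0 tv tw fv fw vw; have /andP[q0 q1] := q01.
pose D f := v f - w f; have tD : tempered D by exact: temperedB.
have [N HN] : exists N, forall h f, sch f -> D (iter N (diffh h) f) = 0.
  by apply: (spectrum_at_origin_diffh sp ip tD) => psi sps h; rewrite /D vw ?subrr.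
suff H t x : 0 < t -> dist_conv (dilate t phi) v x = dist_conv (dilate t phi) w x.
  apply/funext => x; congr ereal_sup; apply/seteqP; split=> _ [t t0 <-];
    exists t => //; by rewrite H.
move=> t0; set f := dilate t phi; have sf : sch f by exact: sch_dilate.
have cD y : dist_conv f D y = dist_conv f v y - dist_conv f w y by [].
suff : dist_conv f D x = 0 by rewrite cD => /eqP; rewrite subr_eq0 => /eqP.
have [B1 B10 H1] := morrey_cube_bound q0 fv (fun y => cnorm_ge0 (dist_conv f v y))
  (fun y => maximal_ge phi v y t0).
have [B2 B20 H2] := morrey_cube_bound q0 fw (fun y => cnorm_ge0 (dist_conv f w y))
  (fun y => maximal_ge phi w y t0).
have mv : cmeas (dist_conv f v) by exact: dist_conv_cmeas.
have mw : cmeas (dist_conv f w) by exact: dist_conv_cmeas.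
apply: (@annihilated_by_differences _ _ (dist_conv f D) q (n%:R * q / lam)
  (B1 + B2) N) => //.
- by rewrite divr_gt0// mulr_gt0// ltr0n.
- exact: addr_ge0.
- exact: dist_conv_cmeas.
- move=> h y; rewrite iter_diffh_dist_conv// /dist_conv.
  have -> : (fun z => iter N (diffh h) f (y - z)) = iter N (diffh (- h)) (fun z => f (y - z)).
    by rewrite diffh_reflect opprK.
  by apply: HN; exact: sch_reflect.
move=> c r r0.
apply: (@le_trans _ _ (\int[lebesgue_rV R n]_(y in cube c r)
    ((cnorm (dist_conv f v y) `^ q)%:E + (cnorm (dist_conv f w y) `^ q)%:E))%E).
  apply: le_integral_nonneg => y _; first by rewrite lee_fin powR_ge0.
  rewrite -EFinD lee_fin cD.
  by have := cnorm_powR_le (dist_conv f v y) (- dist_conv f w y) q01; rewrite cnormN.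
have mm (g : V -> R[i]) : cmeas g -> measurable_fun (cube c r) (fun y => (cnorm (g y) `^ q)%:E).
  move=> mg; apply: measurable_funTS; apply/measurable_EFinP.
  exact: measurable_cnorm_powR.
rewrite ge0_integralD//; [|exact: measurable_cube| |exact: mm| |exact: mm].
- by rewrite mulrDl EFinD; apply: leeD; [exact: H1|exact: H2].
- by move=> y _; rewrite lee_fin powR_ge0.
- by move=> y _; rewrite lee_fin powR_ge0.
Qed.

End uniqueness.

(** * Decay of maximal functions *)

Section maximal_functions.
Context {R : realType} {n : nat}.
Local Notation V := 'rV[R]_n.
Local Notation mu := (lebesgue_rV R n).
Implicit Types (f g : V -> R[i]).

Definition pairing g : (V -> R[i]) -> R[i] := fun f => cintegral (fun y => f y * g y).

Lemma cint_mul_sch f g : sch f -> sch g -> cint (fun y => f y * g y).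
Proof. by move=> sf sg; apply: sch_cint; apply: schM => //; exact: sch_tame. Qed.

Lemma tempered_pairing g : sch g -> tempered (pairing g).
Proof.
move=> sg; split=> [c f h /schwartz_sch sf /schwartz_sch sh|].
  rewrite /pairing -cintegralZ -?cintegralD; last exact: cint_mul_sch.
  - by congr cintegral; apply/funext => y; rewrite mulrDl mulrA.
  - by apply: cintZ; exact: cint_mul_sch.
  - exact: cint_mul_sch.
have [C C0 HC] := sch_unif 0 (2 * n) sg.
exists 0%N, (2 * C * @decay_mass R n) => f sf.
have mf : (schwartz_seminorm 0 f \is a fin_num)%E.
  by rewrite ge0_fin_numE ?seminorm_ge0//; have [_] := sf; exact.
have z0 : (morder (fun _ : 'I_n => 0%N) <= 0)%N by rewrite /morder big1.
have fK y : cnorm (f y) <= fine (schwartz_seminorm 0 f).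
  rewrite -lee_fin fineK//; have := @cnorm_seminorm _ _ f y _ _ 0 z0 z0.
  rewrite mmonom0 normr1 mul1r; congr ((cnorm (_ y))%:E <= _)%E.
  by rewrite /mpartial; elim: (enum _).
rewrite -(fineK mf); set K := fine _ in fK *; rewrite -EFinM lee_fin.
have sf' := schwartz_sch sf.
rewrite (_ : 2 * C * _ * K = 2 * ((K * C) * @decay_mass R n)); last by ring.
apply: cintegral_decay_le => [|y]; first exact: cmeasM (sch_cmeas sf') (sch_cmeas sg).
by rewrite cnormM -mulrA ler_pM ?cnorm_ge0//; exact: (HC [::]).
Qed.

Lemma dist_conv_pairing f g : dist_conv f (pairing g) = conv f g.
Proof. by []. Qed.

Lemma cintegral_by_parts f g j : sch f -> sch g ->
  cintegral (fun y => f y * partial j g y) = - cintegral (fun y => partial j f y * g y).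
Proof.
move=> sf sg; apply/eqP; rewrite -subr_eq0 opprK -cintegralD.
- have sfg : sch (fun y => f y * g y) by apply: schM => //; exact: sch_tame.
  rewrite -(cintegral_partial j sfg); apply/eqP; congr cintegral; apply/funext => y.
  rewrite (partialM j (sch_cdiff y sf) (sch_cdiff y sg)); exact: addrC.
- exact: cint_mul_sch sf (sch_partial j sg).
- exact: cint_mul_sch (sch_partial j sf) sg.
Qed.

Lemma conv_partial f g j x : sch f -> sch g ->
  conv f (partial j g) x = conv (partial j f) g x.
Proof.
move=> sf sg; have sr := sch_reflect x sf.
rewrite /conv (cintegral_by_parts j sr sg) -mulN1r -cintegralZ; last first.
  exact: cint_mul_sch (sch_partial j sr) sg.
congr cintegral; apply/funext => y; rewrite mulrA; congr (_ * _).
have [_] := partial_affine x (-1) y j (fun z => sch_cdiff z sf).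
have E : (fun y : V => f (x + -1 *: y)) = fun y => f (x - y).
  by apply/funext => z; rewrite scaleN1r.
by rewrite E scaleN1r => ->; rewrite rmorphN rmorph1; ring.
Qed.

Lemma sch_iter_partial j k f : sch f -> sch (iter k (partial j) f).
Proof. by move=> sf; elim: k => //= k; exact: sch_partial. Qed.

Lemma conv_iter_partial f g j k x : sch f -> sch g ->
  conv f (iter k (partial j) g) x = conv (iter k (partial j) f) g x.
Proof.
elim: k f => [|k IH] f sf sg; first by [].
rewrite iterS iterSr (conv_partial j x sf (sch_iter_partial j k sg)).
exact: IH (sch_partial j sf) sg.
Qed.

Lemma partial_dilate f j t : 0 < t -> sch f ->
  partial j (dilate t f) = fun x => (t^-1)%:C * dilate t (partial j f) x.
Proof.
move=> t0 sf; apply/funext => x.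
have [d e] := partial_affine 0 t^-1 x j (fun z => sch_cdiff z sf).
have E : dilate t f = fun y => (t ^- n)%:C * f (0 + t^-1 *: y).
  by apply/funext => y; rewrite add0r.
by rewrite E (partialZ _ _ d) e add0r /dilate; ring.
Qed.

Lemma iter_partial_dilate f j k t : 0 < t -> sch f ->
  iter k (partial j) (dilate t f) =
  fun x => (t ^- k)%:C * dilate t (iter k (partial j) f) x.
Proof.
move=> t0 sf; elim: k => [|k IH].
  by apply/funext => x; rewrite expr0 invr1 mul1r.
have sk := sch_iter_partial j k sf.
rewrite iterS IH; apply/funext => x.
rewrite (partialZ _ _ (sch_cdiff x (sch_dilate t0 sk))) (partial_dilate j t0 sk).
by rewrite mulrA -rmorphM exprSr invfM.
Qed.

Lemma cnorm_dilate t f x : 0 < t -> cnorm (dilate t f x) = t ^- n * cnorm (f (t^-1 *: x)).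
Proof.
by move=> t0; rewrite cnormM cnorm_real ger0_norm// invr_ge0 exprn_ge0// ltW.
Qed.

Lemma conv_dilate t f g x : 0 < t -> sch f -> sch g ->
  conv (dilate t f) g x = cintegral (fun z => g (x - t *: z) * f z).
Proof.
move=> t0 sf sg; have t1 : - t != 0 by rewrite oppr_eq0 gt_eqF.
have := cintegral_affine x t1 (cint_mul_sch (sch_reflect x (sch_dilate t0 sf)) sg).
rewrite normrN gtr0_norm// => E; have tn : (t ^+ n)%:C != 0 :> R[i].
  apply/eqP => -[h]; have := exprn_gt0 n t0; by rewrite h ltxx.
apply: (mulfI (_ : (t ^- n)%:C != 0)); first by rewrite fmorphV invr_neq0.
rewrite -E -cintegralZ.
  congr cintegral; apply/funext => z; rewrite /dilate scaleNr subKr scalerA.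
  by rewrite mulVf ?gt_eqF// scale1r [_ * g _]mulrC !mulrA [_ * g _]mulrC.
have := cint_mul_sch (sch_affine x t1 sg) sf; congr cint; apply/funext => z.
by rewrite scaleNr.
Qed.

(** For small t the mollification inherits the decay of W's derivative; for
    large t the L derivatives are moved to the mollifier, gaining t ^ -L, which
    pays for the spreading of its decay. *)
Lemma maximal_decay (phi W : V -> R[i]) L j : sch phi -> sch W ->
  exists2 C : R, 0 <= C & forall t x, 0 < t ->
  cnorm (conv (dilate t phi) (iter L (partial j) W) x) <= C * decay L x.
Proof.
move=> sp sW; have sU := sch_iter_partial j L sW; set U := iter L _ W in sU *.
have sp' := sch_iter_partial j L sp.
have [a a0 Ha] := sch_unif 0 L sU.
have [b b0 Hb] := sch_unif 0 (L + 2 * n) sp.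
have [a' a'0 Ha'] := sch_unif 0 L sp'.
have [b' b'0 Hb'] := sch_unif 0 (L + 2 * n) sW.
exists (2 * (a * b * @decay_mass R n) + 2 * (a' * b' * @decay_mass R n)).
  by rewrite addr_ge0 ?mulr_ge0 ?decay_mass_ge0.
move=> t x t0; have [t1|t1] := leP t 1; last first.
  apply: (@le_trans _ _ (2 * (a' * b' * @decay_mass R n) * decay L x)); last first.
    by rewrite ler_wpM2r ?decay_ge0// lerDr !mulr_ge0 ?decay_mass_ge0.
  rewrite (conv_iter_partial j L x (sch_dilate t0 sp) sW) (iter_partial_dilate j L t0 sp).
  apply: conv_bound => //; [|exact: sch_cmeas| |exact: (Hb' [::])].
    by apply: schZ; exact: sch_dilate.
  move=> y; rewrite cnormM cnorm_real ger0_norm ?invr_ge0 ?exprn_ge0 ?(ltW t0)//.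
  rewrite cnorm_dilate//.
  have ti : 0 <= t ^- L by rewrite invr_ge0 exprn_ge0// ltW.
  apply: (@le_trans _ _ (t ^- L * (1 * (a' * decay L (t^-1 *: y))))).
    rewrite ler_wpM2l// ler_pM ?cnorm_ge0 ?invr_ge0 ?exprn_ge0 ?(ltW t0)//.
      by rewrite invf_le1 ?exprn_gt0// exprn_ege1// ltW.
    exact: (Ha' [::]).
  rewrite mul1r mulrCA ler_wpM2l// /decay -invfM lef_pV2 ?posrE ?mulr_gt0 ?exprn_gt0 ?ltr_pwDl//.
  rewrite -exprMn lerXn2r ?nnegrE ?mulr_ge0 ?addr_ge0 ?(ltW t0)//.
  by rewrite normrZ gtr0_norm ?invr_gt0// mulrDr mulr1 mulrA divff ?gt_eqF// mul1r lerD2r ltW.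
apply: (@le_trans _ _ (2 * (a * b * @decay_mass R n) * decay L x)); last first.
  by rewrite ler_wpM2r ?decay_ge0// lerDl !mulr_ge0 ?decay_mass_ge0.
rewrite conv_dilate// (_ : _ * decay L x = 2 * ((a * b * decay L x) * @decay_mass R n)); last by ring.
apply: cintegral_decay_le => [|z].
  apply: cmeasM; last exact: sch_cmeas.
  have t1' : - t != 0 by rewrite oppr_eq0 gt_eqF.
  have := sch_cmeas (sch_affine x t1' sU); congr cmeas; apply/funext => z.
  by rewrite scaleNr.
rewrite cnormM.
apply: (@le_trans _ _ ((a * ((1 + `|z|) ^+ L * decay L x)) * (b * decay (L + 2 * n) z))).
  rewrite ler_pM ?cnorm_ge0//; last exact: (Hb [::]).
  apply: (le_trans (Ha [::] _ _)) => //; rewrite ler_wpM2l//.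
  apply: (le_trans (decay_peetre _ _ _)); rewrite ler_wpM2r ?decay_ge0//.
  rewrite lerXn2r ?nnegrE ?addr_ge0// lerD2l normrN normrZ gtr0_norm//.
  by rewrite ler_piMl.
rewrite decayD [decay L z](_ : _ = (1 + `|z|) ^- L)//.
have z0 : (1 + `|z|) ^+ L != 0 by rewrite gt_eqF// exprn_gt0// ltr_pwDl.
move: z0; move: (_ ^+ L) (decay L x) => p d p0; apply: ler_of_eq.
by field.
Qed.

End maximal_functions.

(** * Dilations and Hardy-Morrey quasi-norms *)

Section scaling.
Context {R : realType} {n : nat}.
Local Notation V := 'rV[R]_n.
Local Notation mu := (lebesgue_rV R n).
Implicit Types (f g : V -> R[i]).

Definition zoom (a t : R) g : V -> R[i] := fun y => a%:C * g (t *: y).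

Lemma sch_zoom a t g : 0 < t -> sch g -> sch (zoom a t g).
Proof. by move=> t0 sg; apply: schZ; apply: sch_scale => //; rewrite gt_eqF. Qed.

Lemma conv_zoom a t s f g x : 0 < t -> 0 < s -> sch f -> sch g ->
  conv (dilate s f) (zoom a t g) x = a%:C * conv (dilate (t * s) f) g (t *: x).
Proof.
move=> t0 s0 sf sg; rewrite (conv_dilate x s0 sf (sch_zoom a t0 sg)).
rewrite conv_dilate ?mulr_gt0// -cintegralZ.
  congr cintegral; apply/funext => z; rewrite /zoom mulrA; congr (_ * g _ * _).
  by rewrite scalerBr scalerA.
apply: cint_mul_sch => //.
have ts : - (t * s) != 0 by rewrite oppr_eq0 gt_eqF// mulr_gt0.
have := sch_affine (t *: x) ts sg; congr sch; apply/funext => z.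
by rewrite scaleNr.
Qed.

(** Rescale the cube to the side p = t r. Small cubes are controlled by their
    volume, as 1 / lam >= 0, and large ones by the total mass of the weight, as
    1 / lam <= 1 / q. *)
Lemma morrey_decay (q lam : R) (L : nat) : 0 < q -> q <= lam ->
  (2 * n)%:R <= L%:R * q -> exists2 A : R, 0 <= A &
  forall (C t : R) (g : V -> \bar R), 0 <= C -> 0 < t ->
  (forall x, 0 <= g x)%E -> (forall x, g x <= (C * decay L (t *: x))%:E)%E ->
  (morrey_norm q lam g <= (A * C * t `^ (- (n%:R / lam)))%:E)%E.
Proof.
move=> q0 ql Lq; have l0 : 0 < lam by exact: lt_le_trans ql.
set M := @decay_mass R n; have M0 : 0 <= M by exact: decay_mass_ge0.
exists ((1 + M) `^ q^-1) => [|C t g C0 t0 g0 gC]; first exact: powR_ge0.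
apply: ge_ereal_sup => _ [c [r [r0 ->]]]; rewrite lebesgue_cube//.
pose d (y : V) := (decay L y `^ q)%:E.
have d0 y : (0 <= d y)%E by rewrite lee_fin powR_ge0.
have md : measurable_fun setT d.
  apply/measurable_EFinP.
  apply: (@measurableT_comp _ _ _ _ _ _ (fun u : measurableTypeR R => u `^ q)).
    exact: measurable_powR.
  by apply: continuous_measurable_rV; exact: continuous_decay.
pose p := t * r; have p0 : 0 < p by rewrite mulr_gt0.
have dle y : (d y <= (decay (2 * n) y)%:E)%E.
  rewrite lee_fin /decay -powR_inv1 ?exprn_ge0 ?addr_ge0// -powRrM -powR_mulrn ?addr_ge0//.
  rewrite -powRrM -powR_invn ?addr_ge0//; apply: ler_powR; first by rewrite lerDl.
  by rewrite mulN1r mulrN lerN2.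
have [I [I0 IM Ip EI]] : exists I : R, [/\ 0 <= I, I <= M, I <= p ^+ n &
    (\int[mu]_(y in cube (t *: c)%R p) d y = I%:E)%E].
  set J := (\int[mu]_(y in _) d y)%E.
  have J0 : (0 <= J)%E by apply: integral_ge0 => y _.
  have JM : (J <= M%:E)%E.
    apply: (@le_trans _ _ (\int[mu]_y (decay (2 * n) y)%:E)%E).
      apply: (@le_trans _ _ (\int[mu]_y d y)%E).
        by apply: ge0_subset_integral => //; exact: measurable_cube.
      by apply: le_integral_nonneg => y _.
    rewrite /M /decay_mass /Rintegral fineK//.
    exact: integrable_fin_num (rint_decay (leqnn _)).
  have Jp : (J <= (p ^+ n)%:E)%E.
    rewrite -[p ^+ n]mul1r EFinM -(lebesgue_cube (t *: c) p0).
    rewrite -integral_cst; last exact: measurable_cube.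
    apply: le_integral_nonneg => y _ //.
    by apply: (le_trans (dle y)); rewrite lee_fin; exact: decay_le1.
  have Jf : J \is a fin_num by rewrite ge0_fin_numE//; apply: le_lt_trans JM _; rewrite ltry.
  exists (fine J); split; [exact: fine_ge0| | |by rewrite fineK].
  - by rewrite -lee_fin fineK.
  - by rewrite -lee_fin fineK.
have E1 : (\int[mu]_(x in cube c r) poweR `|g x| q <= (C `^ q * (t ^- n * I))%:E)%E.
  apply: (@le_trans _ _ (\int[mu]_(x in cube c r) ((C `^ q)%:E * d (0 + t *: x)%R))%E).
    apply: le_integral_nonneg => x _; first exact: poweR_ge0.
    rewrite gee0_abs// add0r /d -EFinM -powRM ?decay_ge0// -poweR_EFin.
    apply: gt0_ler_poweR; rewrite ?(ltW q0)// ?in_itv/= ?leey ?andbT//.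
    by rewrite lee_fin mulr_ge0// decay_ge0.
  rewrite ge0_integralZl//; [|exact: measurable_cube| |by rewrite lee_fin powR_ge0].
  - rewrite (integral_cube_affine _ _ _ t0 md d0) add0r EI.
    by rewrite -!EFinM.
  - apply: measurable_funTS; apply: measurableT_comp => //; exact: measurable_affine.
apply: (@le_trans _ _ (poweR (r ^+ n)%:E (lam^-1 - q^-1) *
    poweR (C `^ q * (t ^- n * I))%:E q^-1)%E).
  apply: lee_wpmul2l; first exact: poweR_ge0.
  apply: gt0_ler_poweR => //; rewrite ?invr_ge0 ?(ltW q0)// in_itv/= ?leey ?andbT.
    by apply: integral_ge0 => x _; exact: poweR_ge0.
  by rewrite lee_fin !mulr_ge0 ?powR_ge0// invr_ge0 exprn_ge0// ltW.
rewrite !poweR_EFin -EFinM lee_fin.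
have ti : 0 <= t ^- n by rewrite invr_ge0 exprn_ge0// ltW.
rewrite powRM ?powR_ge0 ?mulr_ge0// powRM// -powRrM divff ?gt_eqF// powRr1//.
(* t ^ (- n / q) splits into t ^ (- n / lam) and the power of t turning r into p *)
have -> : (r ^+ n) `^ (lam^-1 - q^-1) * (C * ((t ^- n) `^ q^-1 * I `^ q^-1)) =
    ((p ^+ n) `^ (lam^-1 - q^-1) * I `^ q^-1) * C * t `^ (- (n%:R / lam)).
  have -> : (t ^- n) `^ q^-1 = (t ^+ n) `^ (lam^-1 - q^-1) * t `^ (- (n%:R / lam)).
    rewrite -powR_invn ?(ltW t0)// -powR_mulrn ?(ltW t0)// -!powRrM -powRD; last first.
      by rewrite (gt_eqF t0) implybT.
    by congr (_ `^ _); ring.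
  rewrite /p exprMn [X in _ = X * _ * _ * _]powRM ?exprn_ge0 ?(ltW t0) ?(ltW r0)//.
  by move: (_ `^ _) (_ `^ _) (_ `^ _) (_ `^ _) => a1 a2 a3 a4; ring.
rewrite !ler_wpM2r ?powR_ge0//.
have e0 : lam^-1 - q^-1 <= 0 by rewrite subr_le0 lef_pV2 ?posrE.
have pn0 : 0 < p ^+ n by exact: exprn_gt0.
have M1 : 1 <= (1 + M) `^ q^-1.
  by rewrite -[leLHS](powRr0 (1 + M)) ler_powR ?lerDl// invr_ge0 ltW.
have [p1|p1] := leP 1 (p ^+ n).
  apply: (@le_trans _ _ (1 * I `^ q^-1)).
    rewrite ler_wpM2r ?powR_ge0// -[leRHS](powRr0 (p ^+ n)); exact: ler_powR.
  rewrite mul1r; apply: ge0_ler_powR; rewrite ?invr_ge0 ?(ltW q0) ?nnegrE ?addr_ge0//.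
  by apply: (le_trans IM); rewrite lerDr.
apply: le_trans M1; apply: (@le_trans _ _ ((p ^+ n) `^ (lam^-1 - q^-1) * (p ^+ n) `^ q^-1)).
  rewrite ler_wpM2l ?powR_ge0//; apply: ge0_ler_powR; rewrite ?invr_ge0 ?(ltW q0) ?nnegrE//.
  exact: ltW.
rewrite -powRD; last by rewrite (gt_eqF pn0) implybT.
rewrite subrK -[leRHS](powRr0 (p ^+ n)); apply: ger_powR; last by rewrite invr_ge0 ltW.
by rewrite pn0 ltW.
Qed.

Lemma morrey_lower (q lam : R) (g : V -> \bar R) (m : R) c r :
  0 < q -> 0 < m -> 0 < r ->
  (forall x, cube c r x -> (m%:E <= g x)%E) ->
  ((m * r `^ (n%:R / lam))%:E <= morrey_norm q lam g)%E.
Proof.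
move=> q0 m0 r0 mg.
apply: (@le_trans _ _ (poweR (mu (cube c r)) (lam^-1 - q^-1)%R *
    poweR (\int[mu]_(x in cube c r) poweR `|g x| q) q^-1%R)%E); last first.
  by apply: ereal_sup_ubound; exists c, r.
have rn0 : 0 < r ^+ n by exact: exprn_gt0.
have H : ((m `^ q * r ^+ n)%:E <= \int[mu]_(x in cube c r) poweR `|g x| q)%E.
  rewrite EFinM -(lebesgue_cube c r0) -integral_cst; last exact: measurable_cube.
  apply: le_integral_nonneg => x xc; first by rewrite lee_fin powR_ge0.
  have g0 : (0 <= g x)%E by apply: le_trans (mg x xc); rewrite lee_fin ltW.
  rewrite gee0_abs// -poweR_EFin.
  apply: gt0_ler_poweR; rewrite ?(ltW q0)// ?in_itv/= ?leey ?andbT ?lee_fin ?(ltW m0)//.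
  exact: mg.
rewrite lebesgue_cube// poweR_EFin.
apply: (@le_trans _ _ (((r ^+ n) `^ (lam^-1 - q^-1))%:E * poweR (m `^ q * r ^+ n)%:E q^-1)%E).
  rewrite poweR_EFin -EFinM lee_fin powRM ?powR_ge0 ?exprn_ge0 ?(ltW r0)//.
  rewrite -[(m `^ q) `^ _]powRrM divff ?gt_eqF// powRr1 ?(ltW m0)//.
  rewrite mulrCA -powRD ?(gt_eqF rn0) ?implybT// subrK.
  by rewrite -powR_mulrn ?(ltW r0)// -powRrM.
apply: lee_wpmul2l; first by rewrite lee_fin powR_ge0.
apply: gt0_ler_poweR => //; rewrite ?invr_ge0 ?(ltW q0)// in_itv/= ?leey ?andbT.
  by rewrite lee_fin mulr_ge0 ?powR_ge0// ltW.
by apply: integral_ge0 => x _; exact: poweR_ge0.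
Qed.

(** The maximal function of a dilate is the dilate of the maximal function. *)
Lemma hm_norm_zoom_le (phi W : V -> R[i]) (q lam : R) (L : nat) j :
  sch phi -> sch W -> 0 < q -> q <= lam -> (2 * n)%:R <= L%:R * q ->
  exists2 A : R, 0 <= A & forall a t, 0 < a -> 0 < t ->
  (hm_norm phi q lam (pairing (zoom a t (iter L (partial j) W))) <=
   (A * a * t `^ (- (n%:R / lam)))%:E)%E.
Proof.
move=> sp sW q0 ql Lq; have [A A0 HA] := morrey_decay q0 ql Lq.
have [C C0 HC] := maximal_decay L j sp sW.
have sU := sch_iter_partial j L sW.
exists (A * C) => [|a t a0 t0]; first exact: mulr_ge0.
rewrite (_ : A * C * a = A * (a * C)); last by ring.
apply: HA => // [|x|x]; first by rewrite mulr_ge0// ltW.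
  apply: le_trans (maximal_ge phi (pairing (zoom a t (iter L (partial j) W))) x ltr01).
  by rewrite lee_fin cnorm_ge0.
apply: ge_ereal_sup => _ [s s0 <-].
rewrite dist_conv_pairing (conv_zoom a x t0 s0 sp sU) lee_fin cnormM cnorm_real.
by rewrite gtr0_norm// -mulrA ler_wpM2l ?(ltW a0)// HC// mulr_gt0.
Qed.

(** Some mollification of g is nonzero at x0, hence bounded below on a cube. The
    dilated cube then gives the lower bound with the exact power of t. *)
Lemma hm_norm_zoom_ge (phi g : V -> R[i]) (q lam : R) x0 :
  sch phi -> cintegral phi != 0 -> sch g -> g x0 != 0 -> 0 < q ->
  exists2 m : R, 0 < m & forall a t, 0 < a -> 0 < t ->
  ((m * a * t `^ (- (n%:R / lam)))%:E <= hm_norm phi q lam (pairing (zoom a t g)))%E.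
Proof.
move=> sp ip sg gx0 q0.
have sr := sch_reflect x0 sg.
(* as s tends to 0 the mollifications tend to g x0 times the integral of phi *)
have [s s0 cs] : exists2 s : R, 0 < s & conv (dilate s phi) g x0 != 0.
  apply: contrapT => H.
  have [K HK] := cintegral_rescale sr sp.
  have : cnorm (g x0 * cintegral phi) <= 0.
    apply: (@le0_of_small_bound _ _ K) => s s01; have /andP[s0 s1] := s01.
    have := HK s s01; rewrite subr0 -conv_dilate//.
    have -> : conv (dilate s phi) g x0 = 0.
      by apply/eqP; apply: contrapT => /negP h; apply: H; exists s.
    by rewrite sub0r cnormN.
  move=> h; have /eqP : g x0 * cintegral phi = 0.
    by apply: cnorm_eq0; apply/eqP; rewrite eq_le h cnorm_ge0.
  by rewrite mulf_eq0 (negbTE gx0) (negbTE ip).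
set G := conv (dilate s phi) g in cs *.
have [cR cI] := dist_conv_continuous (tempered_pairing sg) (sch_dilate s0 sp).
have [u [cu u0 uG]] : exists u : V -> R, [/\ continuous u, 0 < u x0 & forall x, u x <= cnorm (G x)].
  have [R0|R0] := eqVneq (complex.Re (G x0)) 0.
    exists (fun x => `|complex.Im (G x)|); split.
    - move=> x; apply: (@continuous_comp _ _ _ (fun x => complex.Im (G x)) (fun y : R => `|y|)).
        exact: cI.
      exact: norm_continuous.
    - rewrite normr_gt0; apply: contraNN cs => /eqP I0; apply/eqP.
      exact: complex_ext.
    - by move=> x; exact: normr_Im_le.
  exists (fun x => `|complex.Re (G x)|); split.
  - move=> x; apply: (@continuous_comp _ _ _ (fun x => complex.Re (G x)) (fun y : R => `|y|)).
      exact: cR.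
    exact: norm_continuous.
  - by rewrite normr_gt0.
  - by move=> x; exact: normr_Re_le.
have hu : u x0 / 2 < u x0 by rewrite ltr_pdivrMr// ltr_pMr// ltr1n.
have [r r0 Hr] := gt_on_cube cu hu.
have u2 : 0 < u x0 / 2 by rewrite divr_gt0.
exists (u x0 / 2 * r `^ (n%:R / lam)) => [|a t a0 t0].
  by rewrite mulr_gt0// powR_gt0.
have ti : 0 < t^-1 by rewrite invr_gt0.
have := @morrey_lower q lam (maximal phi (pairing (zoom a t g))) (a * (u x0 / 2))
  (t^-1 *: x0) (t^-1 * r) q0.
have -> : a * (u x0 / 2) * (t^-1 * r) `^ (n%:R / lam) =
    u x0 / 2 * r `^ (n%:R / lam) * a * t `^ (- (n%:R / lam)).
  rewrite powRM ?(ltW ti) ?(ltW r0)// -[t^-1]powR_inv1 ?(ltW t0)// -powRrM mulN1r.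
  by move: (_ `^ _) (_ `^ _) => b d; ring.
apply; rewrite ?mulr_gt0// => x cx.
have st : 0 < t^-1 * s by rewrite mulr_gt0.
apply: le_trans (maximal_ge phi (pairing (zoom a t g)) x st).
rewrite dist_conv_pairing (conv_zoom a x t0 st sp sg) lee_fin cnormM cnorm_real.
rewrite gtr0_norm// ler_wpM2l ?(ltW a0)// mulrA divff ?gt_eqF// mul1r.
apply: (le_trans _ (uG _)); apply/ltW; apply: Hr.
have := (cube_affine 0 (t^-1 *: x0) (t^-1 * r) x t0).2 cx.
by rewrite !add0r scalerA mulrA divff ?gt_eqF// scale1r mul1r.
Qed.

End scaling.

(** * Riesz symbols *)

Section riesz_symbols.
Context {R : realType} {n : nat}.
Local Notation V := 'rV[R]_n.
Implicit Types (f g : V -> R).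

Lemma enorm_gt0 (x : V) : x != 0 -> 0 < enorm x.
Proof.
move=> x0; have h : 0 < sqnorm x.
  by apply: lt_le_trans (sqnorm_ge x); rewrite exprn_gt0// normr_gt0.
by rewrite /enorm sqrtr_gt0.
Qed.

Lemma sqnorm_gt0 (x : V) : x != 0 -> 0 < sqnorm x.
Proof. by move=> x0; rewrite -enorm_sq exprn_gt0// enorm_gt0. Qed.

Lemma coord_le_enorm (x : V) i : `|x 0 i| <= enorm x.
Proof.
rewrite -(@ler_pXn2r _ 2)// ?nnegrE ?sqrtr_ge0// enorm_sq real_normK ?num_real//.
by rewrite /sqnorm (bigD1 i)//= lerDl sumr_ge0// => j _; exact: sqr_ge0.
Qed.

Lemma sqnorm_diff (x : V) :
  differentiable sqnorm x /\ forall i, 'D_(basis i) sqnorm x = 2 * x 0 i.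
Proof.
apply: (@expansion_diff _ _ _ _ _ n%:R) => h _.
have -> : sqnorm (x + h) - sqnorm x - linform (fun i => 2 * x 0 i) h =
    \sum_(i < n) h 0 i ^+ 2.
  rewrite /sqnorm /linform -!sumrB; apply: eq_bigr => i _; rewrite mxE; ring.
rewrite ger0_norm; last by apply: sumr_ge0 => i _; exact: sqr_ge0.
apply: (@le_trans _ _ (\sum_(i < n) `|h| ^+ 2)); last first.
  by rewrite sumr_const card_ord mulr_natl.
apply: ler_sum => i _; rewrite -[leLHS]real_normK ?num_real//.
by rewrite lerXn2r ?nnegrE// coord_le_norm.
Qed.

(** Functions built from powers of the squared norm are homogeneous of the
    stated degree, and this class is stable under differentiation off the
    origin: this is how all derivatives of a Riesz symbol are bounded at once. *)
Inductive homogeneous : R -> (V -> R) -> Prop :=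
| homog_pow s m of m = 2 * s : homogeneous m (fun x => sqnorm x `^ s)
| homog_coord j k m f of m = k + 1 & homogeneous k f :
    homogeneous m (fun x => x 0 j * f x)
| homog_add m f g of homogeneous m f & homogeneous m g :
    homogeneous m (fun x => f x + g x)
| homog_scale m c f of homogeneous m f : homogeneous m (fun x => c * f x).

Lemma homogeneous_bound m f : homogeneous m f ->
  exists C : R, forall x, x != 0 -> `|f x| <= C * enorm x `^ m.
Proof.
elim=> {m f} [s m ->|j k m f -> _ [C HC]|m f g _ [C HC] _ [D HD]|m c f _ [C HC]].
- exists 1 => x x0; rewrite mul1r ger0_norm ?powR_ge0//.
  by rewrite -enorm_sq -powR_mulrn ?sqrtr_ge0// -powRrM.
- exists C => x x0; have e0 := enorm_gt0 x0.
  rewrite powRD ?(gt_eqF e0) ?implybT// powRr1 ?(ltW e0)// normrM mulrA [leRHS]mulrC.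
  by apply: ler_pM => //; [exact: coord_le_enorm|exact: HC].
- exists (C + D) => x x0; rewrite mulrDl; apply: (le_trans (ler_normD _ _)).
  by apply: lerD; [exact: HC|exact: HD].
- by exists (`|c| * C) => x x0; rewrite normrM -mulrA ler_wpM2l// HC.
Qed.

Lemma homogeneous_diff m f : homogeneous m f ->
  (forall x, x != 0 -> differentiable f x) /\
  forall i, exists2 g, homogeneous (m - 1) g &
    forall x, x != 0 -> 'D_(basis i) f x = g x.
Proof.
elim=> {m f} [s m ->|j k m f -> hf [df Df]|m f g hf [df Df] hg [dg Dg]|m c f hf [df Df]].
- have H x (x0 : x != 0) := chain_rule (sqnorm_diff x).1 (is_derive1_powR s (sqnorm_gt0 x0)).
  split=> [x x0|i]; first by have [] := H x x0.
  exists (fun x : V => (2 * s) * (x 0 i * sqnorm x `^ (s - 1))).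
    apply: homog_scale; apply: (@homog_coord i (2 * (s - 1))); first by ring.
    exact: homog_pow.
  move=> x x0; have [_ ->] := H x x0; have [_ ->] := sqnorm_diff x; ring.
- split=> [x x0|i].
    by have := @differentiableM _ _ (fun y : V => y 0 j) f x (coord_diff j x).1 (df x x0).
  have [g hg Eg] := Df i.
  exists (fun x : V => (i == j)%:R * f x + x 0 j * g x).
    apply: homog_add; last by apply: (@homog_coord j (k - 1)); first by ring.
    by apply: homog_scale; rewrite addrK.
  move=> x x0; have e := @deriveM _ _ (fun y : V => y 0 j) f x (basis i)
    (diff_derivable (coord_diff j x).1) (diff_derivable (df x x0)).
  apply: (etrans e); rewrite (coord_diff j x).2 (Eg x x0) addrC; congr (_ + _).
  exact: mulrC.
- split=> [x x0|i].
    by have := @differentiableD _ _ _ f g x (df x x0) (dg x x0).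
  have [f' hf' Ef] := Df i; have [g' hg' Eg] := Dg i.
  exists (fun x => f' x + g' x); first exact: homog_add.
  move=> x x0; rewrite -(Ef x x0) -(Eg x x0).
  apply: (@deriveD _ _ _ f g x (basis i)); apply: diff_derivable; [exact: df|exact: dg].
- split=> [x x0|i].
    by have := @differentiableM _ _ (fun=> c) f x (differentiable_cst c x) (df x x0).
  have [g hg Eg] := Df i.
  exists (fun x => c * g x); first exact: homog_scale.
  move=> x x0; rewrite -(Eg x x0).
  have e := @deriveM _ _ (fun=> c) f x (basis i)
    (diff_derivable (differentiable_cst c x)) (diff_derivable (df x x0)).
  apply: (etrans e); rewrite derive_cst scaler0 addr0; reflexivity.
Qed.

(** This is |xi| ^ (- b), through the squared norm, which is smooth at 0 as well. *)
Definition riesz (b : R) (x : V) : R[i] := (sqnorm x `^ (- b / 2))%:C.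

Lemma riesz_symbol (b : R) : symbol_class (- b) (riesz b).
Proof.
have H w : exists2 g, homogeneous (- b - (size w)%:R) g &
    forall x, x != 0 -> foldr partial (riesz b) w x = (g x)%:C.
  elim: w => [|i w [g hg E]].
    exists (fun x : V => sqnorm x `^ (- b / 2)) => //.
    by apply: homog_pow; rewrite subr0 mulrC divfK.
  have [dg /(_ i)[g' hg' Eg]] := homogeneous_diff hg.
  exists g' => [|x x0].
    by move: hg'; congr homogeneous; rewrite /= -natr1; ring.
  have x1 : 0 < `|x| by rewrite normr_gt0.
  have [|_ e] := @cdiff_local _ _ (foldr partial (riesz b) w) (fun y => (g y)%:C) x _ x1 _
    (cdiff_real (dg x x0)).
    move=> h hx; apply: E; apply: contraTneq hx => /eqP; rewrite addrC addr_eq0 => /eqP ->.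
    by rewrite normrN ltxx.
  by rewrite [LHS]e partial_real Eg.
split=> [w x /= x0|a].
  have [g hg E] := H w; have [dg _] := homogeneous_diff hg.
  have x1 : 0 < `|x| by rewrite normr_gt0.
  have [|cd _] := @cdiff_local _ _ (foldr partial (riesz b) w) (fun y => (g y)%:C) x _ x1 _
    (cdiff_real (dg x x0)).
    move=> h hx; apply: E; apply: contraTneq hx => /eqP; rewrite addrC addr_eq0 => /eqP ->.
    by rewrite normrN ltxx.
  exact: cd.
have [w ws ->] := mpartial_word (riesz b) a.
have [g hg E] := H w; have [C HC] := homogeneous_bound hg.
by exists C => x x0; rewrite E// cnorm_real -ws; exact: HC.
Qed.

Lemma sqnormZ (t : R) (x : V) : sqnorm (t *: x) = t ^+ 2 * sqnorm x.
Proof. by rewrite /sqnorm mulr_sumr; apply: eq_bigr => i _; rewrite mxE exprMn. Qed.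

Lemma rieszZ (b t : R) (x : V) : 0 < t -> riesz b (t *: x) = (t `^ (- b))%:C * riesz b x.
Proof.
move=> t0; rewrite /riesz sqnormZ powRM ?sqr_ge0//; last first.
  by apply: sumr_ge0 => i _; exact: sqr_ge0.
rewrite -rmorphM -powR_mulrn ?(ltW t0)// -powRrM; congr ((_ `^ _ * _)%:C).
by rewrite mulrC divfK.
Qed.

(** The frequency localisation is an annulus, where every power of the squared
    norm is smooth; p is that power. *)
Definition annulus (p : R) (x : V) : R := flat p (sqnorm x) * flat 0 (4 - sqnorm x).

Lemma sch_annulus p : sch (fun x => (annulus p x)%:C).
Proof.
apply: (@elementary_sch _ _ _ 2).
  apply: elem_mul; first by apply: elem_flat; exact: elementary_sqnorm.
  apply: elem_flat; rewrite (_ : (fun x => _) = fun x : V => 4 + (-1) * sqnorm x).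
    apply: elem_add; first exact: elem_cst.
    by apply: elem_mul; [exact: elem_cst|exact: elementary_sqnorm].
  by apply/funext => x; rewrite mulN1r.
move=> x x2; rewrite /annulus [flat 0 _]flat_le0 ?mulr0//.
have : 2 ^+ 2 <= `|x| ^+ 2 by rewrite lerXn2r ?nnegrE.
by have := sqnorm_ge x; lra.
Qed.

Lemma riesz_annulus (b : R) x : riesz b x * (annulus 0 x)%:C = (annulus (- b / 2) x)%:C.
Proof.
rewrite -rmorphM /annulus mulrA; congr ((_ * _)%:C).
rewrite /flat; case: ifP => _; last by rewrite mulr0.
by rewrite powRr0 mul1r.
Qed.

Lemma annulus_basis p i : annulus p (basis i) != 0.
Proof.
have -> : annulus p (basis i) = flat p 1 * flat 0 3.
  have E : sqnorm (basis i) = 1 :> R.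
    rewrite /sqnorm (bigD1 i)//= mxE !eqxx expr1n big1 ?addr0// => j /negbTE ji.
    by rewrite mxE ji andbF expr0n.
  by rewrite /annulus E; congr (_ * flat 0 _); ring.
by rewrite mulf_neq0// gt_eqF// flat_gt0.
Qed.

Lemma cint_riesz_mul (b : R) (psi : V -> R[i]) : sch psi ->
  (exists2 e : R, 0 < e & forall xi, enorm xi < e -> psi xi = 0) ->
  cint (fun xi => riesz b xi * psi xi).
Proof.
move=> sp [e e0 pe]; set p := - b / 2.
pose m := Num.bound `|p|.
have pm : p <= m%:R by apply: (le_trans (ler_norm _)); apply/ltW/archi_boundP.
have [C C0 HC] := sch_unif 0 (2 * m + 2 * n) sp.
pose K : R := (e ^+ 2) `^ (- `|p|) + (n.+1%:R) ^+ m.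
have sq (x : V) : sqnorm x <= n%:R * `|x| ^+ 2.
  rewrite mulr_natl -[X in _ *+ X]card_ord -sumr_const; apply: ler_sum => i _.
  by rewrite -[leLHS]real_normK ?num_real// lerXn2r ?nnegrE// coord_le_norm.
have K0 : 0 <= K by rewrite addr_ge0 ?powR_ge0// exprn_ge0.
apply: (@cint_decay _ _ _ (K * C)).
  apply: cmeasM; last exact: sch_cmeas.
  split; last exact: measurable_cst.
  apply: (@measurableT_comp _ _ _ _ _ _ (fun u : measurableTypeR R => u `^ p)).
    exact: measurable_powR.
  apply: continuous_measurable_rV => x; apply: differentiable_continuous.
  exact: (sqnorm_diff x).1.
move=> x; rewrite cnormM; have [xe|ex] := ltP (enorm x) e.
  by rewrite pe// cnorm0 mulr0 !mulr_ge0// decay_ge0.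
have s0 : e ^+ 2 <= sqnorm x.
  by rewrite -enorm_sq lerXn2r ?nnegrE ?sqrtr_ge0// ltW.
have e2 : 0 < e ^+ 2 by rewrite exprn_gt0.
have sx0 : 0 < sqnorm x by apply: lt_le_trans s0.
have d1 : 1 <= (1 + `|x|) ^+ (2 * m) by rewrite exprn_ege1// lerDl.
have key : cnorm (riesz b x) <= K * (1 + `|x|) ^+ (2 * m).
  rewrite /riesz cnorm_real ger0_norm ?powR_ge0// -/p /K mulrDl.
  have [s1|s1] := leP 1 (sqnorm x).
    apply: (@le_trans _ _ (n.+1%:R ^+ m * (1 + `|x|) ^+ (2 * m))); last first.
      by rewrite lerDr mulr_ge0 ?powR_ge0// exprn_ge0// addr_ge0.
    apply: (@le_trans _ _ (sqnorm x `^ m%:R)); first exact: ler_powR.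
    rewrite powR_mulrn ?(ltW sx0)// exprM -exprMn.
    rewrite lerXn2r ?nnegrE ?mulr_ge0 ?sqr_ge0 ?(ltW sx0)//.
    apply: (le_trans (sq x)); apply: ler_pM; rewrite ?ler0n ?sqr_ge0 ?ler_nat//.
    by rewrite lerXn2r ?nnegrE ?addr_ge0// lerDr.
  apply: (@le_trans _ _ ((e ^+ 2) `^ (- `|p|) * (1 + `|x|) ^+ (2 * m))); last first.
    by rewrite lerDl mulr_ge0 ?exprn_ge0// addr_ge0.
  apply: (@le_trans _ _ ((e ^+ 2) `^ (- `|p|))); last by rewrite ler_peMr ?powR_ge0.
  apply: (@le_trans _ _ (sqnorm x `^ (- `|p|))).
    apply: ger_powR; first by rewrite sx0 ltW.
    by rewrite lerNl -normrN ler_norm.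
  rewrite !powRN lef_pV2 ?posrE ?powR_gt0//.
  by apply: ge0_ler_powR; rewrite ?nnegrE ?(ltW e2) ?(ltW sx0).
apply: (le_trans (ler_pM (cnorm_ge0 _) (cnorm_ge0 _) key (HC [::] _ x))) => //.
rewrite decayD [decay (2 * m) x](_ : _ = (1 + `|x|) ^- (2 * m))//.
have z0 : (1 + `|x|) ^+ (2 * m) != 0 by rewrite gt_eqF// exprn_gt0// ltr_pwDl.
move: z0; move: (_ ^+ (2 * m)) => d dn0; apply: ler_of_eq.
by field.
Qed.

End riesz_symbols.

(** * Failure of boundedness *)

Section counterexample.
Context {R : realType} {n : nat}.
Local Notation V := 'rV[R]_n.

Lemma fourier_zoom a t (g : V -> R[i]) xi : 0 < t -> sch g ->
  fourier (zoom a t g) xi = (a * t ^- n)%:C * fourier g (t^-1 *: xi).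
Proof.
move=> t0 sg; rewrite !fourierE.
have t1 : t != 0 by rewrite gt_eqF.
have := Fs_scale (- (2 * pi)) xi t1 (sch_cint sg); rewrite gtr0_norm// => E.
rewrite rmorphM -mulrA -E /Fs -cintegralZ.
  by congr cintegral; apply/funext => x; rewrite /zoom mulrCA.
by apply: cint_chi; apply: sch_cint; apply: sch_scale.
Qed.

Lemma pairing_fourier (f g : V -> R[i]) : cint f -> cint g ->
  pairing g (fourier f) = cintegral (fun y => f y * fourier g y).
Proof. by move=> cf cg; rewrite /pairing !fourierE; exact: multiplication_formula. Qed.

(** Multiplication by the symbol on the frequency side is dilation covariant:
    if it carries u to v, it carries the dilates of u to t ^ (- b) times those
    of v. *)
Lemma riesz_zoom (b t : R) (u v psi : V -> R[i]) : 0 < t -> sch u -> sch v ->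
  (forall xi, riesz b xi * fourier u xi = fourier v xi) -> sch psi ->
  (exists2 e : R, 0 < e & forall xi, enorm xi < e -> psi xi = 0) ->
  pairing (zoom 1 t u) (fourier (fun xi => riesz b xi * psi xi)) =
  pairing (zoom (t `^ (- b)) t v) (fourier psi).
Proof.
move=> t0 su sv uv sp pe.
rewrite pairing_fourier; [|exact: cint_riesz_mul|exact: sch_cint (sch_zoom 1 t0 su)].
rewrite pairing_fourier; [|exact: sch_cint|exact: sch_cint (sch_zoom _ t0 sv)].
congr cintegral; apply/funext => xi.
rewrite !fourier_zoom// -uv mul1r -{1}[xi](_ : t *: (t^-1 *: xi) = xi).
  by rewrite rieszZ// rmorphM; ring.
by rewrite scalerA divff ?gt_eqF// scale1r.
Qed.

Lemma not_bounded_powR (e K : R) : e != 0 -> exists2 t : R, 0 < t & K < t `^ e.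
Proof.
move=> e0; have K1 : 0 < `|K| + 1 by rewrite ltr_pwDr.
exists ((`|K| + 1) `^ e^-1); first exact: powR_gt0.
rewrite -powRrM mulVf// powRr1 ?(ltW K1)//.
by apply: le_lt_trans (ler_norm K) _; rewrite ltrDl.
Qed.

(** Both functions are L-fold derivatives, whose decay beats any given q for L
    large; on the frequency side they are supported in the annulus, where the
    symbol acts as a change of the exponent p. *)
Lemma riesz_test_functions (phi : V -> R[i]) (beta : R) (j : 'I_n) (L : nat) :
  sch phi -> cintegral phi != 0 ->
  exists u v : V -> R[i],
  [/\ sch u /\ sch v,
      forall xi, riesz beta xi * fourier u xi = fourier v xi,
      exists x, v x != 0 &
      forall q lam, 0 < q -> q <= lam -> (2 * n)%:R <= L%:R * q ->
        exists2 A : R, 0 <= A & forall a t, 0 < a -> 0 < t ->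
        (hm_norm phi q lam (pairing (zoom a t u)) <=
         (A * a * t `^ (- (n%:R / lam)))%:E)%E /\
        (hm_norm phi q lam (pairing (zoom a t v)) <=
         (A * a * t `^ (- (n%:R / lam)))%:E)%E].
Proof.
move=> sp ip; have s0 : 2 * pi != 0 :> R by rewrite mulf_neq0// gt_eqF// pi_gt0.
have [c c0 Hc] := fourier_inversion sp ip.
pose W p := Fs (2 * pi) (fun x : V => (annulus p x)%:C).
have sW p : sch (W p) by exact: Fs_sch s0 (sch_annulus p).
pose U p := iter L (partial j) (W p).
have sU p : sch (U p) by exact: sch_iter_partial.
have FU p xi : fourier (U p) xi =
    (- (- (2 * pi) * xi 0 j)*i) ^+ L * (c * (annulus p xi)%:C).
  rewrite fourierE (Fs_iter_partial _ _ _ _ (sW p)) -fourierE.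
  by rewrite (Hc _ (sch_annulus p)).
set b := - beta / 2.
exists (U 0), (U b); split; first by split.
- move=> xi; have E := riesz_annulus beta xi.
  apply: (etrans (congr1 (fun z => riesz beta xi * z) (FU 0 xi))).
  apply: (etrans _ (esym (FU b xi))).
  move: E; rewrite -/b; move: (riesz beta xi) (_ ^+ L) (annulus 0 xi)%:C => x y z <-.
  by rewrite (mulrCA x y) (mulrCA x c).
- apply: contrapT => H.
  have U0 : U b = fun=> 0.
    apply/funext => x; apply/eqP; apply: contrapT => /negP h; apply: H; by exists x.
  have : fourier (U b) (basis j) = 0.
    rewrite U0 -[RHS](@cintegral0 R n); congr cintegral; apply/funext => x.
    by rewrite mulr0.
  move=> /eqP; rewrite FU !mulf_eq0 (negbTE c0) /= => /orP[|/eqP[]]; last first.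
    by move=> h; have := annulus_basis b j; rewrite h eqxx.
  rewrite expf_eq0 => /andP[_ /eqP].
  move=> /(congr1 (@complex.Im R))/=; rewrite mxE !eqxx mulr1.
  by move=> /eqP; rewrite oppr_eq0 oppr_eq0 (negbTE s0).
- move=> q lam q0 ql Lq.
  have [A A0 HA] := hm_norm_zoom_le j sp (sW 0) q0 ql Lq.
  have [B B0 HB] := hm_norm_zoom_le j sp (sW b) q0 ql Lq.
  exists (A + B) => [|a t a0 t0]; first exact: addr_ge0.
  have tp : 0 <= t `^ (- (n%:R / lam)) by exact: powR_ge0.
  split; [apply: (le_trans (HA a t a0 t0))|apply: (le_trans (HB a t a0 t0))];
    by rewrite lee_fin ler_wpM2r// ler_wpM2r ?(ltW a0)// ?lerDl ?lerDr.
Qed.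

End counterexample.

Theorem proposition3p7 (R : realType) (n : nat) (n_gt0 : (0 < n)%N)
    (phi : 'rV[R]_n -> R[i])
    (phi_schwartz : schwartz phi) (phi_int : cintegral phi != 0)
    (q1 q2 lam1 lam2 beta : R)
    (hq1 : 0 < q1 <= 1) (hq2 : 0 < q2 <= 1)
    (hlam1 : q1 <= lam1 <= 1) (hlam2 : q2 <= lam2)
    (hq : q2 / lam2 = q1 / lam1)
    (hbeta : beta <> n%:R * (lam1^-1 - lam2^-1)) :
  exists2 sigma : 'rV[R]_n -> R[i],
    symbol_class (- beta) sigma &
    ~ hm_continuous phi q1 lam1 q2 lam2 sigma.
Proof.
exists (riesz beta); first exact: riesz_symbol.
case=> C C0 HC.
have sp := schwartz_sch phi_schwartz.
have /andP[q10 _] := hq1; have /andP[q20 _] := hq2; have /andP[ql1 _] := hlam1.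
have l20 : 0 < lam2 by exact: lt_le_trans hlam2.
pose j : 'I_n := Ordinal n_gt0.
(* integrability of the power q of a decay of order L, for both exponents *)
pose L := (Num.bound ((2 * n)%:R / q1) + Num.bound ((2 * n)%:R / q2))%N.
have bound (q : R) (k : nat) : 0 < q -> (Num.bound ((2 * n)%:R / q) <= k)%N ->
    (2 * n)%:R <= k%:R * q.
  move=> q0 kq; rewrite -ler_pdivrMr//.
  apply: (@le_trans _ _ (Num.bound ((2 * n)%:R / q))%:R); last by rewrite ler_nat.
  by apply/ltW/archi_boundP; rewrite divr_ge0// ltW.
have Lq1 : (2 * n)%:R <= L%:R * q1 by apply: bound => //; exact: leq_addr.
have Lq2 : (2 * n)%:R <= L%:R * q2 by apply: bound => //; exact: leq_addl.
have [u [v [[su sv] uv [x0 vx0] Huv]]] := riesz_test_functions beta j L sp phi_int.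
have [A A0 HA] := Huv _ _ q10 ql1 Lq1.
have [A2 _ HA2] := Huv _ _ q20 hlam2 Lq2.
have [m m0 Hm] := hm_norm_zoom_ge lam2 sp phi_int sv vx0 q20.
have key t : 0 < t -> m * t `^ (- beta) * t `^ (- (n%:R / lam2)) <=
    C * (A * t `^ (- (n%:R / lam1))).
  move=> t0.
  pose a := t `^ (- beta); have a0 : 0 < a by exact: powR_gt0.
  have [hu _] := HA 1 t ltr01 t0; have [_ hv] := HA2 a t a0 t0.
  have tu := tempered_pairing (sch_zoom 1 t0 su).
  have tv := tempered_pairing (sch_zoom a t0 sv).
  have [w [tw fw] [mw nw]] := HC _ (conj tu (le_lt_trans hu (ltry _))).
  (* w is only prescribed off the frequency 0, but the space leaves no choice *)
  have E : maximal phi w = maximal phi (pairing (zoom a t v)).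
    apply: (maximal_unique n_gt0 sp phi_int hq2 l20 tw tv fw (le_lt_trans hv (ltry _))).
    move=> psi spsi pe; rewrite -(riesz_zoom t0 su sv uv spsi pe).
    exact: (mw psi (sch_schwartz spsi) pe).
  have h1 := Hm a t a0 t0; rewrite /hm_norm -E in h1.
  have h2 : (C%:E * hm_norm phi q1 lam1 (pairing (zoom 1%R t u)) <=
      (C * (A * t `^ (- (n%:R / lam1))))%:E)%E.
    rewrite [leRHS]EFinM; apply: lee_wpmul2l; first by rewrite lee_fin ltW.
    by rewrite mulr1 in hu.
  by have := le_trans h1 (le_trans nw h2); rewrite lee_fin.
pose e := - beta - n%:R / lam2 + n%:R / lam1.
have e0 : e != 0.
  apply/eqP => h; apply: hbeta.
  have -> : beta = n%:R * (lam1^-1 - lam2^-1) - e by rewrite /e; ring.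
  by rewrite h subr0.
have [t t0 Kt] := not_bounded_powR (C * A / m) e0.
have := key t t0; apply/negP; rewrite -ltNge.
have tE : t `^ e = t `^ (- beta) * t `^ (- (n%:R / lam2)) * t `^ (n%:R / lam1).
  by rewrite -!powRD// (gt_eqF t0) implybT.
have tl : 0 < t `^ (n%:R / lam1) by exact: powR_gt0.
rewrite [t `^ (- (n%:R / lam1))]powRN mulrA ltr_pdivrMr//.
by move: Kt; rewrite ltr_pdivrMr// tE; congr (_ < _); ring.
Qed.
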